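(* Let $\lambda\in(0,\infty)$ and suppose that the random variable $\alpha$ with values in $(0,1)$ has a probability density of the form $\psi(x)(1-x)^{\beta}$, $x\in(0,1)$, where $\psi$ is a function on $(0,1)$ having a limit $\lim_{x\uparrow 1}\psi(x)=\psi_1\in(0,\infty)$. Let $\widetilde S^{(N,n)}$ be the doubly aggregated, conditionally centered partial sum process of independent copies of the randomized INAR(1) process with Poisson innovations (defined in the context). If $\beta\in(1,\infty)$, then $$\mathcal D_{\mathrm f}\text{-}\lim_{n\to\infty}\ \mathcal D_{\mathrm f}\text{-}\lim_{N\to\infty}\ (nN)^{-\frac12}\widetilde S^{(N,n)}=\mathcal D_{\mathrm f}\text{-}\lim_{N\to\infty}\ \mathcal D_{\mathrm f}\text{-}\lim_{n\to\infty}\ (nN)^{-\frac12}\widetilde S^{(N,n)}=\sigma B,$$ where $\sigma^2:=\lambda\,\mathbb E\bigl((1+\alpha)(1-\alpha)^{-2}\bigr)$ and $B=(B_t)_{t\in[0,\infty)}$ is a standard Wiener process.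
   Context: Randomized INAR(1) process: let $\lambda\in(0,\infty)$ and let $\alpha$ be a random variable with values in $(0,1)$. Let $X_0$, $\xi_{k,j}$, $\varepsilon_k$ ($k,j\in\mathbb N=\{1,2,\dots\}$) be random variables which are conditionally independent given $\alpha$ and such that, conditionally on $\alpha$, each $\xi_{k,j}$ is Bernoulli with $\mathbb P(\xi_{k,j}=1\mid\alpha)=\alpha=1-\mathbb P(\xi_{k,j}=0\mid\alpha)$, each $\varepsilon_k$ is Poisson with parameter $\lambda$, and $X_0$ is Poisson with parameter $\lambda/(1-\alpha)$. Define $X_k=\sum_{j=1}^{X_{k-1}}\xi_{k,j}+\varepsilon_k$, $k\in\mathbb N$ (with $\sum_{j=1}^0:=0$). Let $(\alpha^{(j)},(X^{(j)}_k)_{k\in\mathbb Z_+})$, $j\in\mathbb N$, be independent copies of $(\alpha,(X_k)_{k\in\mathbb Z_+})$, where $\mathbb Z_+=\{0,1,2,\dots\}$. Conditional expectations are in the generalized sense, and $\mathbb E(X_k\mid\alpha)=\lambda/(1-\alpha)$. For $N,n\in\mathbb N$ set $\widetilde S^{(N,n)}_t:=\sum_{j=1}^N\sum_{k=1}^{\lfloor nt\rfloor}\bigl(X^{(j)}_k-\mathbb E(X^{(j)}_k\mid\alpha^{(j)})\bigr)=\sum_{j=1}^N\sum_{k=1}^{\lfloor nt\rfloor}\bigl(X^{(j)}_k-\frac{\lambda}{1-\alpha^{(j)}}\bigr)$, $t\in[0,\infty)$. $\mathcal D_{\mathrm f}\text{-}\lim$ denotes weak convergence of finite dimensional distributions.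 In an iterated limit the inner (right-hand) limit is taken first with the other index fixed (and is asserted to exist), and then the resulting limit processes converge in finite dimensional distributions, as the outer index tends to infinity, to the stated process. *)

(* Defs.v *)
From HB Require Import structures.
From mathcomp Require Import all_boot all_order all_algebra.
From mathcomp Require Import all_classical all_reals all_analysis.
From mathcomp Require Import measurable_realfun.

Set Implicit Arguments.
Unset Strict Implicit.
Unset Printing Implicit Defensive.

Import Order.TTheory GRing.Theory Num.Theory.
Import numFieldNormedType.Exports.

Local Open Scope classical_set_scope.
Local Open Scope ring_scope.

Section conditioning.
Context d (T : measurableType d) (R : realType) (P : probability T R).

(* [f] is a version of E(Y | alpha): it is measurable for
   sigma(alpha) = {alpha^-1(B) : B Borel} and has the same integral as Y on
   every event of sigma(alpha). The integrals are extended-real valued, so that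
   for Y >= 0 this is the generalized conditional expectation (no integrability
   of Y is required). *)
Definition cond_exp (alpha Y f : T -> R) : Prop :=
  (forall U : set R, measurable U -> g_sigma_algebra_preimage alpha (f @^-1` U))
  /\ (forall B : set R, measurable B ->
      (\int[P]_(w in alpha @^-1` B) (Y w)%:E
       = \int[P]_(w in alpha @^-1` B) (f w)%:E)%E).

Definition cond_prob (alpha : T -> R) (A : set T) (f : T -> R) : Prop :=
  cond_exp alpha (\1_A) f.

Definition cond_pmf (alpha : T -> R) (Z : T -> nat) (q : R -> nat -> R) : Prop :=
  forall z, cond_prob alpha [set w | Z w = z] (fun w => q (alpha w) z).

(* Versions of conditional probabilities exist and are almost surely unique, so
   it does not matter which versions [f i] are taken. *)
Definition cond_independent d' (T' : measurableType d') (I : choiceType)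
    (alpha : T -> R) (Z : I -> T -> T') : Prop :=
  forall (s : seq I) (A : I -> set T') (f : I -> T -> R), uniq s ->
    (forall i, measurable (A i)) ->
    (forall i, i \in s -> cond_prob alpha (Z i @^-1` A i) (f i)) ->
    cond_prob alpha (\bigcap_(i in [set` s]) (Z i @^-1` A i))
      (fun w => \prod_(i <- s) f i w).

Definition mutually_independent d' (T' : measurableType d') (I : choiceType)
    (Z : I -> T -> T') : Prop :=
  forall (s : seq I) (A : I -> set T'), uniq s ->
    (forall i, measurable (A i)) ->
    P (\bigcap_(i in [set` s]) (Z i @^-1` A i))
    = (\prod_(i <- s) P (Z i @^-1` A i))%E.

Definition has_density01 (alpha : T -> R) (h : R -> R) : Prop :=
  [/\ measurable_fun (`]0, 1[ : set R) h,
      forall x, 0 < x < 1 -> 0 <= h x &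
      forall A : set R, measurable A ->
        P (alpha @^-1` A)
        = (\int[lebesgue_measure]_(x in A `&` `]0%R, 1%R[) (h x)%:E)%E].

End conditioning.

Section INAR.
Context d (T : measurableType d) (R : realType) (P : probability T R).

Definition inar_inputs (X0 : T -> nat) (xi : nat -> nat -> T -> nat)
    (eps : nat -> T -> nat) (i : unit + (nat * nat) + nat) : T -> nat :=
  match i with
  | inl (inl tt) => X0
  | inl (inr (k, j)) => xi k j
  | inr k => eps k
  end.

(* The variables xi_{k,j} and eps_k are shifted to start at index 0: [xi k j] is
   xi_{k+1,j+1} and [eps k] is eps_{k+1}; [X k] is X_k. *)
Record randomized_INAR1 (lambda : R) (alpha : {RV P >-> R})
    (xi : nat -> nat -> {RV P >-> nat}) (eps : nat -> {RV P >-> nat})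
    (X : nat -> {RV P >-> nat}) : Prop := {
  inar_alpha : forall w, 0 < alpha w < 1;
  inar_cond_independent :
    cond_independent P alpha (inar_inputs (X 0) (fun k j => xi k j) eps);
  inar_xi1 : forall k j, cond_prob P alpha [set w | xi k j w = 1%N] alpha;
  inar_xi0 : forall k j,
    cond_prob P alpha [set w | xi k j w = 0%N] (fun w => 1 - alpha w);
  inar_eps : forall k, cond_pmf P alpha (eps k) (fun=> poisson_pmf lambda);
  inar_init :
    cond_pmf P alpha (X 0) (fun a => poisson_pmf (lambda / (1 - a)));
  inar_step : forall k w,
    X k.+1 w = ((\sum_(j < X k w) xi k j w) + eps k w)%N }.

End INAR.

Definition path_cylinders : set (set (nat -> nat)) :=
  [set C | exists (k : nat) (B : set nat), C = [set x | B (x k)]].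

Definition path_space := g_sigma_algebraType path_cylinders.

Section copies.
Context d0 (T0 : measurableType d0) d (T : measurableType d) (R : realType).
Context (P0 : probability T0 R) (P : probability T R).

Definition alpha_path d' (T' : measurableType d') (alpha : T' -> R)
  (X : nat -> T' -> nat) : T' -> (R * path_space)%type :=
  fun w => (alpha w, fun k => X k w).

Definition independent_copies (alpha : {RV P0 >-> R})
    (X : nat -> {RV P0 >-> nat}) (alpha_ : nat -> {RV P >-> R})
    (X_ : nat -> nat -> {RV P >-> nat}) : Prop :=
  (forall (j : nat) (A : set (R * path_space)), measurable A ->
     P (alpha_path (alpha_ j) (X_ j) @^-1` A) = P0 (alpha_path alpha X @^-1` A))
  /\ mutually_independent P (fun j => alpha_path (alpha_ j) (X_ j)).

End copies.

(* The time set is [0, +oo[: the values at t < 0 are never used. *)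
Record process (R : realType) := Process {
  pr_display : measure_display;
  pr_space : measurableType pr_display;
  pr_prob : probability pr_space R;
  pr_rv :> R -> {RV pr_prob >-> R} }.

Arguments Process {R pr_display pr_space} pr_prob pr_rv.

Section processes.
Context (R : realType).

Definition fdd (X : process R) (m : nat) (t : 'I_m -> R) :
  pr_space X -> 'rV[R]_m := fun w => \row_i X (t i) w.

Arguments fdd X [m] t _.

Definition fdd_cvg (X : nat -> process R) (Y : process R) : Prop :=
  forall (m : nat) (t : 'I_m -> R) (f : 'rV[R]_m -> R),
    (forall i, 0 <= t i) -> continuous f ->
    (exists M, forall x, `|f x| <= M) ->
    ('E_(pr_prob (X n))[f \o fdd (X n) t] @[n --> \oo]
       --> 'E_(pr_prob Y)[f \o fdd Y t])%E.

(* D_f-lim_a D_f-lim_b X a b = Y with both indices running over {1, 2, ...}: for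
   each fixed a >= 1 the inner limit exists as a process. *)
Definition iterated_fdd_lim (X : nat -> nat -> process R) (Y : process R) :
    Prop :=
  exists Z : nat -> process R,
    (forall a, (0 < a)%N -> fdd_cvg (X a) (Z a)) /\ fdd_cvg Z Y.

Definition standard_wiener (W : process R) : Prop :=
  [/\ {ae pr_prob W, forall w, W 0 w = 0},
      forall s t, 0 <= s -> s < t -> forall A : set R, measurable A ->
        pr_prob W ((W t \- W s) @^-1` A) = normal_prob 0 (Num.sqrt (t - s)) A,
      forall (m : nat) (t : nat -> R), 0 <= t 0 -> nondecreasing_seq t ->
        mutually_independent (pr_prob W)
          (fun i : 'I_m => (W (t i.+1) \- W (t i) : pr_space W -> R)) &
      {ae pr_prob W, forall w, {within `[0, +oo[, continuous (W ^~ w)}}].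

Definition scale_process (c : R) (W : process R) : process R :=
  Process (pr_prob W) (fun t => c \o* W t : {mfun pr_space W >-> R}).

End processes.

Section aggregation.
Context d (T : measurableType d) (R : realType) (P : probability T R).
Context (X_ : nat -> nat -> {RV P >-> nat}) (m_ : nat -> nat -> {RV P >-> R}).

(* The copies are numbered from 0; [m_ j k] stands for a version of
   E(X_ j k | alpha_ j). On t >= 0, [Num.truncn] is the floor. *)
Definition partial_sum (N n : nat) (t : R) (w : T) : R :=
  \sum_(j < N) \sum_(1 <= k < (Num.truncn (n%:R * t)).+1)
    ((X_ j k w)%:R - m_ j k w).

Fact measurable_partial_sum N n t :
  measurable_fun [set: T] (partial_sum N n t).
Proof.
apply: measurable_sum => j; apply: measurable_sum => k.
by apply: measurable_funB => //; exact: measurableT_comp.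
Qed.

Definition aggregated (N n : nat) : process R :=
  Process P (fun t => mfun_Sub (mem_set (measurable_partial_sum N n t))).

End aggregation.

(* Main.v *)
Require Import Defs.
From HB Require Import structures.
From mathcomp Require Import all_boot all_order all_algebra.
From mathcomp Require Import all_classical all_reals all_analysis.
From mathcomp Require Import measurable_realfun complex ring lra.

Set Implicit Arguments.
Unset Strict Implicit.
Unset Printing Implicit Defensive.

Import Order.TTheory GRing.Theory Num.Theory.
Import numFieldNormedType.Exports.

Local Open Scope classical_set_scope.
Local Open Scope ring_scope.
Local Open Scope complex_scope.
Import ComplexField.Normc.
Local Notation Re := complex.Re.
Local Notation Im := complex.Im.


(** Everything is done with characteristic functions, with values in [R[i]].

Fix a value [a] of [alpha]. The chain is then a Poisson autoregression started
from its stationary law, and integrating out its last value, given the previous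
one, turns the generating function of the path into one of the same form
([path_gf]). So [E exp (i \sum_k th_k (X_k - E (X_k | alpha)))] is the mean of
[exp (logchar th alpha)], where the exponent [logchar] is given by an explicit
recursion with phases [th] ([centred_charf]). To second order the exponent is
minus half the conditional variance
[lambda / (1 - a) * \sum_(k, l) th_k th_l a ^ |k - l|]
([logchar_cvar]). For the phases of a linear combination of partial sums,
normalized by [n ^ (-1/2)], the conditional variance converges to
[lambda (1 + a) / (1 - a) ^ 2] times the variance of the same linear combination
of values of a standard Wiener process ([quad_steps_cvg]). Both quantities are
bounded by a multiple of [(1 - a) ^ (-2)], which is integrable because the density
vanishes at [1] with an exponent [beta > 1] ([itg_inv1B_square]).

The copies are independent, so the characteristic function of [N] copies is the
[N]-th power of such a mean ([copies_charf]). This uses that the given versions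
of the conditional means equal [lambda / (1 - alpha)] almost surely
([copies_cond_mean]).

If the number of copies grows first, the [N]-th power converges to the exponential
of the averaged exponent ([cvg_mean_power]): the limit for a fixed [n] consists of
normalized partial sums of a Gaussian sequence with the covariances
[E (lambda alpha ^ |k - l| / (1 - alpha))]. Such a sequence is obtained from the
increments of [B] by a Cholesky factorization ([gaussian_from_wiener]). Then the
variances of the partial sums converge by dominated convergence. If the horizon
grows first, the limit for a fixed [N] is a Wiener process multiplied by the square
root of the average of [lambda (1 + alpha) / (1 - alpha) ^ 2] over the copies,
independent of it, and this average becomes deterministic.

Convergence of characteristic functions is turned into weak convergence of finite
dimensional distributions by [fdd_cvg_charf]: a continuous bounded function is
approximated on a large cube by a trigonometric polynomial that remains bounded
outside of the cube, and the mass outside is controlled by a quadratic bound on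
the characteristic functions at the origin, uniform in [n] and [N]
([phi_stepw_bound]). *)

(** * Elementary bounds and limits *)
Section real_trig.
Context {R : realType}.
Implicit Types x y : R.

(** The Taylor bounds below follow from one another by comparing derivatives on the
half line. *)
Lemma nonneg_of_derive (f f' : R -> R) :
  (forall x, is_derive x 1 f (f' x)) -> f 0 = 0 ->
  (forall x, 0 < x -> 0 <= f' x) -> forall x, 0 <= x -> 0 <= f x.
Proof.
move=> df f0 f'0 x x0; rewrite -f0.
have drv y : derivable f y 1 by have [] := df y.
apply: (@ger0_derive1_ndecry _ f 0) => //.
- move=> y; rewrite in_itv/= andbT => y0.
  by rewrite derive1E; have [_ ->] := df y; exact: f'0.
- apply: continuous_subspaceT => y.
  by apply: differentiable_continuous; apply/derivable1_diffP.
Qed.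

Lemma sin_le_id x : 0 <= x -> sin x <= x.
Proof.
move=> x0; rewrite -subr_ge0.
apply: (@nonneg_of_derive (fun z => z - sin z) (fun z => 1 - cos z)) => //.
- by rewrite sin0 subrr.
Qed.

Lemma cos_ge_quad x : 1 - x ^+ 2 / 2 <= cos x.
Proof.
wlog x0 : x / 0 <= x.
  move=> H; have [x0|/ltW x0] := leP 0 x; first exact: H.
  by have := H (- x); rewrite cosN sqrrN oppr_ge0; apply.
rewrite -subr_ge0.
apply: (@nonneg_of_derive (fun z => cos z - (1 - z ^+ 2 / 2)) (fun z => z - sin z)) => //.
- move=> z; apply: is_derive_eq.
  rewrite /GRing.scale /=; lra.
- by rewrite cos0; lra.
- by move=> z /ltW z0; rewrite subr_ge0 sin_le_id.
Qed.

Lemma sin_ge_cube x : 0 <= x -> x - x ^+ 3 / 6 <= sin x.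
Proof.
move=> x0; rewrite -subr_ge0.
apply: (@nonneg_of_derive (fun z => sin z - (z - z ^+ 3 / 6))
          (fun z => cos z - (1 - z ^+ 2 / 2))) => //.
- move=> z; apply: is_derive_eq; rewrite /GRing.scale /=; ring || lra || nra.
- by rewrite sin0; lra.
- by move=> z z0; rewrite subr_ge0 cos_ge_quad.
Qed.

Lemma sin_ge_quad x : 0 <= x -> x - x ^+ 2 / 2 <= sin x.
Proof.
move=> x0; rewrite -subr_ge0.
apply: (@nonneg_of_derive (fun z => sin z - (z - z ^+ 2 / 2))
          (fun z => cos z - 1 + z)) => //.
- move=> z; apply: is_derive_eq; rewrite /GRing.scale /=; ring || lra || nra.
- by rewrite sin0; lra.
- move=> z /ltW z0.
  apply: (@nonneg_of_derive (fun z => cos z - 1 + z) (fun z => 1 - sin z)) => //.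
  + move=> t; apply: is_derive_eq; rewrite /GRing.scale /=; ring || lra || nra.
  + by rewrite cos0; lra.
Qed.

Lemma cos_le_cube x : 0 <= x -> cos x <= 1 - x ^+ 2 / 2 + x ^+ 3 / 6.
Proof.
move=> x0; rewrite -subr_ge0.
apply: (@nonneg_of_derive (fun z => (1 - z ^+ 2 / 2 + z ^+ 3 / 6) - cos z)
          (fun z => sin z - (z - z ^+ 2 / 2))) => //.
- move=> z; apply: is_derive_eq; rewrite /GRing.scale /=; ring || lra || nra.
- by rewrite cos0; lra.
- by move=> z /ltW z0; rewrite subr_ge0 sin_ge_quad.
Qed.

Lemma cos_sub1_quad x : `|cos x - 1| <= x ^+ 2 / 2.
Proof.
rewrite ler_norml; apply/andP; split; last first.
  by rewrite (le_trans _ (_ : 0 <= _)) ?subr_le0 ?cos_le1// divr_ge0// sqr_ge0.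
by have := cos_ge_quad x; lra.
Qed.

Lemma cos_sub_cube x : `|cos x - 1 + x ^+ 2 / 2| <= `|x| ^+ 3 / 6.
Proof.
have -> : cos x - 1 + x ^+ 2 / 2 = cos `|x| - 1 + `|x| ^+ 2 / 2.
  by rewrite cos_norm real_normK ?num_real.
have := cos_ge_quad `|x|; have := cos_le_cube (normr_ge0 x).
by move=> h1 h2; rewrite ger0_norm; lra.
Qed.

Lemma sin_sub_id x : `|sin x - x| = `|sin `|x| - `|x| |.
Proof.
have [x0|/ltW x0] := leP 0 x; first by rewrite (ger0_norm x0).
by rewrite (ler0_norm x0) sinN -opprD normrN.
Qed.

Lemma sin_sub_quad x : `|sin x - x| <= x ^+ 2 / 2.
Proof.
rewrite sin_sub_id -[x ^+ 2]real_normK ?num_real//.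
have := sin_le_id (normr_ge0 x); have := sin_ge_quad (normr_ge0 x).
by move=> h1 h2; rewrite (@ler0_norm _ (sin _ - _)); lra.
Qed.

Lemma sin_sub_cube x : `|sin x - x| <= `|x| ^+ 3 / 6.
Proof.
rewrite sin_sub_id.
have := sin_le_id (normr_ge0 x); have := sin_ge_cube (normr_ge0 x).
by move=> h1 h2; rewrite (@ler0_norm _ (sin _ - _)); lra.
Qed.

Lemma expR_sub1_le x : x <= 0 -> `|expR x - 1| <= - x.
Proof.
move=> x0; have := expR_ge1Dx x; have : expR x <= 1 by rewrite expR_le1.
by move=> h1 h2; rewrite (@ler0_norm _ (expR _ - _)); lra.
Qed.

Lemma expR_sub_quad x : x <= 0 -> `|expR x - 1 - x| <= x ^+ 2.
Proof.
move=> x0; have h1 := expR_ge1Dx x.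
rewrite ger0_norm; last lra.
have h2 := expR_ge1Dx (- x).
have := expRxMexpNx_1 x; have := expR_gt0 x; set e := expR x in h1 *.
set e' := expR _ in h2 *.
move=> e0 ee'; have : e * (1 - x) <= 1 by rewrite -ee' ler_pM2l//; lra.
nra.
Qed.

End real_trig.


Lemma cvg_invn0 {R : realType} : n%:R^-1 @[n --> \oo] --> (0 : R).
Proof.
apply/gtr0_cvgV0; last exact: cvgr_idn.
by near=> n; rewrite ltr0n; near: n; exact: nbhs_infty_gt.
Unshelve. all: by end_near.
Qed.

Lemma cvg0_squeeze {R : realType} (u v : nat -> R) :
  (\forall n \near \oo, 0 <= u n <= v n) -> v n @[n --> \oo] --> 0 ->
  u n @[n --> \oo] --> 0.
Proof.
move=> uv v0; apply: (@squeeze_cvgr _ _ _ _ (cst 0) v u uv) => //; exact: cvg_cst.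
Qed.

Lemma cvg_dist0 {R : realType} (u v : nat -> R) l :
  (\forall n \near \oo, `|u n - l| <= v n) -> v n @[n --> \oo] --> 0 ->
  u n @[n --> \oo] --> l.
Proof.
move=> uv v0; apply/cvgrPdist_lt => e e0; near=> n.
rewrite distrC; apply: (@le_lt_trans _ _ (v n)); near: n => //.
exact: (cvgr_lt _ v0).
Unshelve. all: by end_near.
Qed.

Lemma dist0_cvg {R : realType} (u : nat -> R) l :
  u n @[n --> \oo] --> l -> `|u n - l| @[n --> \oo] --> 0.
Proof.
move=> ul; rewrite -(@normr0 _ R) -(subrr l); apply: cvg_norm.
by apply: cvgB => //; exact: cvg_cst.
Qed.



(** * Modulus and exponential of complex numbers *)
Section complex_norm.
Context {R : realType}.
Local Notation C := R[i].
Implicit Types (x y : R) (z w : C).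

Lemma normc_ge0 z : 0 <= normc z.
Proof. by case: z => a b; rewrite sqrtr_ge0. Qed.

Lemma normc_real x : normc x%:C = `|x|.
Proof. by rewrite /= expr0n /= addr0 sqrtr_sqr. Qed.

Lemma normcB z w : normc (z - w) = normc (w - z).
Proof. by rewrite -normcN opprB. Qed.

Lemma normcX z n : normc (z ^+ n) = normc z ^+ n.
Proof.
elim: n => [|n IH]; first by rewrite !expr0 normc1.
by rewrite !exprS normcM IH.
Qed.

Lemma normc_le_ReIm z : normc z <= `|Re z| + `|Im z|.
Proof.
have -> : z = (Re z)%:C + 'i * (Im z)%:C by rewrite -complexE.
rewrite (le_trans (le_normcD _ _))// normcM !normc_real.
have -> : normc ('i : C) = 1 by rewrite /= expr0n expr1n add0r sqrtr1.
by rewrite mul1r; case: z => a b /=; rewrite !(mul0r, mulr0, mul1r, subr0, addr0, add0r).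
Qed.

Lemma Re_le_normc z : `|Re z| <= normc z.
Proof.
case: z => a b /=; rewrite -sqrtr_sqr ler_wsqrtr// lerDl sqr_ge0//.
Qed.

Lemma Im_le_normc z : `|Im z| <= normc z.
Proof.
case: z => a b /=; rewrite -sqrtr_sqr ler_wsqrtr// lerDr sqr_ge0//.
Qed.

Lemma normc_sum (I : Type) (r : seq I) (P : pred I) (F : I -> C) :
  normc (\sum_(i <- r | P i) F i) <= \sum_(i <- r | P i) normc (F i).
Proof.
elim/big_ind2 : _ => [|z1 x1 z2 x2 h1 h2|//]; first by rewrite normc0.
by rewrite (le_trans (le_normcD _ _))// lerD.
Qed.

Lemma normcX_le1 z n : normc z <= 1 -> normc (z ^+ n) <= 1.
Proof. by move=> z1; rewrite normcX exprn_ile1// normc_ge0. Qed.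

Lemma normcM_le1 z w : normc z <= 1 -> normc w <= 1 -> normc (z * w) <= 1.
Proof. by move=> z1 w1; rewrite normcM mulr_ile1// normc_ge0. Qed.

Lemma normc_prod_le1 (I : Type) (r : seq I) (P : pred I) (F : I -> C) :
  (forall i, normc (F i) <= 1) -> normc (\prod_(i <- r | P i) F i) <= 1.
Proof.
move=> F1; elim/big_ind : _ => //; [by rewrite normc1|exact: normcM_le1].
Qed.

(** On the unit disc taking powers is Lipschitz, with the exponent as constant. *)
Lemma normc_subX z w n : normc z <= 1 -> normc w <= 1 ->
  normc (z ^+ n - w ^+ n) <= n%:R * normc (z - w).
Proof.
move=> z1 w1; rewrite subrXX normcM mulrC ler_wpM2r ?normc_ge0//.
rewrite (le_trans (normc_sum _ _ _))//.
have -> : n%:R = \sum_(i < n) (1 : R) by rewrite sumr_const card_ord.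
by apply: ler_sum => i _; apply: normcM_le1; apply: normcX_le1.
Qed.

Lemma complex_eqP z w : Re z = Re w -> Im z = Im w -> z = w.
Proof. by case: z => a b; case: w => c d /= -> ->. Qed.

Lemma ReM z w : Re (z * w) = Re z * Re w - Im z * Im w.
Proof. by case: z => a b; case: w. Qed.

Lemma ImM z w : Im (z * w) = Re z * Im w + Im z * Re w.
Proof. by case: z => a b; case: w => c d /=. Qed.

Lemma ReD z w : Re (z + w) = Re z + Re w. Proof. by case: z; case: w. Qed.
Lemma ImD z w : Im (z + w) = Im z + Im w. Proof. by case: z; case: w. Qed.
Lemma ReN z : Re (- z) = - Re z. Proof. by case: z. Qed.
Lemma ImN z : Im (- z) = - Im z. Proof. by case: z. Qed.

Definition cis y : C := cos y +i* sin y.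

Lemma cisD x y : cis (x + y) = cis x * cis y.
Proof. by rewrite /cis cosD sinD; simpc; congr (_ +i* _); ring. Qed.

Lemma cis0 : cis 0 = 1. Proof. by rewrite /cis cos0 sin0. Qed.

Lemma cis_sum (I : Type) (r : seq I) (P : pred I) (F : I -> R) :
  cis (\sum_(i <- r | P i) F i) = \prod_(i <- r | P i) cis (F i).
Proof. by apply: (big_morph cis cisD cis0). Qed.

Lemma cisMn y n : cis (y *+ n) = cis y ^+ n.
Proof.
elim: n => [|n IH]; first by rewrite mulr0n cis0.
by rewrite mulrS cisD IH exprS.
Qed.

Lemma normc_cis y : normc (cis y) = 1.
Proof. by rewrite /= cos2Dsin2 sqrtr1. Qed.

Lemma normc_cis_sub1 y : normc (cis y - 1) <= `|y|.
Proof.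
rewrite /= -[leRHS]sqrtr_sqr ler_wsqrtr//.
have := cos_ge_quad y; have := cos2Dsin2 y; nra.
Qed.

Lemma normc_cis_sub2 y : normc (cis y - 1 - 0 +i* y) <= y ^+ 2.
Proof.
rewrite (le_trans (normc_le_ReIm _))//= subr0.
by have := cos_sub1_quad y; have := sin_sub_quad y; rewrite oppr0 addr0; lra.
Qed.

Lemma normc_cis_sub3 y :
  normc (cis y - 1 - 0 +i* y + (y ^+ 2 / 2)%:C) <= `|y| ^+ 3.
Proof.
rewrite (le_trans (normc_le_ReIm _))//= !(oppr0,addr0,subr0).
have := cos_sub_cube y; have := sin_sub_cube y.
have : 0 <= `|y| ^+ 3 by rewrite exprn_ge0.
lra.
Qed.

Definition cexp z : C := (expR (Re z))%:C * cis (Im z).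

Lemma cexpD z w : cexp (z + w) = cexp z * cexp w.
Proof. by rewrite /cexp ReD ImD expRD cisD rmorphM/=; ring. Qed.

Lemma cexp0 : cexp 0 = 1. Proof. by rewrite /cexp/= expR0 cis0 mulr1. Qed.

Lemma cexpMn z n : cexp (z *+ n) = cexp z ^+ n.
Proof.
elim: n => [|n IH]; first by rewrite mulr0n cexp0.
by rewrite mulrS cexpD IH exprS.
Qed.

Lemma cexp_real x : cexp x%:C = (expR x)%:C.
Proof. by rewrite /cexp/= cis0 mulr1. Qed.

Lemma cexp_im y : cexp (0 +i* y) = cis y.
Proof. by rewrite /cexp/= expR0 mul1r. Qed.

Lemma normc_cexp z : normc (cexp z) = expR (Re z).
Proof. by rewrite normcM normc_real normc_cis mulr1 ger0_norm// expR_ge0. Qed.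

Lemma normc_cexp_le1 z : Re z <= 0 -> normc (cexp z) <= 1.
Proof. by rewrite normc_cexp expR_le1. Qed.

(** On the left half plane the remainders of the exponential are bounded without
the factor [expR (normc z)] that they have in general. *)
Lemma normc_cexp_sub1 z : Re z <= 0 -> normc (cexp z - 1) <= 2 * normc z.
Proof.
case: z => x y x0; rewrite /= in x0.
have -> : cexp (x +i* y) - 1 = (expR x)%:C * (cis y - 1) + (expR x - 1)%:C.
  by rewrite /cexp/= rmorphB/=; ring.
rewrite (le_trans (le_normcD _ _))// normcM !normc_real.
rewrite (ger0_norm (expR_ge0 _)).
have h1 := normc_cis_sub1 y; have h2 := expR_sub1_le x0.
have h3 : expR x <= 1 by rewrite expR_le1.
have h4 := normc_ge0 (cis y - 1).
have h5 := Re_le_normc (x +i* y); have h6 := Im_le_normc (x +i* y).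
move: h1 h4 h5 h6; set A := normc (cis y - 1); set n := normc _.
rewrite (ler0_norm x0) => h1 h4 h5 h6.
have : expR x * A <= A by rewrite ler_piMl.
lra.
Qed.

Lemma normc_cexp_sub2 z : Re z <= 0 ->
  normc (cexp z - 1 - z) <= 3 * normc z ^+ 2.
Proof.
case: z => x y x0.
have -> : cexp (x +i* y) - 1 - x +i* y =
    (expR x)%:C * (cis y - 1 - 0 +i* y) + (expR x - 1)%:C * (0 +i* y)
    + (expR x - 1 - x)%:C.
  rewrite /cexp /=; apply: complex_eqP; rewrite /=; ring.
rewrite (le_trans (le_normcD _ _))//.
rewrite (le_trans (lerD (le_normcD _ _) (lexx _)))//.
rewrite !normcM !normc_real (ger0_norm (expR_ge0 _)).
have -> : normc (0 +i* y : C) = `|y| by rewrite /= expr0n add0r sqrtr_sqr.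
have h1 := normc_cis_sub2 y; have h2 := expR_sub1_le x0.
have h3 : expR x <= 1 by rewrite expR_le1.
have h4 := normc_ge0 (cis y - 1 - 0 +i* y).
have h5 := Re_le_normc (x +i* y); have h6 := Im_le_normc (x +i* y).
have h7 := expR_sub_quad x0.
rewrite /= in x0; move: h5 h6; rewrite (ler0_norm x0).
have := expR_ge0 x; have := normr_ge0 (expR x - 1); have := normr_ge0 y.
have h8 : y ^+ 2 = `|y| ^+ 2 by rewrite real_normK ?num_real.
rewrite h8 in h1; move: h1 h2 h3 h4 h7.
set A := normc (_ - _ - _); set n := normc (x +i* y); set u := `|y|; set e := expR x.
set f := `|e - 1|; set g := `|e - 1 - x|.
move=> h1 h2 h3 h4 h7 u0 f0 e0 h5 h6.
have u2 : u ^+ 2 <= n ^+ 2 by rewrite !expr2 ler_pM.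
have x2 : x ^+ 2 <= n ^+ 2 by rewrite -[x ^+ 2]sqrrN !expr2 ler_pM// oppr_ge0.
have fu : f * u <= n ^+ 2 by rewrite expr2 ler_pM// (le_trans h2).
have eA : e * A <= A by rewrite ler_piMl.
rewrite /= in h7.
lra.
Qed.

(** The law of small numbers for complex powers: replacing each factor [w N]
by [cexp (z / N)] costs at most [N] times the error of one factor, as all the
factors lie in the unit disc. *)
Lemma cvg_power_cexp (w : nat -> C) z : (forall N, normc (w N) <= 1) ->
  Re z <= 0 ->
  normc (N%:R * (w N - 1) - z) @[N --> \oo] --> 0 ->
  normc (w N ^+ N - cexp z) @[N --> \oo] --> 0.
Proof.
move=> w1 z0 cw.
have cv : (normc (N%:R * (w N - 1) - z) + 3 * normc z ^+ 2 * N%:R^-1) @[N --> \oo] --> 0.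
  rewrite -[X in _ --> X]addr0 -[X in _ --> _ + X](mulr0 (3 * normc z ^+ 2)).
  by apply: cvgD => //; apply: cvgM; [exact: cvg_cst|exact: cvg_invn0].
apply: (cvg0_squeeze _ cv).
near=> N; rewrite normc_ge0 /=.
have N0 : (0 < N%:R :> R) by rewrite ltr0n; near: N; exact: nbhs_infty_gt.
have N0' : (N%:R : C) != 0 by rewrite pnatr_eq0; move: N0; rewrite ltr0n; case: (N).
have NE : N%:R = (N%:R)%:C :> C by rewrite rmorph_nat.
set zN := (N%:R^-1)%:C * z.
have ReN : Re zN = N%:R^-1 * Re z by rewrite /zN ReM /=; ring.
have zN0 : Re zN <= 0 by rewrite ReN mulr_ge0_le0// invr_ge0 ltW.
have -> : cexp z = cexp zN ^+ N.
  rewrite -cexpMn -mulr_natl /zN NE mulrA -rmorphM mulfV ?mul1r//.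
  by rewrite gt_eqF.
rewrite (le_trans (normc_subX _ _ _))// ?normc_cexp_le1//.
have -> : w N - cexp zN =
   N%:R^-1 * ((N%:R * (w N - 1) - z) - N%:R * (cexp zN - 1 - zN)).
  rewrite /zN fmorphV /= -NE; field. exact: N0'.
rewrite normcM.
have -> : normc (N%:R^-1 : C) = N%:R^-1.
  by rewrite NE -fmorphV normc_real ger0_norm// invr_ge0 ltW.
rewrite mulrA mulfV ?gt_eqF// mul1r.
rewrite (le_trans (le_normcD _ _))// normcN lerD2l normcM NE normc_real.
rewrite (ger0_norm (ltW N0)).
rewrite (le_trans (ler_wpM2l (ltW N0) (normc_cexp_sub2 zN0)))//.
rewrite /zN normcM normc_real ger0_norm; last by rewrite invr_ge0 ltW.
rewrite exprMn le_eqVlt; apply/orP; left; apply/eqP; field.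
by rewrite gt_eqF.
Unshelve. all: by end_near.
Qed.

End complex_norm.


(** * Expectation of real random variables *)
Section real_expectation.
Context d (T : measurableType d) (R : realType) (P : probability T R).
Implicit Types f g : T -> R.

(** A total real-valued expectation; it is meaningful when [itg] holds. *)
Definition Ex f : R := fine (\int[P]_w (f w)%:E)%E.

Definition itg f := P.-integrable [set: T] (EFin \o f).

Lemma itg_meas f : itg f -> measurable_fun [set: T] f.
Proof. by move=> /measurable_int/measurable_EFinP. Qed.

Lemma itg_bounded f M : measurable_fun [set: T] f ->
  (forall w, `|f w| <= M) -> itg f.
Proof.
move=> mf fM; apply: measurable_bounded_integrable => //.
- exact: le_lt_trans (probability_le1 P measurableT) (ltry 1).
- exists M; split; first exact: num_real.
  by move=> x Mx w _; apply: (le_trans (fM w)); exact: ltW.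
Qed.

Lemma itg_le f g : measurable_fun [set: T] f -> itg g ->
  (forall w, `|f w| <= g w) -> itg f.
Proof.
move=> mf ig fg; apply: (le_integrable _ _ _ ig) => //.
- exact/measurable_EFinP.
- by move=> w _; rewrite /= lee_fin (le_trans (fg w)) ?ler_norm.
Qed.

Lemma itg_cst r : itg (cst r).
Proof. by apply: (@itg_bounded _ `|r|). Qed.

Lemma itgD f g : itg f -> itg g -> itg (fun w => f w + g w).
Proof.
move=> mf mg; have := integrableD measurableT mf mg.
by apply: eq_integrable => //.
Qed.

Lemma itgZ r f : itg f -> itg (fun w => r * f w).
Proof.
move=> mf; have := integrableZl measurableT r mf.
by apply: eq_integrable.
Qed.

Lemma itgN f : itg f -> itg (fun w => - f w).
Proof.
move=> /(itgZ (-1)); apply: eq_integrable => // w _ /=.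
by rewrite mulN1r.
Qed.

Lemma itgB f g : itg f -> itg g -> itg (fun w => f w - g w).
Proof. by move=> mf mg; apply: itgD => //; exact: itgN. Qed.

Lemma itg_norm f : itg f -> itg (fun w => `|f w|).
Proof. exact: integrable_norm. Qed.

Lemma itg_sum I (s : seq I) (F : I -> T -> R) : (forall i, itg (F i)) ->
  itg (fun w => \sum_(i <- s) F i w).
Proof.
move=> iF; elim: s => [|i s IH].
  by apply: eq_integrable (itg_cst 0) => // w _ /=; rewrite big_nil.
have := itgD (iF i) IH; apply: eq_integrable => // w _ /=.
by rewrite big_cons.
Qed.

Lemma Ex_fin f : itg f -> (\int[P]_w (f w)%:E = (Ex f)%:E)%E.
Proof.
by move=> mf; rewrite /Ex fineK//; exact: integrable_fin_num.
Qed.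

Lemma Ex_cst r : Ex (cst r) = r.
Proof.
have := expectation_cst P r; rewrite unlock /Ex => -> //.
Qed.

Lemma eq_Ex f g : f =1 g -> Ex f = Ex g.
Proof. by move=> fg; rewrite /Ex; under eq_integral do rewrite fg. Qed.

Lemma ExD f g : itg f -> itg g -> Ex (fun w => f w + g w) = Ex f + Ex g.
Proof. by move=> mf mg; rewrite /Ex -RintegralD. Qed.

Lemma ExZ r f : itg f -> Ex (fun w => r * f w) = r * Ex f.
Proof. by move=> mf; rewrite /Ex -RintegralZl. Qed.

Lemma ExN f : itg f -> Ex (fun w => - f w) = - Ex f.
Proof.
move=> mf; rewrite -mulN1r -ExZ//; apply: eq_Ex => w; by rewrite mulN1r.
Qed.

Lemma ExB f g : itg f -> itg g -> Ex (fun w => f w - g w) = Ex f - Ex g.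
Proof.
by move=> mf mg; rewrite -ExN// -ExD//; exact: itgN.
Qed.

Lemma Ex_sum I (s : seq I) (F : I -> T -> R) : (forall i, itg (F i)) ->
  Ex (fun w => \sum_(i <- s) F i w) = \sum_(i <- s) Ex (F i).
Proof.
move=> iF; elim: s => [|i s IH].
  rewrite big_nil -[RHS](Ex_cst 0); apply: eq_Ex => w; by rewrite big_nil.
rewrite big_cons -IH -ExD//; last exact: itg_sum.
by apply: eq_Ex => w; rewrite big_cons.
Qed.

Lemma Ex_le f g : itg f -> itg g -> (forall w, f w <= g w) -> Ex f <= Ex g.
Proof. by move=> mf mg fg; apply: le_Rintegral => // w _; exact: fg. Qed.

Lemma Ex_ge0 f : (forall w, 0 <= f w) -> 0 <= Ex f.
Proof.
by move=> f0; rewrite fine_ge0//; apply: integral_ge0 => w _; rewrite lee_fin.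
Qed.

Lemma Ex_norm f : itg f -> `|Ex f| <= Ex (fun w => `|f w|).
Proof. by move=> mf; exact: le_normr_Rintegral. Qed.

Lemma Ex_ae f g : measurable_fun [set: T] f -> measurable_fun [set: T] g ->
  {ae P, forall w, f w = g w} -> Ex f = Ex g.
Proof.
move=> mf mg fg; rewrite /Ex; congr fine; apply: ae_eq_integral => //.
- exact/measurable_EFinP.
- exact/measurable_EFinP.
- by move: fg; apply: filterS => w + _ => /= ->.
Qed.

Lemma Ex_dct (F : nat -> T -> R) f g :
  (forall n, measurable_fun [set: T] (F n)) -> measurable_fun [set: T] f ->
  itg g -> (forall n w, `|F n w| <= g w) ->
  (forall w, F n w @[n --> \oo] --> f w) ->
  Ex (F n) @[n --> \oo] --> Ex f.
Proof.
move=> mF mf ig Fg Ff.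
have i_f : itg f.
  apply: (itg_le mf ig) => w.
  have Fnf : `|F n w| @[n --> \oo] --> `|f w| by apply: cvg_norm; exact: Ff.
  apply: (cvgr_to_le Fnf).
  by apply: nearW => n; exact: Fg.
have : (\int[P]_w (F n w)%:E)%E @[n --> \oo] --> (\int[P]_w (f w)%:E)%E.
  apply: (dominated_cvg measurableT (g := EFin \o g)) => //.
  - by move=> n; apply/measurable_EFinP; exact: mF.
  - by move=> w _; apply: cvg_EFin; [exact: nearW|exact: Ff].
  - by move=> n w _ /=; rewrite lee_fin Fg.
by rewrite Ex_fin// => /fine_cvg.
Qed.

Lemma Ex_prob (A : set T) : measurable A -> Ex (\1_A) = fine (P A).
Proof. by move=> mA; rewrite /Ex integral_indic// setIT. Qed.

End real_expectation.

Section transfer.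
Context d (T' : measurableType d) (R : realType).

Definition bmf (g : T' -> R) :=
  measurable_fun [set: T'] g /\ exists M, forall x, `|g x| <= M.

Lemma bmf_indic (A : set T') : measurable A -> bmf (\1_A : T' -> R).
Proof.
move=> mA; split; first exact: measurable_indic.
by exists 1 => x; rewrite indicE ger0_norm// lern1 leq_b1.
Qed.

Lemma itgMb dT (T : measurableType dT) (P : probability T R) (Z : T -> T') (g : T' -> R) (F : T -> R) :
  measurable_fun [set: T] Z -> bmf g -> itg P F -> itg P (fun w => g (Z w) * F w).
Proof.
move=> mZ [mg [M gM]] iF.
apply: (@itg_le _ _ _ _ _ (fun w => M * `|F w|)).
- apply: measurable_funM; first exact: measurableT_comp.
  exact: itg_meas iF.
- by apply: itgZ; exact: itg_norm.
- by move=> w; rewrite normrM ler_wpM2r.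
Qed.

(** Two weighted laws that agree on events agree on bounded measurable
functions, because such a function is a uniform limit of simple ones. *)
Lemma law_transfer d1 (T1 : measurableType d1) (P1 : probability T1 R)
  d2 (T2 : measurableType d2) (P2 : probability T2 R)
  (Z1 : T1 -> T') (Z2 : T2 -> T') (F1 : T1 -> R) (F2 : T2 -> R) :
  measurable_fun [set: T1] Z1 -> measurable_fun [set: T2] Z2 ->
  itg P1 F1 -> itg P2 F2 ->
  (forall A, measurable A -> Ex P1 (fun w => \1_A (Z1 w) * F1 w)
     = Ex P2 (fun w => \1_A (Z2 w) * F2 w)) ->
  forall g, bmf g -> Ex P1 (fun w => g (Z1 w) * F1 w)
     = Ex P2 (fun w => g (Z2 w) * F2 w).
Proof.
move=> mZ1 mZ2 i1 i2 H g [mg [M gM]].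
(* [gn n] rounds [g] down to the grid of mesh 1 / (n + 1). *)
pose lev n x : nat := Num.truncn (n.+1%:R * (g x + M)).
pose K n := (Num.truncn (n.+1%:R * (M + M))).+1.
pose A n k := [set x | k%:R <= n.+1%:R * (g x + M) < k.+1%:R].
have mA n k : measurable (A n k).
  have -> : A n k = [set: T'] `&` (fun x => n.+1%:R * (g x + M)) @^-1` `[k%:R, k.+1%:R[%classic.
    by rewrite setTI; apply/seteqP; split => x /=; rewrite in_itv.
  have : measurable_fun [set: T'] (fun x => n.+1%:R * (g x + M)).
    by apply: measurable_funM => //; exact: measurable_funD.
  by apply => //; exact: measurable_itv.
pose gn n x := \sum_(k <- iota 0 (K n)) (k%:R / n.+1%:R) * \1_(A n k) x - M.
have gn_app n x : `|g x - gn n x| <= n.+1%:R^-1.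
  have n0 : 0 < n.+1%:R :> R by rewrite ltr0n.
  have /andP[gM1 gM2] : - M <= g x <= M by rewrite -ler_norml.
  have y0 : 0 <= n.+1%:R * (g x + M) by rewrite mulr_ge0//; lra.
  have /andP[t1 t2] := truncn_itv y0.
  have AE k : \1_(A n k) x = (k == lev n x)%:R :> R.
    rewrite indicE; congr (_%:R); congr nat_of_bool; apply/idP/eqP.
      rewrite inE /A/= => /andP[h1 h2]; apply/eqP; rewrite eq_sym.
      by rewrite /lev truncn_eq// h1 h2.
    by move=> ->; rewrite inE /A/= t1 t2.
  have levK : (lev n x < K n)%N.
    by rewrite ltnS; apply: le_truncn; rewrite ler_wpM2l//; lra.
  rewrite /gn (bigD1_seq (lev n x)) ?iota_uniq ?mem_iota//= big1; last first.
    by move=> k kl; rewrite AE (negbTE kl) mulr0.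
  rewrite AE eqxx mulr1 addr0 /lev.
  move: t1 t2; rewrite -/(lev n x) => t1 t2.
  have -> : g x - ((lev n x)%:R / n.+1%:R - M) = (n.+1%:R * (g x + M) - (lev n x)%:R) / n.+1%:R.
    by field; rewrite gt_eqF//= -natr1.
  rewrite normrM ger0_norm ?subr_ge0// ger0_norm ?invr_ge0 ?(ltW n0)//.
  rewrite ler_piMl ?invr_ge0 ?(ltW n0)//.
  by move: t2; rewrite -natr1; lra.
have mgn n : measurable_fun [set: T'] (gn n).
  apply: measurable_funB => //; apply: measurable_sum => k.
  by apply: measurable_funM => //; exact: measurable_indic.
have bgn n : bmf (gn n).
  split => //; exists (M + n.+1%:R^-1) => x.
  have -> : gn n x = g x - (g x - gn n x) by ring.
  by rewrite (le_trans (ler_normB _ _))// lerD.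
have app1 dT (T : measurableType dT) (P : probability T R) (Z : T -> T') (F : T -> R) n :
    measurable_fun [set: T] Z -> itg P F ->
    `|Ex P (fun w => g (Z w) * F w) - Ex P (fun w => gn n (Z w) * F w)|
      <= n.+1%:R^-1 * Ex P (fun w => `|F w|).
  move=> mZ iF.
  have igF : itg P (fun w => g (Z w) * F w) by apply: itgMb => //; split=> //; exists M.
  have ignF : itg P (fun w => gn n (Z w) * F w) by apply: itgMb.
  rewrite -ExB//.
  rewrite (le_trans (Ex_norm _))//; first exact: itgB.
  rewrite -ExZ; last exact: itg_norm.
  apply: Ex_le.
  - by apply: itg_norm; exact: itgB.
  - by apply: itgZ; exact: itg_norm.
  - by move=> w; rewrite -mulrBl normrM ler_wpM2r.
have gnE dT (T : measurableType dT) (P : probability T R) (Z : T -> T') (F : T -> R) n :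
    measurable_fun [set: T] Z -> itg P F ->
    Ex P (fun w => gn n (Z w) * F w) =
    \sum_(k <- iota 0 (K n)) (k%:R / n.+1%:R) * Ex P (fun w => \1_(A n k) (Z w) * F w)
    - M * Ex P (fun w => \1_[set: T'] (Z w) * F w).
  move=> mZ iF.
  have iA B : measurable B -> itg P (fun w => \1_B (Z w) * F w).
    by move=> mB; apply: itgMb => //; exact: bmf_indic.
  rewrite (@eq_Ex _ _ _ _ _ (fun w =>
    \sum_(k <- iota 0 (K n)) (k%:R / n.+1%:R) * (\1_(A n k) (Z w) * F w)
    - M * (\1_[set: T'] (Z w) * F w))); last first.
    move=> w; rewrite /gn mulrBl mulr_suml indicT mul1r.
    by congr (_ - _); apply: eq_bigr => k _; rewrite mulrA.
  rewrite ExB; last 2 first.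
  - apply: itg_sum => k; apply: itgZ; exact: iA.
  - by apply: itgZ; exact: iA.
  rewrite Ex_sum; last by move=> k; apply: itgZ; exact: iA.
  congr (_ - _); last by rewrite ExZ//; exact: iA.
  by apply: eq_bigr => k _; rewrite ExZ//; exact: iA.
apply/eqP; rewrite -subr_eq0 -normr_le0; apply/ler_addgt0Pl => e e0; rewrite addr0.
pose C := Ex P1 (fun w => `|F1 w|) + Ex P2 (fun w => `|F2 w|).
have C0 : 0 <= C by apply: addr_ge0; apply: Ex_ge0.
have [n nC] : exists n : nat, n.+1%:R^-1 * C <= e.
  exists (Num.truncn (C / e)).
  rewrite mulrC ler_pdivrMr ?ltr0n// mulrC -ler_pdivrMr//.
  by rewrite ltW// truncnS_gt.
rewrite (le_trans _ nC)//.
have -> : Ex P1 (fun w => g (Z1 w) * F1 w) - Ex P2 (fun w => g (Z2 w) * F2 w) =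
  (Ex P1 (fun w => g (Z1 w) * F1 w) - Ex P1 (fun w => gn n (Z1 w) * F1 w)) -
  (Ex P2 (fun w => g (Z2 w) * F2 w) - Ex P2 (fun w => gn n (Z2 w) * F2 w)).
  rewrite !gnE// H//; under eq_bigr do rewrite H//; ring.
by rewrite (le_trans (ler_normB _ _))// mulrDr lerD// app1.
Qed.

End transfer.


(** * Expectation of complex random variables *)
Section complex_measurable.
Context d (T : measurableType d) (R : realType).
Local Notation C := R[i].
Implicit Types F G : T -> C.

Definition cmf F := measurable_fun [set: T] (fun w => Re (F w)) /\
  measurable_fun [set: T] (fun w => Im (F w)).

Lemma eq_cmf F G : F =1 G -> cmf F -> cmf G.
Proof. by move=> /funext ->. Qed.

Lemma cmf_cst c : cmf (cst c). Proof. by split; exact: measurable_cst. Qed.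

Lemma cmf_real (f : T -> R) : measurable_fun [set: T] f -> cmf (fun w => (f w)%:C).
Proof. by move=> mf; split => //=; exact: measurable_cst. Qed.

Lemma cmfD F G : cmf F -> cmf G -> cmf (fun w => F w + G w).
Proof.
move=> [F1 F2] [G1 G2]; split.
  by under eq_fun do rewrite ReD; exact: measurable_funD.
by under eq_fun do rewrite ImD; exact: measurable_funD.
Qed.

Lemma cmfN F : cmf F -> cmf (fun w => - F w).
Proof.
move=> [F1 F2]; split.
  by under eq_fun do rewrite ReN; exact: measurableT_comp.
by under eq_fun do rewrite ImN; exact: measurableT_comp.
Qed.

Lemma cmfB F G : cmf F -> cmf G -> cmf (fun w => F w - G w).
Proof. by move=> mF mG; apply: cmfD => //; exact: cmfN. Qed.

Lemma cmfM F G : cmf F -> cmf G -> cmf (fun w => F w * G w).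
Proof.
move=> [F1 F2] [G1 G2]; split.
  by under eq_fun do rewrite ReM; apply: measurable_funB; exact: measurable_funM.
by under eq_fun do rewrite ImM; apply: measurable_funD; exact: measurable_funM.
Qed.

Lemma cmfX F n : cmf F -> cmf (fun w => F w ^+ n).
Proof.
move=> mF; elim: n => [|n IH]; first by apply: eq_cmf (cmf_cst 1) => w; rewrite expr0.
by apply: eq_cmf (cmfM mF IH) => w; rewrite exprS.
Qed.

Lemma cmf_sum I (s : seq I) (F : I -> T -> C) : (forall i, cmf (F i)) ->
  cmf (fun w => \sum_(i <- s) F i w).
Proof.
move=> mF; elim: s => [|i s IH].
  by apply: eq_cmf (cmf_cst 0) => w; rewrite big_nil.
by apply: eq_cmf (cmfD (mF i) IH) => w; rewrite big_cons.
Qed.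

Lemma cmf_prod I (s : seq I) (F : I -> T -> C) : (forall i, cmf (F i)) ->
  cmf (fun w => \prod_(i <- s) F i w).
Proof.
move=> mF; elim: s => [|i s IH].
  by apply: eq_cmf (cmf_cst 1) => w; rewrite big_nil.
by apply: eq_cmf (cmfM (mF i) IH) => w; rewrite big_cons.
Qed.

Lemma cmf_cis (f : T -> R) : measurable_fun [set: T] f -> cmf (fun w => cis (f w)).
Proof.
move=> mf; split => /=; apply: measurableT_comp => //;
  apply: continuous_measurable_fun; [exact: continuous_cos|exact: continuous_sin].
Qed.

Lemma cmf_cexp F : cmf F -> cmf (fun w => cexp (F w)).
Proof.
move=> [F1 F2]; apply: cmfM; last exact: cmf_cis.
by apply: cmf_real; exact: measurableT_comp.
Qed.

Lemma measurable_normc F : cmf F -> measurable_fun [set: T] (fun w => normc (F w)).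
Proof.
move=> [F1 F2].
have ms : measurable_fun [set: R] (@Num.sqrt R).
  by apply: continuous_measurable_fun; exact: sqrt_continuous.
have -> : (fun w => normc (F w)) =
    Num.sqrt \o (fun w => Re (F w) ^+ 2 + Im (F w) ^+ 2).
  by apply/funext => w /=; case: (F w).
apply: (measurableT_comp ms).
by apply: measurable_funD; exact: measurable_funX.
Qed.

Lemma measurable_natP (Z : T -> nat) (G : nat -> T -> R) :
  measurable_fun [set: T] Z -> (forall k, measurable_fun [set: T] (G k)) ->
  measurable_fun [set: T] (fun w => G (Z w) w).
Proof.
move=> mZ mG _ Y mY; rewrite setTI.
have -> : (fun w => G (Z w) w) @^-1` Y = \bigcup_k ((Z @^-1` [set k]) `&` (G k @^-1` Y)).
  apply/seteqP; split => w /=; first by move=> GY; exists (Z w).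
  by move=> [k _ [/= -> ]].
apply: bigcup_measurable => k _; apply: measurableI.
  by rewrite -[X in measurable X]setTI; exact: mZ.
by rewrite -[X in measurable X]setTI; exact: mG.
Qed.

Lemma cmf_natP (Z : T -> nat) (G : nat -> T -> C) :
  measurable_fun [set: T] Z -> (forall k, cmf (G k)) -> cmf (fun w => G (Z w) w).
Proof.
move=> mZ mG; split.
  by apply: (@measurable_natP Z (fun k w => Re (G k w))) => // k; have [] := mG k.
by apply: (@measurable_natP Z (fun k w => Im (G k w))) => // k; have [] := mG k.
Qed.

End complex_measurable.

Lemma cmf_comp d1 (T1 : measurableType d1) d2 (T2 : measurableType d2) (R : realType)
  (Z : T1 -> T2) (F : T2 -> R[i]) : measurable_fun [set: T1] Z -> cmf F ->
  cmf (fun w => F (Z w)).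
Proof.
by move=> mZ [F1 F2]; split; [exact: (measurableT_comp F1)|exact: (measurableT_comp F2)].
Qed.

Section complex_expectation.
Context d (T : measurableType d) (R : realType) (P : probability T R).
Local Notation C := R[i].
Implicit Types F G : T -> C.

Definition cEx F : C := Ex P (fun w => Re (F w)) +i* Ex P (fun w => Im (F w)).

Definition citg F := itg P (fun w => Re (F w)) /\ itg P (fun w => Im (F w)).

Lemma eq_citg F G : F =1 G -> citg F -> citg G.
Proof. by move=> /funext ->. Qed.

Lemma citg_cmf F : citg F -> cmf F.
Proof. by move=> [F1 F2]; split; [exact: (itg_meas F1)|exact: (itg_meas F2)]. Qed.

Lemma citg_le F (g : T -> R) : cmf F -> itg P g ->
  (forall w, normc (F w) <= g w) -> citg F.
Proof.
move=> [F1 F2] ig Fg; split; apply: itg_le ig _ => // w.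
  exact: le_trans (Re_le_normc _) (Fg w).
exact: le_trans (Im_le_normc _) (Fg w).
Qed.

Lemma citg_bounded F M : cmf F -> (forall w, normc (F w) <= M) -> citg F.
Proof. by move=> mF FM; apply: (citg_le mF (itg_cst P M)). Qed.

Lemma citg_norm F : citg F -> itg P (fun w => normc (F w)).
Proof.
move=> iF; have mF := citg_cmf iF.
apply: (itg_le (g := fun w => `|Re (F w)| + `|Im (F w)|)).
- exact: measurable_normc.
- by apply: itgD; apply: itg_norm; [exact: iF.1|exact: iF.2].
- by move=> w; rewrite ger0_norm ?normc_ge0// normc_le_ReIm.
Qed.

Lemma citg_cst c : citg (cst c).
Proof. by apply: (@citg_bounded _ (normc c)) => //; exact: cmf_cst. Qed.

Lemma citgD F G : citg F -> citg G -> citg (fun w => F w + G w).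
Proof.
move=> [F1 F2] [G1 G2]; split.
  by under eq_fun do rewrite ReD; exact: itgD.
by under eq_fun do rewrite ImD; exact: itgD.
Qed.

Lemma citgZ c F : citg F -> citg (fun w => c * F w).
Proof.
move=> [F1 F2]; split.
  by under eq_fun do rewrite ReM; apply: itgB; exact: itgZ.
by under eq_fun do rewrite ImM; apply: itgD; exact: itgZ.
Qed.

Lemma citgB F G : citg F -> citg G -> citg (fun w => F w - G w).
Proof.
move=> iF iG; apply: citgD => //; apply: eq_citg (citgZ (-1) iG) => w.
by rewrite mulN1r.
Qed.

Lemma citg_sum I (s : seq I) (F : I -> T -> C) : (forall i, citg (F i)) ->
  citg (fun w => \sum_(i <- s) F i w).
Proof.
move=> mF; elim: s => [|i s IH].
  by apply: eq_citg (citg_cst 0) => w; rewrite big_nil.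
by apply: eq_citg (citgD (mF i) IH) => w; rewrite big_cons.
Qed.

Lemma eq_cEx F G : F =1 G -> cEx F = cEx G.
Proof. by move=> /funext ->. Qed.

Lemma cEx_cst c : cEx (cst c) = c.
Proof. by case: c => a b; rewrite /cEx /= (Ex_cst P a) (Ex_cst P b). Qed.

Lemma cEx_real (f : T -> R) : cEx (fun w => (f w)%:C) = (Ex P f)%:C.
Proof. by rewrite /cEx/= (Ex_cst P 0). Qed.

Lemma cExD F G : citg F -> citg G -> cEx (fun w => F w + G w) = cEx F + cEx G.
Proof.
move=> [F1 F2] [G1 G2]; apply: complex_eqP; rewrite ?ReD ?ImD /=.
  by rewrite -ExD//; apply: eq_Ex => w; rewrite ReD.
by rewrite -ExD//; apply: eq_Ex => w; rewrite ImD.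
Qed.

Lemma cExZ c F : citg F -> cEx (fun w => c * F w) = c * cEx F.
Proof.
move=> [F1 F2]; apply: complex_eqP; rewrite ?ReM ?ImM /=.
  rewrite -2?ExZ// -ExB; [|exact: itgZ|exact: itgZ].
  by apply: eq_Ex => w; rewrite ReM.
rewrite -2?ExZ// -ExD; [|exact: itgZ|exact: itgZ].
by apply: eq_Ex => w; rewrite ImM.
Qed.

Lemma cExB F G : citg F -> citg G -> cEx (fun w => F w - G w) = cEx F - cEx G.
Proof.
move=> iF iG; rewrite -mulN1r -cExZ// -cExD//; last exact: citgZ.
by apply: eq_cEx => w; rewrite mulN1r.
Qed.

Lemma cEx_sum I (s : seq I) (F : I -> T -> C) : (forall i, citg (F i)) ->
  cEx (fun w => \sum_(i <- s) F i w) = \sum_(i <- s) cEx (F i).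
Proof.
move=> mF; elim: s => [|i s IH].
  by rewrite big_nil -[RHS](cEx_cst 0); apply: eq_cEx => w; rewrite big_nil.
rewrite big_cons -IH -cExD//; last exact: citg_sum.
by apply: eq_cEx => w; rewrite big_cons.
Qed.

Lemma cEx_ae F G : cmf F -> cmf G -> {ae P, forall w, F w = G w} -> cEx F = cEx G.
Proof.
move=> [F1 F2] [G1 G2] FG; congr (_ +i* _); apply: Ex_ae => //;
  by move: FG; apply: filterS => w ->.
Qed.

(** After multiplication by the conjugate of the mean the expectation is real, and
a real part is at most a modulus. *)
Lemma normc_cEx F : citg F -> normc (cEx F) <= Ex P (fun w => normc (F w)).
Proof.
move=> iF; set c := cEx F.
have [c0|c0] := eqVneq (normc c) 0.
  by rewrite c0; apply: Ex_ge0 => w; exact: normc_ge0.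
have cgt0 : 0 < normc c by rewrite lt_neqAle eq_sym c0 normc_ge0.
rewrite -(ler_pM2l cgt0).
have -> : normc c * normc c = Re (cEx (fun w => conjc c * F w)).
  rewrite cExZ// -/c ReM; case: (c) => a b /=.
  rewrite -expr2 sqr_sqrtr ?addr_ge0 ?sqr_ge0//; ring.
have nJ : normc (conjc c) = normc c by case: (c) => a b /=; rewrite sqrrN.
rewrite -[Re (cEx _)]/(Ex P (fun w => Re (conjc c * F w))) -ExZ; last exact: citg_norm.
apply: Ex_le.
- exact: (citgZ (conjc c) iF).1.
- by apply: itgZ; exact: citg_norm.
- move=> w; rewrite -nJ -normcM; apply: le_trans (Re_le_normc _); exact: ler_norm.
Qed.

Lemma normc_cEx_le F M : cmf F -> (forall w, normc (F w) <= M) -> normc (cEx F) <= M.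
Proof.
move=> mF FM; have iF := citg_bounded mF FM.
rewrite (le_trans (normc_cEx iF))// -[leRHS](Ex_cst P M).
by apply: Ex_le => //; [exact: citg_norm|exact: itg_cst].
Qed.

Lemma cEx_dct (F : nat -> T -> C) G (g : T -> R) :
  (forall n, cmf (F n)) -> cmf G -> itg P g -> (forall n w, normc (F n w) <= g w) ->
  (forall w, normc (F n w - G w) @[n --> \oo] --> 0) ->
  normc (cEx (F n) - cEx G) @[n --> \oo] --> 0.
Proof.
move=> mF mG ig Fg FG.
have cR w : Re (F n w) @[n --> \oo] --> Re (G w).
  apply: (cvg_dist0 _ (FG w)); apply: nearW => n.
  by rewrite -ReN -ReD Re_le_normc.
have cI w : Im (F n w) @[n --> \oo] --> Im (G w).
  apply: (cvg_dist0 _ (FG w)); apply: nearW => n.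
  by rewrite -ImN -ImD Im_le_normc.
have dR : Ex P (fun w => Re (F n w)) @[n --> \oo] --> Ex P (fun w => Re (G w)).
  apply: (Ex_dct (g := g)) => //.
  - by move=> n; have [] := mF n.
  - by have [] := mG.
  - by move=> n w; exact: le_trans (Re_le_normc _) (Fg n w).
have dI : Ex P (fun w => Im (F n w)) @[n --> \oo] --> Ex P (fun w => Im (G w)).
  apply: (Ex_dct (g := g)) => //.
  - by move=> n; have [] := mF n.
  - by have [] := mG.
  - by move=> n w; exact: le_trans (Im_le_normc _) (Fg n w).
have cS : (`|Ex P (fun w => Re (F n w)) - Ex P (fun w => Re (G w))| +
   `|Ex P (fun w => Im (F n w)) - Ex P (fun w => Im (G w))|) @[n --> \oo] --> 0.
  by rewrite -[X in _ --> X]addr0; apply: cvgD; exact: dist0_cvg.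
apply: (cvg0_squeeze _ cS); apply: nearW => n; rewrite normc_ge0 andTb.
by apply: (le_trans (normc_le_ReIm _)); rewrite ReD ImD ReN ImN.
Qed.

End complex_expectation.

Lemma complex_law_transfer (R : realType) d (T' : measurableType d)
  d1 (T1 : measurableType d1) (P1 : probability T1 R)
  d2 (T2 : measurableType d2) (P2 : probability T2 R)
  (Z1 : T1 -> T') (Z2 : T2 -> T') (F1 : T1 -> R[i]) (F2 : T2 -> R[i]) :
  measurable_fun [set: T1] Z1 -> measurable_fun [set: T2] Z2 ->
  citg P1 F1 -> citg P2 F2 ->
  (forall A, measurable A -> cEx P1 (fun w => (\1_A (Z1 w))%:C * F1 w)
     = cEx P2 (fun w => (\1_A (Z2 w))%:C * F2 w)) ->
  forall (g : T' -> R[i]) M, cmf g -> (forall x, normc (g x) <= M) ->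
  cEx P1 (fun w => g (Z1 w) * F1 w) = cEx P2 (fun w => g (Z2 w) * F2 w).
Proof.
move=> mZ1 mZ2 [iR1 iI1] [iR2 iI2] H g M [mRg mIg] gM.
have bR : bmf (fun x => Re (g x)).
  by split => //; exists M => x; exact: le_trans (Re_le_normc _) (gM x).
have bI : bmf (fun x => Im (g x)).
  by split => //; exists M => x; exact: le_trans (Im_le_normc _) (gM x).
have HR A : measurable A -> Ex P1 (fun w => \1_A (Z1 w) * Re (F1 w))
     = Ex P2 (fun w => \1_A (Z2 w) * Re (F2 w)).
  move=> mA; have := congr1 (fun z => Re z) (H A mA); rewrite /cEx/=.
  under eq_Ex do rewrite ReM/= mul0r subr0.
  by under [in RHS]eq_Ex do rewrite ReM/= mul0r subr0.
have HI A : measurable A -> Ex P1 (fun w => \1_A (Z1 w) * Im (F1 w))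
     = Ex P2 (fun w => \1_A (Z2 w) * Im (F2 w)).
  move=> mA; have := congr1 (fun z => Im z) (H A mA); rewrite /cEx/=.
  under eq_Ex do rewrite ImM/= mul0r addr0.
  by under [in RHS]eq_Ex do rewrite ImM/= mul0r addr0.
congr (_ +i* _).
  under eq_Ex do rewrite ReM.
  under [in RHS]eq_Ex do rewrite ReM.
  rewrite (ExB (itgMb mZ1 bR iR1) (itgMb mZ1 bI iI1)).
  rewrite (ExB (itgMb mZ2 bR iR2) (itgMb mZ2 bI iI2)).
  by rewrite (law_transfer mZ1 mZ2 iR1 iR2 HR bR) (law_transfer mZ1 mZ2 iI1 iI2 HI bI).
under eq_Ex do rewrite ImM.
under [in RHS]eq_Ex do rewrite ImM.
rewrite (ExD (itgMb mZ1 bR iI1) (itgMb mZ1 bI iR1)).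
rewrite (ExD (itgMb mZ2 bR iI2) (itgMb mZ2 bI iR2)).
by rewrite (law_transfer mZ1 mZ2 iR1 iR2 HR bI) (law_transfer mZ1 mZ2 iI1 iI2 HI bR).
Qed.


(** * Products over independent variables *)
Section independence.
Context d (T : measurableType d) (R : realType) (P : probability T R).
Local Notation C := R[i].

Lemma indic_bigcap (I : eqType) (s : seq I) (E : I -> set T) w :
  \1_(\bigcap_(i in [set` s]) E i) w = \prod_(i <- s) \1_(E i) w :> R.
Proof.
elim: s => [|i s IH].
  by rewrite big_nil indicE mem_set// => j /=; rewrite in_nil.
rewrite big_cons -IH !indicE -natrM mulnb; congr (nat_of_bool _)%:R.
apply/idP/andP; rewrite !inE.
  by move=> H; split; [|move=> j js]; apply: H => /=; rewrite inE ?eqxx ?js ?orbT.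
by move=> [Hi Hs] j /=; rewrite inE => /orP[/eqP -> //|]; exact: Hs.
Qed.

Lemma cEx_indic (A : set T) : measurable A -> cEx P (fun w => (\1_A w)%:C) = (fine (P A))%:C.
Proof. by move=> mA; rewrite cEx_real Ex_prob. Qed.

Context d' (T' : measurableType d').

Lemma normc_indic (A : set T') x : normc ((\1_A x)%:C : C) <= 1.
Proof.
by rewrite normc_real indicE; case: (_ \in _); rewrite ?normr1 ?normr0.
Qed.

Lemma cmf_indic (A : set T') : measurable A -> cmf (fun x => (\1_A x)%:C : C).
Proof. by move=> mA; apply: cmf_real; exact: measurable_indic. Qed.

(** Independence passes from events to bounded functions one factor at a time:
for a fixed choice of the other factors, both sides are functions of the event
in the current factor to which [complex_law_transfer] applies. *)
Lemma independent_cEx_prod (I : choiceType) (Z : I -> T -> T') (s : seq I)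
    (f : I -> T' -> C) :
  (forall i, measurable_fun [set: T] (Z i)) -> mutually_independent P Z ->
  (forall i, cmf (f i)) -> (forall i x, normc (f i x) <= 1) -> uniq s ->
  cEx P (fun w => \prod_(i <- s) f i (Z i w))
  = \prod_(i <- s) cEx P (fun w => f i (Z i w)).
Proof.
move=> mZ indep mf f1 us.
(* The factors still to be treated are indicators, indexed by [s2]. *)
suff H s2 (A : I -> set T') : (forall i, measurable (A i)) -> uniq (s ++ s2) ->
    cEx P (fun w => \prod_(i <- s) f i (Z i w) *
                    \prod_(i <- s2) (\1_(A i) (Z i w))%:C)
    = \prod_(i <- s) cEx P (fun w => f i (Z i w)) *
      \prod_(i <- s2) (fine (P (Z i @^-1` A i)))%:C.
  have := H [::] (fun=> set0) (fun=> measurable0); rewrite cats0 big_nil mulr1.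
  move=> <- //; apply: eq_cEx => w; by rewrite big_nil mulr1.
have mpre i B : measurable B -> measurable (Z i @^-1` B).
  by move=> mB; rewrite -[X in measurable X]setTI; exact: mZ.
elim: s s2 A us => [|i s IH] s2 A us mA us2.
  rewrite big_nil mul1r.
  transitivity (cEx P (fun w => (\1_(\bigcap_(i in [set` s2]) (Z i @^-1` A i)) w)%:C)).
    apply: eq_cEx => w; rewrite big_nil mul1r indic_bigcap rmorph_prod.
    by apply: eq_bigr => i _; congr (_%:C).
  rewrite cEx_indic; last by apply: fin_bigcap_measurable => // i _; exact: mpre.
  rewrite indep// -rmorph_prod; congr (_%:C).
  elim: s2 {us2} => [|i s2 IH2]; first by rewrite !big_nil.
  rewrite !big_cons fineM ?IH2//; first by apply: fin_num_measure; exact: mpre.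
  elim: s2 {IH2} => [|j s2 IH2]; rewrite ?big_nil// big_cons fin_numM//.
  by apply: fin_num_measure; exact: mpre.
move: us us2; rewrite /= => /andP[is_ us] /andP[iss2 uss2].
pose F w := \prod_(i <- s) f i (Z i w) * \prod_(i <- s2) (\1_(A i) (Z i w))%:C.
have mF : cmf F.
  apply: cmfM; apply: cmf_prod => j; first exact: cmf_comp.
  by apply: (cmf_comp (F := fun x => (\1_(A j) x)%:C)) => //; exact: cmf_indic.
have F1 w : normc (F w) <= 1.
  by apply: normcM_le1; apply: normc_prod_le1 => j //; exact: normc_indic.
have iF := citg_bounded P mF F1.
transitivity (cEx P (fun w => f i (Z i w) * F w)).
  by apply: eq_cEx => w; rewrite big_cons -mulrA.
set c := \prod_(j <- s) cEx P (fun w => f j (Z j w)) *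
      \prod_(j <- s2) (fine (P (Z j @^-1` A j)))%:C.
transitivity (cEx P (fun w => f i (Z i w) * c)); last first.
  rewrite big_cons -mulrA -/c [RHS]mulrC -cExZ.
    by apply: eq_cEx => w; rewrite mulrC.
  by apply: (@citg_bounded _ _ _ P _ 1) => //; exact: cmf_comp.
apply: (complex_law_transfer (mZ i) (mZ i) iF (citg_cst P c) _ (mf i) (f1 i)) => B mB.
pose A' j := if j == i then B else A j.
have mA' j : measurable (A' j) by rewrite /A'; case: ifP.
have A'E j : j != i -> A' j = A j by rewrite /A' => /negbTE ->.
have A's2 j : j \in s2 -> j != i.
  by move=> js2; apply: contraNneq iss2 => <-; rewrite mem_cat js2 orbT.
have := IH (i :: s2) A' us mA'; rewrite -cat1s uniq_catCA /= iss2 uss2 => /(_ isT).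
have A'i : A' i = B by rewrite /A' eqxx.
rewrite big_cons A'i mulrCA => E.
transitivity ((fine (P (Z i @^-1` B)))%:C * c); last first.
  rewrite mulrC -(cEx_indic (mpre i B mB)) -cExZ.
    by apply: eq_cEx => w; rewrite mulrC.
  apply: (@citg_bounded _ _ _ P _ 1); first by apply: cmf_real; apply: measurable_indic; exact: mpre.
  by move=> w; rewrite (_ : \1__ w = \1_B (Z i w))// normc_indic.
have -> : c = \prod_(j <- s) cEx P (fun w => f j (Z j w)) *
      \prod_(j <- s2) (fine (P (Z j @^-1` A' j)))%:C.
  congr (_ * _); rewrite !big_seq; apply: eq_bigr => j /A's2 ji.
  by rewrite A'E.
rewrite -{}E; apply: eq_cEx => w.
rewrite big_cons A'i /F [LHS]mulrCA; congr (_ * (_ * _)).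
rewrite !big_seq; apply: eq_bigr => j /A's2 ji.
by rewrite A'E.
Qed.

End independence.


(** * Bernstein polynomials in several variables *)
Section bernstein_1d.
Context {R : realType}.
Implicit Types (t : R) (f : nat -> R).

(** [binw n t k] is the binomial probability of [k] successes in [n] trials,
defined by conditioning on the first trial so that moments follow by
induction. *)
Fixpoint binw (n : nat) (t : R) (k : nat) : R :=
  if n is n'.+1 then
    (1 - t) * binw n' t k + (if k is k'.+1 then t * binw n' t k' else 0)
  else (k == 0)%:R.

Lemma binw_ge0 n t k : 0 <= t <= 1 -> 0 <= binw n t k.
Proof.
move=> /andP[t0 t1]; elim: n k => [|n IH] k /=; first exact: ler0n.
by rewrite addr_ge0 ?mulr_ge0 ?subr_ge0//; case: k => // k; rewrite mulr_ge0.
Qed.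

Lemma binw_gt n t k : (n < k)%N -> binw n t k = 0.
Proof.
elim: n k => [|n IH] [|k]//= nk; rewrite !IH ?mulr0 ?addr0//.
exact: ltnW.
Qed.

Lemma sum_binwS n t f : \sum_(k < n.+2) binw n.+1 t k * f k =
  (1 - t) * (\sum_(k < n.+1) binw n t k * f k) +
  t * (\sum_(k < n.+1) binw n t k * f k.+1).
Proof.
under eq_bigr do rewrite /= mulrDl.
rewrite big_split /=; congr (_ + _).
  rewrite big_ord_recr/= binw_gt// mulr0 mul0r addr0 mulr_sumr.
  by apply: eq_bigr => i _; rewrite mulrA.
rewrite big_ord_recl/= mul0r add0r mulr_sumr.
by apply: eq_bigr => i _; rewrite mulrA.
Qed.

Lemma sum_binw n t : \sum_(k < n.+1) binw n t k = 1.
Proof.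
rewrite (_ : \sum_(_ < _) _ = \sum_(k < n.+1) binw n t k * (fun=> 1) (k : nat)); last first.
  by apply: eq_bigr => i _; rewrite mulr1.
elim: n => [|n IH]; first by rewrite big_ord1 /= mulr1.
rewrite (sum_binwS n t (fun=> 1)) IH; ring.
Qed.

Lemma sum_binw_id n t : \sum_(k < n.+1) binw n t k * k%:R = n%:R * t.
Proof.
elim: n => [|n IH]; first by rewrite big_ord1 /= mulr0 mul0r.
rewrite (sum_binwS n t (fun k => k%:R)) IH; under eq_bigr do rewrite -natr1 mulrDr mulr1.
rewrite big_split/= IH sum_binw -natr1; ring.
Qed.

Lemma sum_binw_sqr n t : \sum_(k < n.+1) binw n t k * k%:R ^+ 2
  = n%:R * t * (1 - t) + (n%:R * t) ^+ 2.
Proof.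
elim: n => [|n IH]; first by rewrite big_ord1 /= !expr2 !(mulr0, mul0r) addr0.
rewrite (sum_binwS n t (fun k => k%:R ^+ 2)) IH.
rewrite (eq_bigr (fun k : 'I_n.+1 => binw n t k * k%:R ^+ 2 +
   (binw n t k * k%:R) * 2 + binw n t k)); last first.
  by move=> k _; rewrite -natr1; ring.
rewrite !big_split/= IH sum_binw -mulr_suml sum_binw_id -natr1; ring.
Qed.

Lemma sum_binw_var n t : 0 <= t <= 1 ->
  \sum_(k < n.+2) binw n.+1 t k * (k%:R / n.+1%:R - t) ^+ 2 <= n.+1%:R^-1.
Proof.
move=> /andP[t0 t1].
have n0 : n.+1%:R != 0 :> R by rewrite pnatr_eq0.
have -> : \sum_(k < n.+2) binw n.+1 t k * (k%:R / n.+1%:R - t) ^+ 2 =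
    t * (1 - t) / n.+1%:R.
  rewrite (eq_bigr (fun k : 'I_n.+2 => (binw n.+1 t k * k%:R ^+ 2) * (n.+1%:R^-1 ^+ 2)
     + (binw n.+1 t k * k%:R) * (- 2 * t / n.+1%:R) + binw n.+1 t k * t ^+ 2)).
    rewrite !big_split/= -!mulr_suml sum_binw_sqr sum_binw_id sum_binw.
    by field.
  by move=> k _; field.
rewrite ler_piMl ?invr_ge0//; nra.
Qed.

End bernstein_1d.

Section bernstein.
Context {R : realType} (m : nat).
Implicit Types (y : 'rV[R]_m).

Definition bernstein (G : 'rV[R]_m -> R) n y : R :=
  \sum_(k : {ffun 'I_m -> 'I_n.+2})
    G (\row_i ((k i)%:R / n.+1%:R)) * \prod_i binw n.+1 (y ord0 i) (k i).

(** Uniform continuity on the unit cube, by compactness. *)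
Lemma unif_cont_cube (G : 'rV[R]_m -> R) (e : R) : continuous G -> 0 < e ->
  exists2 r : R, 0 < r & forall x y : 'rV[R]_m, (forall i, 0 <= x ord0 i <= 1) ->
    (forall i, `|x ord0 i - y ord0 i| < r) -> `|G x - G y| < e.
Proof.
move=> cG e0.
pose K := [set x : 'rV[R]_m | forall i, `[0, 1]%classic (x ord0 i)].
have cK : compact K by apply: (@rV_compact R m (fun=> `[0, 1]%classic)) => i; exact: segment_compact.
have nK := (compact_near_coveringP K).1 cK.
have := nK R 0^'+ (fun (r : R) (x : 'rV[R]_m) => forall y : 'rV[R]_m, (forall i, `|x ord0 i - y ord0 i| < r) ->
   `|G x - G y| < e) _ _.
move=> H.
have {}H : \forall r \near 0^'+, K `<=` (fun x : 'rV[R]_m => forall y : 'rV[R]_m, (forall i, `|x ord0 i - y ord0 i| < r) ->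
   `|G x - G y| < e).
  apply: H => x Kx.
  have := cG x => /cvgrPdist_lt /(_ (e / 2)); rewrite divr_gt0// => /(_ isT).
  move=> /nbhs_ballP[r /= r0 rG].
  have r2 : 0 < r / 2 by rewrite divr_gt0.
  near=> x' d => y xy.
  have dr : d < r / 2 by near: d; exact: nbhs_right_lt.
  have bx : forall i, ball (x ord0 i) (r / 2) (x' ord0 i).
    have : ball x (r / 2) x' by near: x'; exact: (nbhsx_ballx x (r / 2) r2).
    by move=> [_ /(_ ord0)].
  have h1 : `|G x - G x'| < e / 2.
    apply: rG; split => // i j; rewrite (ord1 i).
    by have := bx j; apply: le_ball; lra.
  have h2 : `|G x - G y| < e / 2.
    apply: rG; split => // i j; rewrite (ord1 i).
    have := bx j; have := xy j; rewrite /ball/= => h3 h4.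
    have -> : x ord0 j - y ord0 j = (x ord0 j - x' ord0 j) + (x' ord0 j - y ord0 j) by ring.
    rewrite (le_lt_trans (ler_normD _ _))//.
    have : `|x' ord0 j - y ord0 j| < r / 2 by exact: lt_trans dr.
    by move: h4; lra.
  have -> : G x' - G y = (G x - G y) - (G x - G x') by ring.
  by rewrite (le_lt_trans (ler_normB _ _))//; lra.
near (0 : R)^'+ => r.
exists r; first by near: r; exact: nbhs_right_gt.
move=> x y x01 xy.
have HK : K `<=` (fun x : 'rV[R]_m => forall y : 'rV[R]_m, (forall i, `|x ord0 i - y ord0 i| < r) ->
   `|G x - G y| < e) by near: r.
by apply: HK => // i /=; rewrite in_itv/= x01.
Unshelve. all: by end_near.
Qed.

Lemma prod_sum_ffun (p : nat) (F : 'I_m -> 'I_p -> R) :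
  \prod_i \sum_j F i j = \sum_(k : {ffun 'I_m -> 'I_p}) \prod_i F i (k i).
Proof. exact: bigA_distr_bigA. Qed.

(** Under the product of [m] binomial laws, the grid point deviates from [y] by
more than [r] in some coordinate with probability at most [m / (n r^2)]. *)
Lemma bernstein_approx (G : 'rV[R]_m -> R) (M e : R) : continuous G -> (forall x, `|G x| <= M) ->
  0 < e -> exists n, forall y : 'rV[R]_m, (forall i, 0 <= y ord0 i <= 1) ->
    `|G y - bernstein G n y| <= e.
Proof.
move=> cG GM e0.
have e2 : 0 < e / 2 by rewrite divr_gt0.
have [r r0 rG] := unif_cont_cube cG e2.
have M0 : 0 <= M by rewrite (le_trans (normr_ge0 _) (GM 0)).
have C0 : 0 <= 2 * M / r ^+ 2 := divr_ge0 (mulr_ge0 (ler0n R 2) M0) (sqr_ge0 r).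
pose D := 2 * M * m%:R / r ^+ 2.
have D0 : 0 <= D by rewrite /D !mulr_ge0 ?invr_ge0 ?sqr_ge0.
pose n := Num.truncn (D / (e / 2)).
have nD : D / n.+1%:R <= e / 2.
  rewrite ler_pdivrMr ?ltr0n// mulrC -ler_pdivrMr// ltW//.
  exact: truncnS_gt.
exists n => y y01.
pose w (k : {ffun 'I_m -> 'I_n.+2}) := \prod_i binw n.+1 (y ord0 i) (k i).
have w0 k : 0 <= w k by apply: prodr_ge0 => i _; apply: binw_ge0.
have w1 : \sum_k w k = 1.
  rewrite -(@prod_sum_ffun n.+2 (fun i j => binw n.+1 (y ord0 i) j)).
  by rewrite big1// => i _; rewrite sum_binw.
have wvar j : \sum_k w k * ((k j)%:R / n.+1%:R - y ord0 j) ^+ 2 <= n.+1%:R^-1.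
  rewrite (eq_bigr (fun k : {ffun 'I_m -> 'I_n.+2} => \prod_i
    (binw n.+1 (y ord0 i) (k i) * (if i == j then ((k i)%:R / n.+1%:R - y ord0 i) ^+ 2 else 1)))).
    rewrite -(@prod_sum_ffun n.+2 (fun i l => binw n.+1 (y ord0 i) l *
      (if i == j then (l%:R / n.+1%:R - y ord0 i) ^+ 2 else 1))).
    rewrite (bigD1 j)//= eqxx [X in _ * X]big1 ?mulr1.
      exact: sum_binw_var.
    move=> i /negbTE ->; under eq_bigr do rewrite mulr1.
    by rewrite sum_binw.
  move=> k _; rewrite big_split/=; congr (_ * _).
  by rewrite (bigD1 j)//= eqxx big1 ?mulr1// => i /negbTE ->.
have Gy : G y = \sum_k G y * w k by rewrite -mulr_sumr w1 mulr1.
rewrite Gy /bernstein -sumrB.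
rewrite (le_trans (ler_norm_sum _ _ _))//.
(* Either the grid point is close to [y], or one coordinate is at least [r] away
   and the sum of squares makes up for the oscillation [2 * M]. *)
have key k : `|G y * w k - G (\row_i ((k i)%:R / n.+1%:R)) * w k| <=
   w k * (e / 2) + (2 * M / r ^+ 2) * (\sum_j w k * ((k j)%:R / n.+1%:R - y ord0 j) ^+ 2).
  rewrite -mulrBl normrM (ger0_norm (w0 k)) mulrC -mulr_sumr.
  rewrite [X in _ <= _ + X]mulrCA -mulrDr.
  apply: ler_wpM2l => //.
  have S0 : 0 <= \sum_i ((k i)%:R / n.+1%:R - y ord0 i) ^+ 2.
    by apply: sumr_ge0 => i _; exact: sqr_ge0.
  have [close|] := pselect (forall i, `|y ord0 i - (\row_i ((k i)%:R / n.+1%:R)) ord0 i| < r).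
    rewrite (le_trans (ltW (rG _ _ y01 close)))// lerDl mulr_ge0//.
  move=> /existsNP[j /negP]; rewrite -leNgt mxE => far.
  rewrite (le_trans (ler_normB _ _))// (@le_trans _ _ (2 * M))//.
    by rewrite (_ : 2 * M = M + M); [exact: lerD|ring].
  rewrite (le_trans _ (_ : 2 * M / r ^+ 2 * (\sum_i ((k i)%:R / n.+1%:R - y ord0 i) ^+ 2) <= _))//; last first.
    by rewrite lerDr ltW.
  rewrite -mulrA ler_peMr ?mulr_ge0// mulrC ler_pdivlMr ?exprn_gt0// mul1r.
  rewrite (bigD1 j)//= (le_trans (_ : _ <= ((k j)%:R / n.+1%:R - y ord0 j) ^+ 2))//.
    by rewrite -[leRHS]real_normK ?num_real// distrC lerXn2r// nnegrE ltW.
  by rewrite lerDl; apply: sumr_ge0 => i _; exact: sqr_ge0.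
rewrite (le_trans (ler_sum _ (fun k _ => key k)))//.
rewrite big_split/= -mulr_suml w1 mul1r -mulr_sumr exchange_big/=.
rewrite [leRHS](_ : e = e / 2 + e / 2); last by field.
rewrite lerD2l (le_trans _ nD)//.
rewrite (le_trans (ler_wpM2l C0 (ler_sum _ (fun j _ => wvar j))))//.
rewrite sumr_const card_ord -mulr_natl /D le_eqVlt; apply/orP; left; apply/eqP.
by field; apply/andP; split; [rewrite nat1r pnatr_eq0|rewrite gt_eqF].
Qed.

End bernstein.


(** * Trigonometric polynomials *)
Section trigonometric_polynomials.
Context {R : realType} (m : nat).
Implicit Types (h g : 'rV[R]_m -> R) (x c : 'rV[R]_m).

Definition lform c x : R := \sum_i c ord0 i * x ord0 i.

Lemma lformD c c' x : lform (c + c') x = lform c x + lform c' x.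
Proof. by rewrite /lform -big_split/=; apply: eq_bigr => i _; rewrite mxE mulrDl. Qed.

Lemma lformN c x : lform (- c) x = - lform c x.
Proof. by rewrite /lform -sumrN; apply: eq_bigr => i _; rewrite mxE mulNr. Qed.

Definition trigpoly h := exists s : seq (R * 'rV[R]_m * R),
  forall x, h x = \sum_(q <- s) q.1.1 * cos (lform q.1.2 x + q.2).

Lemma trig_cos c b : trigpoly (fun x => cos (lform c x + b)).
Proof. by exists [:: (1, c, b)] => x; rewrite big_seq1 mul1r. Qed.

Lemma trigZ a h : trigpoly h -> trigpoly (fun x => a * h x).
Proof.
move=> [s hs]; exists [seq (a * q.1.1, q.1.2, q.2) | q <- s] => x.
by rewrite hs big_map mulr_sumr; apply: eq_bigr => q _; rewrite mulrA.
Qed.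

Lemma trigD h g : trigpoly h -> trigpoly g -> trigpoly (fun x => h x + g x).
Proof. by move=> [s hs] [s' hs']; exists (s ++ s') => x; rewrite big_cat hs hs'. Qed.

Lemma trig_cst a : trigpoly (fun=> a).
Proof.
exists [:: (a, 0, 0)] => x; rewrite big_seq1/= addr0 /lform big1 ?cos0 ?mulr1// => i _.
by rewrite mxE mul0r.
Qed.

Lemma trig_sum I (r : seq I) (h : I -> 'rV[R]_m -> R) :
  (forall i, trigpoly (h i)) -> trigpoly (fun x => \sum_(i <- r) h i x).
Proof.
move=> th; elim: r => [|i r IH].
  by under eq_fun do rewrite big_nil; exact: trig_cst.
by under eq_fun do rewrite big_cons; exact: trigD.
Qed.

Lemma cosM (u v : R) : cos u * cos v = 2^-1 * (cos (u + v) + cos (u - v)).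
Proof. by rewrite cosD cosB; field. Qed.

Lemma trigM h g : trigpoly h -> trigpoly g -> trigpoly (fun x => h x * g x).
Proof.
move=> [s hs] [s' hs'].
under eq_fun do rewrite hs hs' mulr_suml.
apply: trig_sum => q; under eq_fun do rewrite mulr_sumr.
apply: trig_sum => q'.
have -> : (fun x => q.1.1 * cos (lform q.1.2 x + q.2) *
    (q'.1.1 * cos (lform q'.1.2 x + q'.2))) =
  (fun x => (q.1.1 * q'.1.1 / 2) * (cos (lform (q.1.2 + q'.1.2) x + (q.2 + q'.2)) +
    cos (lform (q.1.2 - q'.1.2) x + (q.2 - q'.2)))).
  apply/funext => x; rewrite !lformD lformN.
  rewrite mulrACA cosM -!mulrA; do 3 congr (_ * _).
  by congr (cos _ + cos _); ring.
by apply: trigZ; apply: trigD; exact: trig_cos.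
Qed.

Lemma trig_prod I (r : seq I) (h : I -> 'rV[R]_m -> R) :
  (forall i, trigpoly (h i)) -> trigpoly (fun x => \prod_(i <- r) h i x).
Proof.
move=> th; elim: r => [|i r IH].
  by under eq_fun do rewrite big_nil; exact: trig_cst.
by under eq_fun do rewrite big_cons; exact: trigM.
Qed.

Lemma trig_sin (a : R) (i : 'I_m) : trigpoly (fun x => sin (a * x ord0 i)).
Proof.
have -> : (fun x : 'rV[R]_m => sin (a * x ord0 i)) =
    (fun x => cos (lform (a *: delta_mx ord0 i) x + - (pi / 2))).
  apply/funext => x; rewrite cosBpihalf; congr sin.
  rewrite /lform (bigD1 i)//= big1 ?addr0 => [|j ji].
    by rewrite !mxE !eqxx mulr1.
  by rewrite !mxE (negbTE ji) andbF mulr0 mul0r.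
exact: trig_cos.
Qed.

Lemma trig_binw n k h : trigpoly h -> trigpoly (fun x => binw n (h x) k).
Proof.
move=> th; elim: n k => [|n IH] k /=; first exact: trig_cst.
apply: trigD.
  apply: trigM => //; apply: trigD; first exact: trig_cst.
  by under eq_fun do rewrite -mulN1r; exact: trigZ.
by case: k => [|k]; [exact: trig_cst|exact: trigM].
Qed.

Lemma row_continuous (g : R -> R) : continuous g ->
  continuous (fun x : 'rV[R]_m => \row_i g (x ord0 i)).
Proof.
move=> cg x A /nbhs_ballP[e /= e0 eA].
exists (fun i j => [set v | ball (g (x ord0 j)) e (g v)]).
  move=> i j; rewrite (ord1 i).
  by have /cvg_ballP /(_ _ e0) := cg (x ord0 j).
by move=> z H; apply: eA; split => // i j; rewrite !mxE; exact: H.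
Qed.

(** Near [0] this inverts [u |-> (1 + sin u) / 2]; clamping the argument away from
the endpoints of the domain of [asin] makes it continuous on the whole line. *)
Definition unsin (y : R) : R :=
  asin (Num.max (- sin 2^-1) (Num.min (sin 2^-1) (2 * y - 1))).

Lemma half_pihalf : (2^-1 : R) < pi / 2.
Proof. by have := @pihalf_ge1 R; lra. Qed.

Lemma sin_half : 0 < sin (2^-1 : R) < 1.
Proof.
have h := half_pihalf.
apply/andP; split; first by apply: sin_gt0_pihalf; rewrite h andbT; lra.
rewrite -[ltRHS]sin_pihalf ltr_sin ?in_itv//=.
all: try (apply/andP; split); lra.
Qed.

Lemma unsinK u : `|u| <= 2^-1 -> unsin ((1 + sin u) / 2) = u.
Proof.
rewrite ler_norml => /andP[u1 u2]; have h := half_pihalf.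
have itv v : - 2^-1 <= v <= 2^-1 -> v \in `[(- (pi / 2) : R), pi / 2].
  by move=> /andP[v1 v2]; rewrite in_itv/=; apply/andP; split; lra.
have le_sin : {in `[(- (pi / 2) : R), pi / 2] &, {mono sin : x y / x <= y}}.
  by move=> a b ha hb; rewrite !leNgt ltr_sin.
rewrite /unsin (_ : 2 * _ - 1 = sin u); last by field.
have s2 : sin u <= sin 2^-1.
  by rewrite le_sin ?itv//; apply/andP; split; lra.
have s1 : - sin 2^-1 <= sin u.
  by rewrite -sinN le_sin ?itv//; apply/andP; split; lra.
rewrite (min_idPr s2) (max_idPr s1) sinK// itv//.
by apply/andP; split; lra.
Qed.

Lemma unsin_continuous : continuous unsin.
Proof.
move=> y; have /andP[s0 s1] := sin_half.
pose F z : R := Num.max (- sin 2^-1) (Num.min (sin 2^-1) (2 * z - 1)).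
have cF : {for y, continuous F}.
  apply: continuous_max; first exact: cvg_cst.
  apply: continuous_min; first exact: cvg_cst.
  by apply: cvgB; [apply: cvgM; [exact: cvg_cst|exact: cvg_id]|exact: cvg_cst].
have cA : {for F y, continuous (@asin R)}.
  apply: continuous_asin; rewrite /F lt_max gt_max gt_min s1.
  by apply/andP; split; [apply/orP; left; lra|rewrite orTb andbT; lra].
exact: (continuous_comp cF cA).
Qed.

(** A polynomial in the [sin (x_i / (2 L))] stays bounded on the whole space, and
on the cube [|x_i| <= L] these sines are coordinates: so Bernstein polynomials
in them approximate [f] there without growing outside. *)
Lemma trigpoly_approx (f : 'rV[R]_m -> R) (M L e : R) : continuous f ->
  (forall x, `|f x| <= M) -> 0 < L -> 0 < e -> exists p : 'rV[R]_m -> R,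
  [/\ trigpoly p, forall x, `|p x| <= M + e &
      forall x : 'rV[R]_m, (forall i, `|x ord0 i| <= L) -> `|f x - p x| <= e].
Proof.
move=> cf fM L0 e0.
pose G (y : 'rV[R]_m) := f (\row_i (2 * L * unsin (y ord0 i))).
have cG : continuous G.
  have cr : continuous (fun y : 'rV[R]_m => \row_i (2 * L * unsin (y ord0 i))).
    apply: (@row_continuous (fun v => 2 * L * unsin v)) => v.
    by apply: cvgM; [exact: cvg_cst|exact: unsin_continuous].
  by move=> y; exact: (continuous_comp (cr y) (cf _)).
have GM y : `|G y| <= M by exact: fM.
have [n nG] := bernstein_approx cG GM e0.
pose Y (x : 'rV[R]_m) : 'rV[R]_m := \row_i ((1 + sin ((2 * L)^-1 * x ord0 i)) / 2).
have Y01 x i : 0 <= Y x ord0 i <= 1.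
  rewrite mxE; have := sin_le1 ((2 * L)^-1 * x ord0 i).
  have := sin_geN1 ((2 * L)^-1 * x ord0 i).
  by move=> h1 h2; apply/andP; split; lra.
exists (fun x => bernstein G n (Y x)); split.
- apply: trig_sum => k; apply: trigZ; apply: trig_prod => i.
  apply: trig_binw; under eq_fun do rewrite mxE mulrC.
  by apply: trigZ; apply: trigD; [exact: trig_cst|exact: trig_sin].
- move=> x; rewrite [bernstein _ _ _](_ : _ = G (Y x) - (G (Y x) - bernstein G n (Y x))); last by ring.
  by rewrite (le_trans (ler_normB _ _))// lerD// nG.
- move=> x xL.
  have -> : f x = G (Y x).
    congr f; apply/rowP => i; rewrite !mxE unsinK; first by field; rewrite gt_eqF.
    have L2 : 0 < 2 * L by rewrite mulr_gt0.
    rewrite normrM (@ger0_norm _ (2 * L)^-1) ?invr_ge0 ?(ltW L2)//.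
    rewrite mulrC ler_pdivrMr// mulrA mulVf ?mul1r ?pnatr_eq0//.
  exact: nG.
Qed.

End trigonometric_polynomials.


(** * Characteristic functions and finite dimensional convergence *)
Lemma cvg_sum_seq {R : realType} I (s : seq I) (u : I -> nat -> R) (l : I -> R) :
  (forall i, u i n @[n --> \oo] --> l i) ->
  \sum_(i <- s) u i n @[n --> \oo] --> \sum_(i <- s) l i.
Proof.
move=> ul; elim: s => [|i s IH].
  have -> : (fun n => \sum_(i <- [::]) u i n) = cst 0.
    by apply/funext => n; rewrite big_nil.
  by rewrite big_nil; exact: cvg_cst.
have -> : (fun n => \sum_(j <- i :: s) u j n) = (fun n => u i n + \sum_(j <- s) u j n).
  by apply/funext => n; rewrite big_cons.
by rewrite big_cons; exact: cvgD.
Qed.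

Section fdd_characteristic.
Context {R : realType}.
Local Notation C := R[i].

Definition charf (X : process R) (m : nat) (t c : 'I_m -> R) : C :=
  cEx (pr_prob X) (fun w => cis (\sum_i c i * X (t i) w)).

Definition charf1 (X : process R) (t s : R) : C :=
  cEx (pr_prob X) (fun w => cis (s * X t w)).

Lemma charf1E X t s : charf1 X t s = charf X (fun _ : 'I_1 => t) (fun=> s).
Proof. by apply: eq_cEx => w; rewrite big_ord1. Qed.

Lemma measurable_cos : measurable_fun [set: R] (@cos R).
Proof. by apply: continuous_measurable_fun; exact: continuous_cos. Qed.

Lemma measurable_lin (X : process R) (m : nat) (t c : 'I_m -> R) :
  measurable_fun [set: pr_space X] (fun w => \sum_i c i * X (t i) w).
Proof. by apply: measurable_sum => i; apply: measurable_funM. Qed.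

Lemma quad_le_cos (u : R) : `|u| <= 1 -> u ^+ 2 <= 3 * (1 - cos u).
Proof.
move=> u1; have := cos_sub_cube u; rewrite ler_norml => /andP[_].
have : `|u| ^+ 3 <= u ^+ 2.
  rewrite -[u ^+ 2]real_normK ?num_real// exprS.
  by rewrite ler_piMl// exprn_ge0.
lra.
Qed.

(** A quadratic bound on the characteristic function at the origin is a bound
on the truncated second moments, hence on the tails. *)
Lemma tail_bound (X : process R) (t A : R) :
  (forall s, 1 - Re (charf1 X t s) <= A * s ^+ 2) ->
  forall L : R, 0 < L ->
  Ex (pr_prob X) (fun w => (L < `|X t w|)%R%:R) <= 3 * A / L ^+ 2.
Proof.
move=> HA L L0.
have mX : measurable_fun [set: pr_space X] (fun w => `|X t w|) by apply: measurableT_comp.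
have mcmp (b : pr_space X -> bool) : measurable_fun [set: pr_space X] b ->
    measurable_fun [set: pr_space X] (fun w => (b w)%:R : R).
  move=> mb; have -> : (fun w => (b w)%:R : R) = (fun w => if b w then 1 else 0).
    by apply/funext => w; case: (b w).
  exact: measurable_fun_ifT.
pose F k w : R := ((L < `|X t w|) && (`|X t w| <= k%:R))%R%:R.
have mF k : measurable_fun [set: pr_space X] (F k).
  apply: mcmp; apply: measurable_and; first exact: measurable_fun_ltr.
  exact: measurable_fun_ler.
have mL : measurable_fun [set: pr_space X] (fun w => (L < `|X t w|)%R%:R : R).
  by apply: mcmp; exact: measurable_fun_ltr.
have FL k : 0 < (k%:R : R) -> Ex (pr_prob X) (F k) <= 3 * A / L ^+ 2.
  move=> k0.
  have iF : itg (pr_prob X) (F k).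
    apply: (@itg_bounded _ _ _ _ _ 1) => // w; rewrite /F.
    by case: (_ && _); rewrite ?normr1 ?normr0.
  have icos : itg (pr_prob X) (fun w => 1 - cos (k%:R^-1 * X t w)).
    apply: (@itg_bounded _ _ _ _ _ (1 + 1)).
      apply: measurable_funB => //; apply: (measurableT_comp measurable_cos).
      exact: measurable_funM.
    by move=> w; rewrite (le_trans (ler_normB _ _))// normr1 lerD2l cos_max.
  rewrite ler_pdivlMr ?exprn_gt0// mulrC -ExZ//.
  have k2 : 0 < (k%:R : R) ^+ 2 by rewrite exprn_gt0.
  apply: (@le_trans _ _ (Ex (pr_prob X) (fun w => (3 * k%:R ^+ 2) * (1 - cos (k%:R^-1 * X t w))))).
    apply: Ex_le => [||w]; [exact: itgZ|exact: itgZ|].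
    rewrite /F; case: (boolP (_ && _)) => [/andP[h1 h2]|_]; last first.
      rewrite mulr0n.
      by rewrite mulr0 mulr_ge0 ?mulr_ge0 ?subr_ge0 ?cos_le1// ltW.
    rewrite mulr1n mulr1.
    apply: (@le_trans _ _ (`|X t w| ^+ 2)).
      by rewrite lerXn2r// ?nnegrE// ltW.
    have h3 : `|k%:R^-1 * X t w| <= 1.
      by rewrite normrM ger0_norm ?invr_ge0 ?(ltW k0)// mulrC ler_pdivrMr// mul1r.
    have := quad_le_cos h3; rewrite exprMn real_normK ?num_real//.
    rewrite exprVn -[X in _ -> X <= _](mulVKf (lt0r_neq0 k2)).
    by move=> /(ler_wpM2l (ltW k2)); rewrite [X in _ <= X](_ : _ = 3 * k%:R ^+ 2 * (1 - cos (k%:R^-1 * X t w)))//; ring.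
  rewrite ExZ// ExB; [|exact: itg_cst|]; last first.
    apply: (@itg_bounded _ _ _ _ _ 1) => [|w]; last exact: cos_max.
    apply: (measurableT_comp measurable_cos).
    exact: measurable_funM.
  rewrite (Ex_cst _ 1).
  have := HA k%:R^-1; rewrite /charf1 /cEx/= => H.
  rewrite (le_trans (ler_wpM2l _ H)) ?mulr_ge0 ?(ltW k2)//.
  rewrite le_eqVlt; apply/orP; left; apply/eqP; field.
  by rewrite gt_eqF.
have cF : Ex (pr_prob X) (F k) @[k --> \oo] --> Ex (pr_prob X) (fun w => (L < `|X t w|)%R%:R).
  apply: (Ex_dct (g := cst 1)) => //; first exact: itg_cst.
    by move=> k w; rewrite /F; case: (_ && _); rewrite ?normr1 ?normr0.
  move=> w; apply: cvg_near_cst.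
  near=> k; rewrite /F; have -> : `|X t w| <= k%:R; last by rewrite andbT.
  near: k; exact: nbhs_infty_ger.
apply: (cvgr_to_le cF); near=> k; apply: FL.
by rewrite ltr0n; near: k; exact: nbhs_infty_gt.
Unshelve. all: by end_near.
Qed.

Lemma Ex_cos (X : process R) (m : nat) (t c : 'I_m -> R) b :
  Ex (pr_prob X) (fun w => cos (\sum_i c i * X (t i) w + b)) =
  Re (cis b * charf X t c).
Proof.
have ic : citg (pr_prob X) (fun w => cis (\sum_i c i * X (t i) w)).
  apply: (@citg_bounded _ _ _ _ _ 1); first by apply: cmf_cis; exact: measurable_lin.
  by move=> w; rewrite normc_cis.
rewrite /charf -cExZ// /cEx; apply: eq_Ex => w.
by rewrite -cisD /= addrC.
Qed.

Lemma Ex_trigpoly_cvg (X : nat -> process R) (Y : process R) (m : nat)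
    (t : 'I_m -> R) p :
  (forall c, normc (charf (X n) t c - charf Y t c) @[n --> \oo] --> 0) ->
  trigpoly p ->
  Ex (pr_prob (X n)) (fun w => p (\row_i X n (t i) w)) @[n --> \oo] -->
    Ex (pr_prob Y) (fun w => p (\row_i Y (t i) w)).
Proof.
move=> cX [s ps].
have E (Z : process R) : Ex (pr_prob Z) (fun w => p (\row_i Z (t i) w)) =
    \sum_(q <- s) q.1.1 * Re (cis q.2 * charf Z t (fun i => q.1.2 ord0 i)).
  have ic (c : 'I_m -> R) b : itg (pr_prob Z) (fun w => cos (\sum_i c i * Z (t i) w + b)).
    apply: (@itg_bounded _ _ _ _ _ 1); last by move=> w; exact: cos_max.
    apply: (measurableT_comp measurable_cos).
    by apply: measurable_funD => //; exact: measurable_lin.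
  rewrite (@eq_Ex _ _ _ _ _ (fun w => \sum_(q <- s) q.1.1 *
      cos (\sum_i q.1.2 ord0 i * Z (t i) w + q.2))).
    rewrite Ex_sum; last by move=> q; exact: itgZ.
    by apply: eq_bigr => q _; rewrite ExZ// Ex_cos.
  move=> w; rewrite ps; apply: eq_bigr => q _; congr (_ * cos (_ + _)).
  by apply: eq_bigr => i _; rewrite mxE.
have -> : (fun n => Ex (pr_prob (X n)) (fun w => p (\row_i X n (t i) w))) =
    (fun n => \sum_(q <- s) q.1.1 * Re (cis q.2 * charf (X n) t (fun i => q.1.2 ord0 i))).
  by apply/funext => n; exact: E.
rewrite E; apply: cvg_sum_seq => q.
apply: cvgM; first exact: cvg_cst.
apply: (cvg_dist0 _ (cX (fun i => q.1.2 ord0 i))); apply: nearW => n.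
rewrite -ReN -ReD -mulrBr (le_trans (Re_le_normc _))//.
by rewrite normcM normc_cis mul1r.
Qed.

Lemma trigpoly_measurable (X : process R) (m : nat) (t : 'I_m -> R) p :
  trigpoly p -> measurable_fun [set: pr_space X] (fun w => p (\row_i X (t i) w)).
Proof.
move=> [s ps].
under eq_fun do rewrite ps.
apply: measurable_sum => q; apply: measurable_funM => //.
apply: (measurableT_comp measurable_cos).
apply: measurable_funD => //; rewrite /lform.
apply: measurable_sum => i; apply: measurable_funM => //.
have -> : (fun w => (\row_j X (t j) w) ord0 i) = X (t i) by apply/funext => w; rewrite mxE.
by [].
Qed.

(** The composite is a pointwise limit of trigonometric polynomials in the
coordinates. *)
Lemma fdd_measurable (X : process R) (m : nat) (t : 'I_m -> R)
    (f : 'rV[R]_m -> R) (M : R) :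
  continuous f -> (forall x, `|f x| <= M) ->
  measurable_fun [set: pr_space X] (fun w => f (\row_i X (t i) w)).
Proof.
move=> cf fM.
have /choice[p Hp] : forall k : nat, exists p : 'rV[R]_m -> R, trigpoly p /\
    forall x : 'rV[R]_m, (forall i, `|x ord0 i| <= k.+1%:R) -> `|f x - p x| <= k.+1%:R^-1.
  move=> k; have k0 : 0 < (k.+1%:R^-1 : R) by rewrite invr_gt0.
  by have [p [p1 _ p3]] := trigpoly_approx cf fM (ltr0Sn R k) k0; exists p.
apply: (measurable_fun_cvg (h := fun k w => p k (\row_i X (t i) w))).
  by move=> k; apply: trigpoly_measurable; have [] := Hp k.
move=> w _ /=.
set x := \row_i _.
have [K xK] : exists K : nat, forall i, `|x ord0 i| <= K%:R.
  exists (Num.truncn (\sum_i `|x ord0 i|)).+1 => i.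
  rewrite (le_trans _ (ltW (truncnS_gt _)))// (bigD1 i)//= lerDl.
  by apply: sumr_ge0.
have c0 : (k.+1%:R^-1 : R) @[k --> \oo] --> 0 by exact: cvg_harmonic.
apply/cvgrPdist_lt => e e0; near=> k.
apply: (@le_lt_trans _ _ k.+1%:R^-1).
  apply: (Hp k).2 => i; rewrite (le_trans (xK i))// ler_nat.
  by apply: leqW; near: k; exact: nbhs_infty_ge.
near: k; exact: (cvgr_lt _ c0).
Unshelve. all: by end_near.
Qed.

(** Lévy's continuity theorem for finite dimensional distributions, in the case
of a known limit and of characteristic functions with a uniform quadratic
bound. *)
Lemma fdd_cvg_charf (X : nat -> process R) (Y : process R) :
  (forall m (t c : 'I_m -> R), (forall i, 0 <= t i) ->
    normc (charf (X n) t c - charf Y t c) @[n --> \oo] --> 0) ->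
  (forall t, 0 <= t -> exists A, forall n s, 1 - Re (charf1 (X n) t s) <= A * s ^+ 2) ->
  fdd_cvg X Y.
Proof.
move=> cX HA m t f t0 cf [M fM].
have EE (Z : process R) : ('E_(pr_prob Z)[f \o @fdd R Z m t] =
    (Ex (pr_prob Z) (fun w => f (\row_i Z (t i) w)))%:E)%E.
  rewrite unlock -Ex_fin//.
  by apply: (@itg_bounded _ _ _ _ _ M) => //; exact: fdd_measurable.
rewrite EE; under eq_fun do rewrite EE.
apply: cvg_EFin; first exact: nearW.
rewrite (_ : fine \o _ = fun n => Ex (pr_prob (X n)) (fun w => f (\row_i X n (t i) w)))//.
have M0 : 0 <= M by rewrite (le_trans (normr_ge0 _) (fM 0)).
have /choice[A' HA'] : forall i : 'I_m, exists A, forall n s,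
    1 - Re (charf1 (X n) (t i) s) <= A * s ^+ 2.
  by move=> i; exact: HA.
pose A i := `|A' i|.
have A0 i : 0 <= A i by exact: normr_ge0.
have HXA i n s : 1 - Re (charf1 (X n) (t i) s) <= A i * s ^+ 2.
  by rewrite (le_trans (HA' i n s))// ler_wpM2r ?sqr_ge0// ler_norm.
have HYA i s : 1 - Re (charf1 Y (t i) s) <= A i * s ^+ 2.
  have : 1 - Re (charf1 (X n) (t i) s) @[n --> \oo] --> 1 - Re (charf1 Y (t i) s).
    apply: cvgB; first exact: cvg_cst.
    apply: (cvg_dist0 _ (cX 1%N (fun=> t i) (fun=> s) (fun=> t0 i))); apply: nearW => n.
    by rewrite -ReN -ReD -!charf1E Re_le_normc.
  move=> H; apply: (cvgr_to_le H); apply: nearW => n; exact: HXA.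
pose S := \sum_i 3 * A i.
have S0 : 0 <= S by apply: sumr_ge0 => i _; rewrite mulr_ge0.
apply/cvgrPdist_lt => e e0.
pose e' := Num.min (e / 8) 1.
have e'0 : 0 < e' by rewrite /e' lt_min ltr01 andbT; lra.
have e'8 : e' <= e / 8 by rewrite /e' ge_min lexx.
have e'1 : e' <= 1 by rewrite /e' ge_min lexx orbT.
(* [L] is chosen such that an excursion beyond it, weighted by [2 * M + 1], costs
   at most [e']. *)
pose B := (2 * M + 1) * S.
have B0 : 0 <= B by rewrite mulr_ge0// addr_ge0// mulr_ge0.
pose L := B / e' + 1.
have L1 : 1 <= L by rewrite lerDr divr_ge0// ltW.
have L0 : 0 < L by rewrite (lt_le_trans ltr01).
have BL : B / L ^+ 2 <= e'.
  rewrite ler_pdivrMr ?exprn_gt0// mulrC -ler_pdivrMr//.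
  have : L <= L ^+ 2 by rewrite expr2 ler_peMl// ltW.
  by apply: le_trans; rewrite lerDl.
(* On the cube [p] is [e']-close to [f]; outside the difference is at most
   [2 * M + e']. *)
have [p [tp pM pf]] := trigpoly_approx cf fM L0 e'0.
have close (Z : process R) : (forall i s, 1 - Re (charf1 Z (t i) s) <= A i * s ^+ 2) ->
    `|Ex (pr_prob Z) (fun w => f (\row_i Z (t i) w)) -
      Ex (pr_prob Z) (fun w => p (\row_i Z (t i) w))| <= 2 * e'.
  move=> HZ.
  have i_f : itg (pr_prob Z) (fun w => f (\row_i Z (t i) w)).
    by apply: (@itg_bounded _ _ _ _ _ M) => //; exact: fdd_measurable cf fM.
  have i_p : itg (pr_prob Z) (fun w => p (\row_i Z (t i) w)).
    by apply: (@itg_bounded _ _ _ _ _ (M + e')) => //; exact: trigpoly_measurable.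
  have i_t i : itg (pr_prob Z) (fun w => (L < `|Z (t i) w|)%R%:R).
    apply: (@itg_bounded _ _ _ _ _ 1) => [|w]; last by case: (_ < _); rewrite ?normr1 ?normr0.
    have -> : (fun w => (L < `|Z (t i) w|)%R%:R : R) = (fun w => if L < `|Z (t i) w| then 1 else 0).
      by apply/funext => w; case: (_ < _).
    apply: measurable_fun_ifT => //; apply: measurable_fun_ltr => //.
    exact: measurableT_comp.
  rewrite -ExB// (le_trans (Ex_norm _))//; first exact: itgB.
  apply: (@le_trans _ _ (Ex (pr_prob Z) (fun w => e' + (2 * M + 1) * \sum_i (L < `|Z (t i) w|)%R%:R))).
    apply: Ex_le.
    - by apply: itg_norm; exact: itgB.
    - by apply: itgD; [exact: itg_cst|apply: itgZ; exact: itg_sum].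
    move=> w.
    have sum0 : 0 <= \sum_i (L < `|Z (t i) w|)%R%:R :> R by apply: sumr_ge0 => i _.
    have [small|] := pselect (forall i, `|(\row_i Z (t i) w) ord0 i| <= L).
      rewrite (le_trans (pf _ small))// lerDl mulr_ge0// addr_ge0// mulr_ge0//.
    move=> /existsNP[i /negP]; rewrite -ltNge mxE => big.
    rewrite (le_trans (ler_normB _ _))// (le_trans (lerD (fM _) (pM _)))//.
    rewrite (_ : M + (M + e') = e' + (2 * M)); last by ring.
    rewrite lerD2l (le_trans (_ : _ <= 2 * M + 1)) ?lerDl// ler_peMr//.
      by rewrite addr_ge0// mulr_ge0.
    by rewrite (bigD1 i)//= big lerDl; apply: sumr_ge0.
  rewrite ExD; [|exact: itg_cst|by apply: itgZ; exact: itg_sum].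
  rewrite (Ex_cst _ e') ExZ; last exact: itg_sum.
  rewrite Ex_sum//.
  rewrite (_ : 2 * e' = e' + e'); last by ring.
  rewrite lerD2l (le_trans _ BL)// /B -mulrA ler_wpM2l//.
    by rewrite addr_ge0// mulr_ge0.
  rewrite mulr_suml; apply: ler_sum => i _.
  exact: tail_bound.
have cp := Ex_trigpoly_cvg (fun c => cX m t c t0) tp.
near=> n.
have h1 := close Y HYA; have h2 := close (X n) (fun i => HXA i n).
have h3 : `|Ex (pr_prob Y) (fun w => p (\row_i Y (t i) w)) -
   Ex (pr_prob (X n)) (fun w => p (\row_i X n (t i) w))| < e / 8.
  near: n; apply: cvgr_dist_lt => //; lra.
move: h1 h2 h3; set a := Ex _ _; set b := Ex _ _; set c := Ex _ _; set d := Ex _ _.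
move=> h1 h2 h3.
rewrite (_ : a - c = (a - b) + (b - d) - (c - d)); last by ring.
rewrite (le_lt_trans (ler_normB _ _))// (le_lt_trans (lerD (ler_normD _ _) (lexx _)))//.
lra.
Unshelve. all: by end_near.
Qed.

End fdd_characteristic.


(** * Second order expansion of normal characteristic functions *)

Section density.
Context d (T : measurableType d) (R : realType).
Context (mu nu : {measure set T -> \bar R}) (h : T -> R).
Hypotheses (mh : measurable_fun [set: T] h) (h0 : forall x, 0 <= h x).
Hypothesis nuE : forall A, measurable A -> nu A = (\int[mu]_(x in A) (h x)%:E)%E.
Import HBNNSimple.

Let density_nnsfun (f : {nnsfun T >-> R}) :
  (\int[nu]_x (f x)%:E = \int[mu]_x (f x * h x)%:E)%E.
Proof.
have mhE D : measurable_fun D (EFin \o h) by apply/measurable_EFinP; exact: measurable_funTS.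
under [LHS]eq_integral do rewrite fimfunE -fsumEFin//.
rewrite [LHS]ge0_integral_fsum//; last 2 first.
  - by move=> r; exact/measurable_EFinP/measurableT_comp.
  - by move=> n x _; rewrite EFinM nnfun_muleindic_ge0.
under [RHS]eq_integral.
  move=> x _; rewrite EFinM muleC fimfunE -fsumEFin// ge0_mule_fsumr; last first.
    by move=> r; rewrite EFinM nnfun_muleindic_ge0.
  over.
rewrite [RHS]ge0_integral_fsum//; last 2 first.
  - by move=> r; apply: emeasurable_funM => //; apply/measurable_EFinP/measurableT_comp.
  - move=> n x _; apply: mule_ge0; first by rewrite lee_fin.
    by rewrite EFinM nnfun_muleindic_ge0.
apply: eq_fsbigr => r _.
rewrite integralZl_indic_nnsfun// integral_indic// setIT nuE//.
under [RHS]eq_integral do rewrite EFinM muleCA.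
have [r0|r0] := leP 0 r; last first.
  rewrite preimage_nnfun0// integral_set0 mule0.
  by under eq_integral do rewrite indic0 mule0 mule0; rewrite integral0.
rewrite ge0_integralZl//; last 2 first.
  - by apply: emeasurable_funM => //; apply/measurable_EFinP.
  - by move=> x _; rewrite mule_ge0 ?lee_fin.
congr (_ * _)%E; rewrite integral_mkcond/=; apply: eq_integral => x _.
by rewrite patchE indicE; case: ifPn => xA; rewrite ?mule1 ?mule0.
Qed.

(** Both sides are monotone limits along simple functions. *)
Lemma ge0_integral_density (f : T -> R) : measurable_fun [set: T] f ->
  (forall x, 0 <= f x) -> (\int[nu]_x (f x)%:E = \int[mu]_x (f x * h x)%:E)%E.
Proof.
move=> mf f0.
have mEf : measurable_fun [set: T] (EFin \o f) by exact/measurable_EFinP.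
pose f_ := nnsfun_approx measurableT mEf.
have cf_ x : ((f_ n x)%:E @[n --> \oo] --> (f x)%:E)%E.
  by apply: (cvg_nnsfun_approx measurableT mEf) => // y _; rewrite lee_fin.
have ndf x : {homo (fun n => f_ n x) : m n / (m <= n)%N >-> m <= n}.
  by move=> m n mn; exact/lefP/nd_nnsfun_approx.
transitivity (lim (\int[nu]_x (f_ n x)%:E @[n --> \oo])%E).
  rewrite -monotone_convergence//=.
  - by apply: eq_integral => x _; apply/esym/cvg_lim.
  - by move=> n; exact/measurable_EFinP.
  - by move=> n x _; rewrite lee_fin.
  - by move=> x _ m n mn; rewrite lee_fin ndf.
under eq_fun do rewrite density_nnsfun.
rewrite -monotone_convergence//=.
- apply: eq_integral => x _; apply/cvg_lim => //.
  under eq_fun do rewrite EFinM; rewrite EFinM.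
  by apply: cvgeMr.
- by move=> n; apply/measurable_EFinP; exact: measurable_funM.
- by move=> n x _; rewrite lee_fin mulr_ge0.
- by move=> x _ m n mn; rewrite lee_fin ler_wpM2r// ndf.
Qed.

End density.

Section symmetric_integral.
Context {R : realType}.
Local Notation mu := (@lebesgue_measure R).

Lemma ge0_integral_oppr (G : R -> R) : continuous G -> (forall x, 0 <= G x) ->
  (\int[mu]_x (G x)%:E = \int[mu]_x (G (- x))%:E)%E.
Proof.
have half (F : R -> R) : continuous F -> (forall x, 0 <= F x) ->
    (\int[mu]_x (F x)%:E = \int[mu]_(x in `[0%R, +oo[) (F x)%:E
      + \int[mu]_(x in `[0%R, +oo[) (F (- x))%:E)%E.
  move=> cF F0.
  have mF : measurable_fun [set: R] F by exact: continuous_measurable_fun.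
  rewrite -(setUv `[0%R, +oo[%classic) ge0_integral_setU//= ; last 4 first.
    exact: measurableC.
    by apply/measurable_EFinP; rewrite setUv.
    by move=> x _; rewrite lee_fin.
    exact/disj_setPCl.
  congr (_ + _)%E; rewrite setCitvr.
  rewrite integral_itv_bndo_bndc; last exact/measurable_EFinP/measurable_funTS.
  rewrite -{1}oppr0 ge0_integration_by_substitutionNy//.
  exact: continuous_subspaceT.
move=> cG G0; rewrite half// [RHS]half//.
  by rewrite addeC; congr (_ + _)%E; apply: eq_integral => x _; rewrite ?opprK.
by move=> x; apply: (@continuous_comp _ _ _ -%R G); [exact: opp_continuous|exact: cG].
Qed.

End symmetric_integral.

Section real_bounds.
Context {R : realType}.
Implicit Types u y r : R.

Lemma cos_le_quartic u : cos u <= 1 - u ^+ 2 / 2 + u ^+ 4 / 24.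
Proof.
wlog u0 : u / 0 <= u.
  move=> H; have [u0|/ltW u0] := leP 0 u; first exact: H.
  by have := H (- u); rewrite cosN sqrrN (_ : (- u) ^+ 4 = u ^+ 4) ?oppr_ge0; [apply|ring].
rewrite -subr_ge0.
apply: (@nonneg_of_derive _ (fun z => (1 - z ^+ 2 / 2 + z ^+ 4 / 24) - cos z)
          (fun z => sin z - (z - z ^+ 3 / 6))) => //.
- move=> z; apply: is_derive_eq; rewrite /GRing.scale /=; ring || lra || nra.
- by rewrite cos0; lra.
- by move=> z /ltW z0; rewrite subr_ge0 sin_ge_cube.
Qed.

Lemma expRN_le y : 0 <= y -> expR (- y) <= (1 + y)^-1.
Proof.
move=> y0; rewrite expRN lef_pV2 ?posrE ?expR_gt0//; last lra.
exact: expR_ge1Dx.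
Qed.

(** The Gaussian bell [expR (- u^2 / 2)] osculates the cosine to fourth order, and
the fourth power is itself dominated by bells. *)
Lemma cos_sub_bell u :
  `|cos u - expR (- (u ^+ 2 / 2))| <= 8 * (1 - expR (- u ^+ 2)) ^+ 2.
Proof.
set y := u ^+ 2; have y0 : 0 <= y by exact: sqr_ge0.
have e1 : expR (- (y / 2)) <= 1 by rewrite expR_le1; lra.
have e0 := expR_ge0 (- (y / 2)).
have eb := expRN_le y0.
(* For large [y] the left side is at most 2 and the bracket at least 1 / 2. *)
have [y1|y1] := leP y 1; last first.
  have h : (1 + y)^-1 <= 2^-1 by rewrite lef_pV2 ?posrE; lra.
  have h2 : 4^-1 <= (1 - expR (- y)) ^+ 2.
    by rewrite (_ : 4^-1 = 2^-1 ^+ 2 :> R); [rewrite lerXn2r ?nnegrE//; lra|field].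
  rewrite (le_trans (ler_normB _ _))//.
  rewrite (ger0_norm e0); have := cos_max u; lra.
have h1 : y / 2 <= 1 - expR (- y).
  apply: (@le_trans _ _ (1 - (1 + y)^-1)); last by lra.
  have -> : 1 - (1 + y)^-1 = y * (1 + y)^-1 by field; lra.
  rewrite ler_wpM2l// lef_pV2 ?posrE; lra.
have h2 : y ^+ 2 / 4 <= (1 - expR (- y)) ^+ 2.
  by rewrite (_ : y ^+ 2 / 4 = (y / 2) ^+ 2); [rewrite lerXn2r ?nnegrE//; lra|field].
have h3 : `|expR (- (y / 2)) - 1 - - (y / 2)| <= (- (y / 2)) ^+ 2.
  by apply: expR_sub_quad; lra.
have := cos_le_quartic u; have := cos_ge_quad u.
rewrite -/y (_ : u ^+ 4 = y ^+ 2); last by rewrite /y -exprM.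
move: h3; rewrite ler_norml => /andP[h3 h4] h5 h6.
have h7 : (- (y / 2)) ^+ 2 = y ^+ 2 / 4 by field.
rewrite ler_norml; have := sqr_ge0 y; rewrite h7 in h3 h4 => h8.
by apply/andP; split; lra.
Qed.

Lemma invsqrt_bound r : 0 <= r ->
  1 - r / 2 <= (Num.sqrt (1 + r))^-1 <= 1 - r / 2 + r ^+ 2 / 2.
Proof.
move=> r0; set q := (Num.sqrt (1 + r))^-1.
have s0 : 0 < Num.sqrt (1 + r) by rewrite sqrtr_gt0; lra.
have q0 : 0 < q by rewrite invr_gt0.
have q2 : q ^+ 2 * (1 + r) = 1.
  rewrite /q exprVn sqr_sqrtr ?mulVf//; lra.
apply/andP; split.
  have [r2|r2] := leP (1 - r / 2) 0; first lra.
  rewrite leNgt; apply/negP => H.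
  have : q ^+ 2 < (1 - r / 2) ^+ 2 by rewrite ltrXn2r ?nnegrE// ltW.
  have h : (1 - r / 2) ^+ 2 * (1 + r) <= 1 by nra.
  move=> H2; have : q ^+ 2 * (1 + r) < (1 - r / 2) ^+ 2 * (1 + r) by rewrite ltr_pM2r; lra.
  lra.
rewrite leNgt; apply/negP => H.
have p0 : 0 <= 1 - r / 2 + r ^+ 2 / 2 by nra.
have H2 : (1 - r / 2 + r ^+ 2 / 2) ^+ 2 < q ^+ 2 by rewrite ltrXn2r ?nnegrE// ltW.
have h : 1 <= (1 - r / 2 + r ^+ 2 / 2) ^+ 2 * (1 + r).
  have -> : (1 - r / 2 + r ^+ 2 / 2) ^+ 2 * (1 + r) =
    1 + r ^+ 2 / 4 + r ^+ 3 * ((r - 2^-1) ^+ 2 + 11 / 4) / 4 by field.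
  have : 0 <= r ^+ 3 by rewrite exprn_ge0.
  have : 0 <= r ^+ 2 by rewrite exprn_ge0.
  have := sqr_ge0 (r - 2^-1); nra.
have : (1 - r / 2 + r ^+ 2 / 2) ^+ 2 * (1 + r) < q ^+ 2 * (1 + r) by rewrite ltr_pM2r; lra.
lra.
Qed.

End real_bounds.

Section normal_moments.
Context {R : realType}.
Local Notation mu := (@lebesgue_measure R).

Lemma normal_Ex (s : R) (g : R -> R) : measurable_fun [set: R] g ->
  (forall x, 0 <= g x) ->
  Ex (normal_prob 0 s) g = fine (\int[mu]_x (g x * normal_pdf 0 s x)%:E)%E.
Proof.
move=> mg g0; rewrite /Ex; congr fine; apply: ge0_integral_density => //.
- exact: measurable_normal_pdf.
- by move=> x; exact: normal_pdf_ge0.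
Qed.

Lemma measurable_bell (e : R) :
  measurable_fun [set: R] (fun x : R => expR (- (e * x ^+ 2))).
Proof.
apply: (measurableT_comp (@measurable_expR R)).
by apply: measurable_funN; apply: measurable_funM => //; exact: measurable_funX.
Qed.

Lemma bell_exponent (s e D x : R) : s != 0 -> D != 0 -> D = 1 + 2 * e * s ^+ 2 ->
  - (e * x ^+ 2) + - x ^+ 2 / (s ^+ 2 *+ 2) = - x ^+ 2 / (s ^+ 2 / D *+ 2).
Proof.
move=> s0 D0 DE; transitivity (- x ^+ 2 * D / (2 * s ^+ 2)); last first.
  by field; rewrite s0 D0.
by rewrite DE; field.
Qed.

Lemma normal_bell (s e : R) : 0 < s -> 0 <= e ->
  Ex (normal_prob 0 s) (fun x => expR (- (e * x ^+ 2))) =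
  (Num.sqrt (1 + 2 * e * s ^+ 2))^-1.
Proof.
move=> s0 e0; set D := 1 + _.
have D0 : 0 < D by rewrite ltr_pwDl// mulr_ge0 ?sqr_ge0// mulr_ge0.
pose s' := s / Num.sqrt D.
have sD0 : 0 < Num.sqrt D by rewrite sqrtr_gt0.
have s'0 : 0 < s' by rewrite divr_gt0.
rewrite normal_Ex; [|exact: measurable_bell|by move=> x; exact: expR_ge0].
have E x : expR (- (e * x ^+ 2)) * normal_pdf 0 s x = (Num.sqrt D)^-1 * normal_pdf 0 s' x.
  rewrite !normal_pdfE ?gt_eqF// /normal_peak /normal_fun.
  rewrite mulrCA -expRD mulrA; congr (_ * expR _).
    set A := s ^+ 2 * pi *+ 2.
    have A0 : 0 < A by rewrite /A mulrn_wgt0// mulr_gt0 ?pi_gt0// exprn_gt0.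
    have -> : s' ^+ 2 * pi *+ 2 = A * D^-1.
      by rewrite /s' /A exprMn exprVn sqr_sqrtr ?(ltW D0)//; ring.
    rewrite sqrtrM ?(ltW A0)// sqrtrV ?(ltW D0)//; field.
    by rewrite !gt_eqF// sqrtr_gt0.
  rewrite /s' exprMn exprVn sqr_sqrtr ?(ltW D0)// subr0.
  by apply: bell_exponent; rewrite ?gt_eqF.
under eq_integral do rewrite E EFinM.
rewrite integralZl//; last exact: integrable_normal_pdf.
by rewrite integral_normal_pdf mule1.
Qed.

Lemma normal_sin (s t : R) : s != 0 -> Ex (normal_prob 0 s) (fun x => sin (t * x)) = 0.
Proof.
move=> s0.
have cs : continuous (fun x : R => sin (t * x)).
  move=> x; apply: (@continuous_comp _ _ _ (fun x => t * x) (@sin R)); last exact: continuous_sin.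
  by apply: cvgM; [exact: cvg_cst|exact: cvg_id].
have i_s : itg (normal_prob 0 s) (fun x => sin (t * x)).
  apply: (@itg_bounded _ _ _ _ _ 1); last by move=> x; exact: sin_max.
  exact: continuous_measurable_fun.
have m1 : measurable_fun [set: R] (fun x : R => 1 + sin (t * x)).
  by apply: measurable_funD => //; exact: continuous_measurable_fun.
have m2 : measurable_fun [set: R] (fun x : R => 1 - sin (t * x)).
  by apply: measurable_funB => //; exact: continuous_measurable_fun.
have g1 x : 0 <= 1 + sin (t * x) by have := sin_geN1 (t * x); lra.
have g2 x : 0 <= 1 - sin (t * x) by have := sin_le1 (t * x); lra.
have : Ex (normal_prob 0 s) (fun x => 1 + sin (t * x)) = Ex (normal_prob 0 s) (fun x => 1 - sin (t * x)).
  rewrite !normal_Ex//; congr fine.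
  rewrite (@ge0_integral_oppr _ (fun x => (1 + sin (t * x)) * normal_pdf 0 s x)).
  - apply: eq_integral => x _; rewrite mulrN sinN; congr (_ * _)%:E.
    by rewrite !normal_pdfE// /normal_fun !subr0 sqrrN.
  - move=> x; apply: cvgM; last exact: continuous_normal_pdf.
    by apply: cvgD; [exact: cvg_cst|exact: cs].
  - by move=> x; rewrite mulr_ge0// normal_pdf_ge0.
rewrite ExD//; last exact: itg_cst.
rewrite ExB//; last exact: itg_cst.
by move=> /addrI /eqP; rewrite -addr_eq0 -mulr2n mulrn_eq0 => /eqP.
Qed.

(** Near the origin the characteristic function of a centred normal law is that of
its variance; the error is computed from Gaussian integrals of bells. *)
Lemma normal_cos (s t : R) : 0 < s ->
  `|Ex (normal_prob 0 s) (fun x => cos (t * x)) - 1 + (t * s) ^+ 2 / 2| <=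
   65 * (t * s) ^+ 4.
Proof.
move=> s0; set r := (t * s) ^+ 2.
have r0 : 0 <= r by exact: sqr_ge0.
set N := normal_prob 0 s.
have ib (e : R) : 0 <= e -> itg N (fun x => expR (- (e * x ^+ 2))).
  move=> e0; apply: (@itg_bounded _ _ _ _ _ 1) => [|x]; first exact: measurable_bell.
  by rewrite ger0_norm ?expR_ge0// expR_le1 oppr_le0 mulr_ge0// ?sqr_ge0.
have ic : itg N (fun x => cos (t * x)).
  apply: (@itg_bounded _ _ _ _ _ 1); last by move=> x; exact: cos_max.
  by apply: (measurableT_comp measurable_cos); exact: measurable_funM.
have t2 : 0 <= t ^+ 2 by exact: sqr_ge0.
have i1 := ib _ (divr_ge0 t2 (ler0n R 2)).
have i2 := ib _ t2.
have i3 := ib _ (mulr_ge0 (ler0n R 2) t2).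
have b1 := normal_bell s0 (divr_ge0 t2 (ler0n R 2)).
have b2 := normal_bell s0 t2.
have b3 := normal_bell s0 (mulr_ge0 (ler0n R 2) t2).
have H : `|Ex N (fun x => cos (t * x)) - Ex N (fun x => expR (- (t ^+ 2 / 2 * x ^+ 2)))| <=
   8 * (1 - 2 * Ex N (fun x => expR (- (t ^+ 2 * x ^+ 2))) + Ex N (fun x => expR (- (2 * t ^+ 2 * x ^+ 2)))).
  rewrite -ExB// (le_trans (Ex_norm _))//; first exact: itgB.
  apply: (@le_trans _ _ (Ex N (fun x => 8 * (1 - 2 * expR (- (t ^+ 2 * x ^+ 2)) + expR (- (2 * t ^+ 2 * x ^+ 2)))))).
    apply: Ex_le.
    - by apply: itg_norm; exact: itgB.
    - by apply: itgZ; apply: itgD => //; apply: itgB; [exact: itg_cst|exact: itgZ].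
    move=> x; have := cos_sub_bell (t * x); rewrite exprMn.
    rewrite (_ : t ^+ 2 * x ^+ 2 / 2 = t ^+ 2 / 2 * x ^+ 2); last by field.
    rewrite (_ : (1 - expR (- (t ^+ 2 * x ^+ 2))) ^+ 2 =
      1 - 2 * expR (- (t ^+ 2 * x ^+ 2)) + expR (- (2 * t ^+ 2 * x ^+ 2)))//.
    rewrite (_ : - (2 * t ^+ 2 * x ^+ 2) = - (t ^+ 2 * x ^+ 2) + - (t ^+ 2 * x ^+ 2)); last by ring.
    by rewrite expRD; ring.
  rewrite ExZ; last by apply: itgD => //; apply: itgB; [exact: itg_cst|exact: itgZ].
  rewrite ExD//; last by apply: itgB; [exact: itg_cst|exact: itgZ].
  rewrite ExB; [|exact: itg_cst|exact: itgZ].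
  by rewrite ExZ// (Ex_cst _ 1).
move: H; rewrite b1 b2 b3.
rewrite (_ : 2 * (t ^+ 2 / 2) * s ^+ 2 = r); last by rewrite /r; field.
rewrite (_ : 2 * t ^+ 2 * s ^+ 2 = 2 * r); last by rewrite /r; ring.
rewrite (_ : 2 * (2 * t ^+ 2) * s ^+ 2 = 4 * r); last by rewrite /r; ring.
have /andP[q1 q1'] := invsqrt_bound r0.
have /andP[q2 q2'] := invsqrt_bound (mulr_ge0 (ler0n R 2) r0).
have /andP[q3 q3'] := invsqrt_bound (mulr_ge0 (ler0n R 4) r0).
rewrite (_ : (t * s) ^+ 4 = r ^+ 2); last by rewrite /r -exprM.
have E2 : (2 * r) ^+ 2 = 4 * r ^+ 2 by ring.
have E4 : (4 * r) ^+ 2 = 16 * r ^+ 2 by ring.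
rewrite E2 in q2'; rewrite E4 in q3'.
clearbody r.
rewrite !ler_norml => /andP[h1 h2].
by apply/andP; split; lra.
Qed.

End normal_moments.


(** * Characteristic functions of a Wiener process *)
Section wiener.
Context {R : realType} (W : process R).
Hypothesis wW : standard_wiener W.
Local Notation C := R[i].
Local Notation P := (pr_prob W).

Lemma increments_independent (m : nat) (tau : nat -> R) (gam : 'I_m -> R) :
  0 <= tau 0 -> nondecreasing_seq tau ->
  cEx P (fun w => cis (\sum_(k < m) gam k * (W (tau k.+1) w - W (tau k) w))) =
  \prod_(k < m) cEx P (fun w => cis (gam k * (W (tau k.+1) w - W (tau k) w))).
Proof.
move=> t0 nd; have [_ _ /(_ m tau t0 nd) indep _] := wW.
have mZ (i : 'I_m) : measurable_fun [set: pr_space W] (W (tau i.+1) \- W (tau i) : pr_space W -> R).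
  exact: measurable_funB.
have mf (i : 'I_m) : cmf (fun x : R => cis (gam i * x)) by apply: cmf_cis; exact: measurable_funM.
have f1 (i : 'I_m) (x : R) : normc (cis (gam i * x)) <= 1 by rewrite normc_cis.
have := independent_cEx_prod mZ indep mf f1 (index_enum_uniq 'I_m).
by move=> <-; apply: eq_cEx => w; rewrite cis_sum.
Qed.

Definition normal_char (delta th : R) : R :=
  Ex (normal_prob 0 (Num.sqrt delta)) (fun x => cos (th * x)).

Lemma normal_char_le1 delta th : `|normal_char delta th| <= 1.
Proof.
rewrite /normal_char.
have ic : itg (normal_prob 0 (Num.sqrt delta)) (fun x : R => cos (th * x)).
  apply: (@itg_bounded _ _ _ _ _ 1); last by move=> x; exact: cos_max.
  by apply: (measurableT_comp measurable_cos); exact: measurable_funM.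
rewrite (le_trans (Ex_norm ic))// -[leRHS](Ex_cst (normal_prob (0:R) (Num.sqrt delta)) 1).
apply: Ex_le; [exact: itg_norm|exact: itg_cst|by move=> x; exact: cos_max].
Qed.

(** Only the cosine remains, as the normal law is symmetric. *)
Lemma increment_char (s t th : R) : 0 <= s -> s < t ->
  cEx P (fun w => cis (th * (W t w - W s w))) = (normal_char (t - s) th)%:C.
Proof.
move=> s0 st; have [_ /(_ s t s0 st) law _ _] := wW.
set N := normal_prob 0 (Num.sqrt (t - s)).
have sq0 : 0 < Num.sqrt (t - s) by rewrite sqrtr_gt0 subr_gt0.
have mI : measurable_fun [set: pr_space W] (W t \- W s : pr_space W -> R).
  exact: measurable_funB.
have tr := @complex_law_transfer R _ R _ _ P _ _ N (W t \- W s) id (cst 1) (cst 1) mI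
  (@measurable_id _ _ _) (citg_cst P 1) (citg_cst N 1) _ (fun x => cis (th * x)) 1.
transitivity (cEx P (fun w => cis (th * (W t \- W s) w) * cst 1 w)).
  by apply: eq_cEx => w; rewrite /cst mulr1.
rewrite tr.
- transitivity (cEx N (fun x : R => cis (th * x))).
    by apply: eq_cEx => x; rewrite /cst mulr1.
  by rewrite /cEx /= normal_sin// gt_eqF.
- move=> A mA.
  transitivity (cEx P (fun w => (\1_((W t \- W s) @^-1` A) w)%:C)).
    by apply: eq_cEx => w; rewrite /cst mulr1.
  transitivity (cEx N (fun x : R => (\1_A x)%:C)); last first.
    by apply: eq_cEx => w; rewrite /cst mulr1.
  rewrite !cEx_indic//; first by rewrite law.
  by rewrite -[X in measurable X]setTI; exact: mI.
- by apply: cmf_cis; exact: measurable_funM.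
- by move=> x; rewrite normc_cis.
Qed.

(** The increments over [N] equal pieces of an interval are i.i.d., which makes
every centred normal characteristic function an [N]-th power; the second order
expansion at the origin then determines it. *)
Lemma normal_charE (delta th : R) : 0 < delta ->
  normal_char delta th = expR (- (th ^+ 2 * delta / 2)).
Proof.
move=> d0.
(* Telescoping over [N] increments of length [delta / N]. *)
have pw N : (0 < N)%N -> normal_char (delta / N%:R) th ^+ N = normal_char delta th.
  move=> N0; have N0' : (0 : R) < N%:R by rewrite ltr0n.
  apply: complexI; rewrite rmorphXn/=.
  pose tau (k : nat) := k%:R * (delta / N%:R).
  have dN : 0 < delta / N%:R by rewrite divr_gt0.
  have nd : nondecreasing_seq tau.
    by move=> i j ij; rewrite /tau ler_wpM2r ?(ltW dN)// ler_nat.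
  have tau0 : 0 <= tau 0%N by rewrite /tau mul0r.
  have := @increments_independent N tau (fun=> th) tau0 nd.
  rewrite (eq_bigr (fun=> (normal_char (delta / N%:R) th)%:C)); last first.
    move=> k _; rewrite increment_char; last 2 first.
    - by rewrite /tau mulr_ge0// ltW.
    - by rewrite /tau ltr_pM2r// ltr_nat.
    rewrite (_ : tau k.+1 - tau k = delta / N%:R)//.
    by rewrite /tau -natr1; ring.
  rewrite prodr_const card_ord => <-.
  rewrite -[delta in RHS]subr0 -increment_char//.
  apply: eq_cEx => w; rewrite -mulr_sumr.
  rewrite -(big_mkord xpredT (fun k => W (tau k.+1) w - W (tau k) w)) telescope_sumr//.
  by rewrite /tau mul0r [N%:R * _]mulrC divfK// gt_eqF.
have cN : normc (((normal_char (delta / N%:R) th)%:C : C) ^+ N -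
    cexp (- (th ^+ 2 * delta / 2))%:C) @[N --> \oo] --> 0.
  apply: cvg_power_cexp.
  - by move=> N; rewrite normc_real normal_char_le1.
  - by rewrite /= oppr_le0 divr_ge0// mulr_ge0 ?sqr_ge0// ltW.
  have c0 : 65 * (th ^+ 2 * delta) ^+ 2 * N%:R^-1 @[N --> \oo] --> (0 : R).
    rewrite -[X in _ --> X](mulr0 (65 * (th ^+ 2 * delta) ^+ 2)).
    by apply: cvgM; [exact: cvg_cst|exact: cvg_invn0].
  apply: (cvg0_squeeze _ c0); near=> N; rewrite normc_ge0 andTb.
  have N0 : 0 < (N%:R : R) by rewrite ltr0n; near: N; exact: nbhs_infty_gt.
  have dN : 0 < delta / N%:R by rewrite divr_gt0.
  have sq0 : 0 < Num.sqrt (delta / N%:R) by rewrite sqrtr_gt0.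
  have -> : N%:R * ((normal_char (delta / N%:R) th)%:C - 1) - (- (th ^+ 2 * delta / 2))%:C
      = (N%:R * (normal_char (delta / N%:R) th - 1) + th ^+ 2 * delta / 2)%:C :> C.
    by rewrite rmorphD/= rmorphM/= rmorphB/= rmorphN/= rmorph_nat rmorph1 opprK.
  rewrite normc_real.
  have := normal_cos th sq0; rewrite exprMn sqr_sqrtr ?(ltW dN)//.
  rewrite (_ : (th * _) ^+ 4 = (th ^+ 2 * (delta / N%:R)) ^+ 2); last first.
    by rewrite -[in RHS](sqr_sqrtr (ltW dN)) -exprMn -exprM.
  rewrite -/(normal_char _ _) => H.
  have -> : N%:R * (normal_char (delta / N%:R) th - 1) + th ^+ 2 * delta / 2 =
    N%:R * (normal_char (delta / N%:R) th - 1 + th ^+ 2 * (delta / N%:R) / 2).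
    by field; rewrite gt_eqF.
  rewrite normrM (ger0_norm (ltW N0)) (le_trans (ler_wpM2l (ltW N0) H))//.
  rewrite le_eqVlt; apply/orP; left; apply/eqP; field.
  by rewrite gt_eqF.
have : normc ((normal_char delta th)%:C - cexp (- (th ^+ 2 * delta / 2))%:C) @[N --> \oo] --> (0 : R).
  move: cN; apply: cvg_trans; apply: near_eq_cvg; near=> N.
  by rewrite -rmorphXn/= pw//; near: N; exact: nbhs_infty_gt.
move=> /(cvg_lim (@Rhausdorff R)); rewrite lim_cst; last exact: Rhausdorff.
move=> /eq0_normc; rewrite cexp_real -rmorphB => /(congr1 (fun z : C => Re z)) /= /eqP.
by rewrite subr_eq0 => /eqP.
Unshelve. all: by end_near.
Qed.

Lemma wiener_increments (m : nat) (tau : nat -> R) (gam : 'I_m -> R) :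
  0 <= tau 0 -> nondecreasing_seq tau ->
  cEx P (fun w => cis (\sum_(k < m) gam k * (W (tau k.+1) w - W (tau k) w))) =
  (expR (- ((\sum_(k < m) gam k ^+ 2 * (tau k.+1 - tau k)) / 2)))%:C.
Proof.
move=> t0 nd; rewrite increments_independent// mulr_suml -sumrN expR_sum rmorph_prod.
apply: eq_bigr => k _.
have := nd k k.+1 (leqnSn k); rewrite le_eqVlt => /orP[/eqP E|lt_tau].
  rewrite -E subrr mulr0 mul0r oppr0 expR0.
  rewrite -[RHS](cEx_cst P 1); apply: eq_cEx => w.
  by rewrite subrr mulr0 cis0.
rewrite increment_char ?normal_charE ?subr_gt0//.
by rewrite (le_trans t0)// nd.
Qed.

End wiener.

Section sorted_times.
Context {R : realType} (s : seq R).
Hypotheses (ss : sorted <=%R s) (s0 : all (fun t => 0 <= t) s).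

(** The times in increasing order, preceded by [0] and continued constantly. *)
Definition grid (k : nat) : R := nth (last 0 s) (0 :: s) k.

Lemma grid0 : grid 0 = 0. Proof. by []. Qed.

Lemma grid_nd : nondecreasing_seq grid.
Proof.
have s0' : sorted <=%R (0 :: s).
  by case: (s) ss s0 => //= a l pl /andP[a0 _]; rewrite a0.
apply/nondecreasing_seqP => k; rewrite /grid.
have [ks|ks] := ltnP k.+1 (size (0 :: s)).
  by apply: (sorted_leq_nth le_trans le_refl _ s0') => //; rewrite inE// ltnW.
rewrite [leRHS]nth_default//.
move: ks; rewrite leq_eqVlt => /orP[/eqP [E]|ks]; last first.
  by rewrite nth_default.
rewrite -E (nth_last _ (0 :: s))//.
Qed.

Lemma grid_telescope (phi : R -> R) t : t \in s ->
  phi t - phi 0 = \sum_(k < size s) (grid k.+1 <= t)%R%:R * (phi (grid k.+1) - phi (grid k)).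
Proof.
move=> ts; set q := index t s.
have qs : (q < size s)%N by rewrite index_mem.
have tq : grid q.+1 = t by rewrite /grid/= nth_index.
rewrite (eq_bigr (fun k : 'I_(size s) => if (k < q.+1)%N then phi (grid k.+1) - phi (grid k) else 0)).
  rewrite -big_mkcond/=.
  rewrite -(big_ord_widen _ (fun k => phi (grid k.+1) - phi (grid k)))//.
  rewrite -(big_mkord xpredT (fun k => phi (grid k.+1) - phi (grid k))) telescope_sumr//.
  by rewrite tq grid0.
move=> k _; case: ltnP => kq.
  by rewrite -tq grid_nd ?mul1r// ltnS.
case: (boolP (grid k.+1 <= t)) => h; rewrite ?mul0r// mul1r.
have h2 : t <= grid k by rewrite -tq grid_nd.
have h3 : grid k <= grid k.+1 by rewrite grid_nd.
have -> : grid k = grid k.+1 by apply/eqP; rewrite eq_le h3 (le_trans h).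
by rewrite subrr.
Qed.

End sorted_times.

Section wiener_fdd.
Context {R : realType}.
Local Notation C := R[i].

(** The variance of [\sum_i c i * W (t i)] for a Wiener process [W]. *)
Definition minform m (t c : 'I_m -> R) : R :=
  \sum_i \sum_j c i * c j * Num.min (t i) (t j).

Section times.
Context (m : nat) (t c : 'I_m -> R) (t0 : forall i, 0 <= t i).
Let s := sort <=%R [seq t i | i <- enum 'I_m].
Let gam (k : 'I_(size s)) : R := \sum_i c i * (grid s k.+1 <= t i)%R%:R.

Let ss : sorted <=%R s. Proof. exact: (sort_sorted (@le_total _ R)). Qed.
Let s0 : all (fun t => 0 <= t) s.
Proof.
by rewrite all_sort; apply/allP => x /mapP[i _ ->].
Qed.
Let ts i : t i \in s.
Proof. by rewrite mem_sort; apply: map_f; rewrite mem_enum. Qed.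

(** Summation by parts over the sorted times. *)
Lemma linear_increments (phi : R -> R) : phi 0 = 0 ->
  \sum_i c i * phi (t i) = \sum_k gam k * (phi (grid s k.+1) - phi (grid s k)).
Proof.
move=> phi0; under [RHS]eq_bigr do rewrite mulr_suml.
rewrite exchange_big/=; apply: eq_bigr => i _.
rewrite -[phi (t i)]subr0 -{1}phi0 (grid_telescope ss s0 _ (ts i)) mulr_sumr.
by apply: eq_bigr => k _; rewrite mulrA.
Qed.

(** Indicators of [x <= t i] and [x <= t j] multiply to that of [x <= min]. *)
Lemma minformE : minform t c = \sum_k gam k ^+ 2 * (grid s k.+1 - grid s k).
Proof.
rewrite /minform.
have E i j : Num.min (t i) (t j) = \sum_(k < size s)
    (grid s k.+1 <= t i)%R%:R * (grid s k.+1 <= t j)%R%:R * (grid s k.+1 - grid s k).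
  have mins : Num.min (t i) (t j) \in s by rewrite minEle; case: ifP.
  rewrite -[LHS]subr0 (grid_telescope ss s0 id mins); apply: eq_bigr => k _.
  by rewrite le_min -natrM mulnb.
under eq_bigr do under eq_bigr do rewrite E mulr_sumr.
under eq_bigr do rewrite exchange_big/=.
rewrite exchange_big/=; apply: eq_bigr => k _.
rewrite expr2 /gam !mulr_suml; apply: eq_bigr => i _.
rewrite mulr_sumr mulr_suml; apply: eq_bigr => j _; ring.
Qed.

Lemma minform_ge0 : 0 <= minform t c.
Proof.
rewrite minformE; apply: sumr_ge0 => k _; rewrite mulr_ge0 ?sqr_ge0// subr_ge0.
exact: (grid_nd ss s0).
Qed.

Lemma wiener_charf (W : process R) : standard_wiener W ->
  charf W t c = (expR (- (minform t c / 2)))%:C.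
Proof.
move=> wW; rewrite minformE -(wiener_increments wW gam) ?grid0//; last first.
  exact: (grid_nd ss s0).
have [W0 _ _ _] := wW.
apply: cEx_ae.
- by apply: cmf_cis; exact: measurable_lin.
- apply: cmf_cis; apply: measurable_sum => k; apply: measurable_funM => //.
  exact: measurable_funB.
- move: W0; apply: filterS => w W0w; congr cis.
  exact: (@linear_increments (W ^~ w)).
Qed.

End times.

Lemma charf_scale (k : R) (X : process R) m (t c : 'I_m -> R) :
  charf (scale_process k X) t c = charf X t (fun i => k * c i).
Proof.
apply: eq_cEx => w; congr cis; apply: eq_bigr => i _ /=.
ring.
Qed.

Lemma minformZ k m (t c : 'I_m -> R) : minform t (fun i => k * c i) = k ^+ 2 * minform t c.
Proof.
rewrite /minform mulr_sumr; apply: eq_bigr => i _; rewrite mulr_sumr.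
apply: eq_bigr => j _; ring.
Qed.

End wiener_fdd.


(** * Poisson generating functions *)
Section bounded_complex.
Context d (T : measurableType d) (R : realType) (P : probability T R).
Local Notation C := R[i].
Implicit Types F G : T -> C.

Definition cbd F := cmf F /\ exists M, forall w, normc (F w) <= M.

Lemma eq_cbd F G : F =1 G -> cbd F -> cbd G.
Proof. by move=> /funext ->. Qed.

Lemma cbd_citg F : cbd F -> citg P F.
Proof. by move=> [mF [M FM]]; exact: citg_bounded FM. Qed.

Lemma cbd_cst c : cbd (cst c).
Proof. by split; [exact: cmf_cst|exists (normc c)]. Qed.

Lemma cbdM F G : cbd F -> cbd G -> cbd (fun w => F w * G w).
Proof.
move=> [mF [M FM]] [mG [N GN]]; split; first exact: cmfM.
by exists (M * N) => w; rewrite normcM ler_pM// normc_ge0.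
Qed.

Lemma cbdD F G : cbd F -> cbd G -> cbd (fun w => F w + G w).
Proof.
move=> [mF [M FM]] [mG [N GN]]; split; first exact: cmfD.
by exists (M + N) => w; rewrite (le_trans (le_normcD _ _))// lerD.
Qed.

Lemma cbd_sum I (s : seq I) (F : I -> T -> C) : (forall i, cbd (F i)) ->
  cbd (fun w => \sum_(i <- s) F i w).
Proof.
move=> mF; elim: s => [|i s IH].
  by apply: eq_cbd (cbd_cst 0) => w; rewrite big_nil.
by apply: eq_cbd (cbdD (mF i) IH) => w; rewrite big_cons.
Qed.

Lemma cbd_prod I (s : seq I) (F : I -> T -> C) : (forall i, cbd (F i)) ->
  cbd (fun w => \prod_(i <- s) F i w).
Proof.
move=> mF; elim: s => [|i s IH].
  by apply: eq_cbd (cbd_cst 1) => w; rewrite big_nil.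
by apply: eq_cbd (cbdM (mF i) IH) => w; rewrite big_cons.
Qed.

Lemma cmf_eqn (Z : T -> nat) v : measurable_fun [set: T] Z ->
  cmf (fun w => (Z w == v)%:R : C).
Proof.
move=> mZ; apply: (@cmf_natP _ _ _ Z (fun k _ => (k == v)%:R)) => // k.
Qed.

Lemma normc_bool (b : bool) : normc (b%:R : C) <= 1.
Proof. by case: b; rewrite ?normc1 ?normc0. Qed.

Lemma cbd_eqn (Z : T -> nat) v : measurable_fun [set: T] Z ->
  cbd (fun w => (Z w == v)%:R : C).
Proof. by move=> mZ; split; [exact: cmf_eqn|exists 1 => w; exact: normc_bool]. Qed.

Lemma normc_limit_unique (u : nat -> C) a b :
  normc (u n - a) @[n --> \oo] --> 0 -> normc (u n - b) @[n --> \oo] --> 0 -> a = b.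
Proof.
move=> ua ub; apply/eqP; rewrite -subr_eq0; apply/eqP/eq0_normc.
apply/eqP; rewrite eq_le normc_ge0 andbT.
have uab : normc (u n - a) + normc (u n - b) @[n --> \oo] --> (0 : R).
  by rewrite -[X in _ --> X]addr0; exact: cvgD.
apply: (cvgr_to_ge uab); apply: nearW => n.
rewrite (_ : a - b = (u n - b) - (u n - a)); last by ring.
by rewrite (le_trans (le_normcD _ _))// normcN addrC.
Qed.

(** Expectations of bounded functions are determined on the level sets of a
discrete variable. *)
Lemma cEx_partition (Z : T -> nat) F G : measurable_fun [set: T] Z -> cbd F -> cbd G ->
  (forall x, cEx P (fun w => F w * (Z w == x)%:R) = cEx P (fun w => G w * (Z w == x)%:R)) ->
  cEx P F = cEx P G.
Proof.
move=> mZ bF bG FG.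
have lim H : cbd H ->
    normc (\sum_(x < n) cEx P (fun w => H w * (Z w == x)%:R) - cEx P H) @[n --> \oo] --> 0.
  move=> bH.
  have bHx (x : nat) : cbd (fun w => H w * (Z w == x)%:R) by apply: cbdM => //; exact: cbd_eqn.
  have E n : \sum_(x < n) cEx P (fun w => H w * (Z w == x)%:R) =
      cEx P (fun w => \sum_(x < n) H w * (Z w == x)%:R).
    by rewrite cEx_sum// => x; exact: cbd_citg.
  under eq_fun do rewrite E.
  have SE n w : \sum_(x < n) H w * (Z w == x)%:R = H w * (Z w < n)%N%:R.
    rewrite -mulr_sumr; congr (_ * _).
    case: (ltnP (Z w) n) => Zn.
      rewrite (bigD1 (Ordinal Zn))//= eqxx big1 ?addr0// => j jn.
      by case: eqP => // E'; case/eqP: jn; apply: val_inj.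
    by rewrite big1// => j _; case: eqP => // E'; move: Zn; rewrite E' leqNgt ltn_ord.
  have [mH [M HM]] := bH.
  apply: (@cEx_dct _ _ _ _ _ _ (cst M)).
  - by move=> n; have [] := cbd_sum (index_enum 'I_n) (fun x : 'I_n => bHx x).
  - by [].
  - exact: itg_cst.
  - move=> n w; rewrite SE normcM (le_trans _ (HM w))//.
    by rewrite ler_piMr ?normc_ge0// normc_bool.
  - move=> w; apply: cvg_near_cst; near=> n; rewrite SE.
    rewrite (_ : (Z w < n)%N = true) ?mulr1 ?subrr ?normc0//.
    by near: n; exact: nbhs_infty_gt.
apply: normc_limit_unique (lim _ bG).
under eq_fun do under eq_bigr do rewrite -FG.
exact: lim.
Unshelve. all: by end_near.
Qed.

End bounded_complex.

Section exponential_sums.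

Section cauchy_product.
Context {F : numFieldType}.

(** Partial sums of the exponential series, over real and complex numbers alike. *)
Definition expsum (n : nat) (z : F) : F := \sum_(k < n) z ^+ k / k`!%:R.

Lemma sum_triangle (f : nat -> nat -> F) n :
  \sum_(k < n) \sum_(i < k.+1) f (k - i)%N i =
  \sum_(i < n) \sum_(j < n) (i + j < n)%N%:R * f j i.
Proof.
elim: n => [|n IH]; first by rewrite !big_ord0.
rewrite big_ord_recr/= IH.
have -> : \sum_(i < n.+1) \sum_(j < n.+1) (i + j < n.+1)%N%:R * f j i =
    \sum_(i < n.+1) \sum_(j < n.+1) (i + j < n)%N%:R * f j i +
    \sum_(i < n.+1) \sum_(j < n.+1) (i + j == n)%N%:R * f j i.
  rewrite -big_split/=; apply: eq_bigr => i _.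
  rewrite -big_split/=; apply: eq_bigr => j _.
  rewrite -mulrDl -natrD ltnS.
  by case: (ltngtP (i + j)%N n).
congr (_ + _).
  rewrite [RHS]big_ord_recr/= [X in _ + X]big1 ?addr0; last first.
    by move=> j _; rewrite ltnNge leq_addr mul0r.
  apply: eq_bigr => i _; rewrite [RHS]big_ord_recr/=.
  by rewrite (ltnNge (i + n)) leq_addl mul0r addr0.
apply: eq_bigr => i _.
have ni : (n - i < n.+1)%N by rewrite ltnS leq_subr.
have iln : (i <= n)%N by rewrite -ltnS.
rewrite (bigD1 (Ordinal ni))//= subnKC// eqxx mul1r big1 ?addr0// => j jn.
case: eqP => [E|]; last by rewrite mul0r.
by case/eqP: jn; apply: val_inj => /=; apply/eqP; rewrite -(eqn_add2l i) E subnKC.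
Qed.

Lemma expsumD n (a b : F) : expsum n a * expsum n b - expsum n (a + b) =
  \sum_(i < n) \sum_(j < n) (n <= i + j)%N%:R * ((a ^+ j / j`!%:R) * (b ^+ i / i`!%:R)).
Proof.
have -> : expsum n (a + b) = \sum_(i < n) \sum_(j < n)
    (i + j < n)%N%:R * ((a ^+ j / j`!%:R) * (b ^+ i / i`!%:R)).
  rewrite -(sum_triangle (fun j i => (a ^+ j / j`!%:R) * (b ^+ i / i`!%:R))).
  apply: eq_bigr => k _; rewrite exprDn mulr_suml; apply: eq_bigr => i _.
  have ik : (i <= k)%N by rewrite -ltnS.
  have fk (l : nat) : l`!%:R != 0 :> F by rewrite pnatr_eq0 -lt0n fact_gt0.
  rewrite -mulr_natr; have -> : k`!%:R = 'C(k, i)%:R * (i`!%:R * (k - i)`!%:R) :> F.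
    by rewrite -!natrM bin_fact.
  have bk : 'C(k, i)%:R != 0 :> F by rewrite pnatr_eq0 -lt0n bin_gt0.
  by field; rewrite bk !fk.
rewrite /expsum mulr_suml.
under eq_bigr do rewrite mulr_sumr.
rewrite exchange_big/= -sumrB; apply: eq_bigr => i _.
rewrite -sumrB; apply: eq_bigr => j _.
by rewrite ltnNge; case: leqP => _; rewrite ?mul0r ?mul1r ?subr0 ?subrr.
Qed.

End cauchy_product.

Context {R : realType}.
Local Notation C := R[i].

Lemma cvg_expsum (x : R) : expsum n x @[n --> \oo] --> expR x.
Proof.
have -> : (fun n => expsum n x) = series (exp_coeff x).
  by apply/funext => n; rewrite /series/= big_mkord.
exact: is_cvg_series_exp_coeff.
Qed.

Lemma expsum_real n (x : R) : expsum n (x%:C : C) = (expsum n x)%:C.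
Proof.
rewrite /expsum rmorph_sum; apply: eq_bigr => k _.
by rewrite rmorphM rmorphXn fmorphV rmorph_nat.
Qed.

Lemma im_power (y : R) k : (0 +i* y : C) ^+ k =
  ((~~ odd k)%:R * (-1) ^+ k./2 * y ^+ k) +i* ((odd k)%:R * (-1) ^+ k.-1./2 * y ^+ k).
Proof.
have sq : (0 +i* y : C) ^+ 2 = (- y ^+ 2)%:C.
  by rewrite expr2; apply: complex_eqP; rewrite /= ?ReM ?ImM/=; ring.
have ev l : (0 +i* y : C) ^+ l.*2 = ((-1) ^+ l * y ^+ l.*2)%:C.
  rewrite -mul2n exprM sq -rmorphXn/=; congr (_%:C).
  by rewrite -[in LHS]mulN1r exprMn exprM.
have [ok|ek] := boolP (odd k); last first.
  rewrite -{1}(even_halfK ek) ev (even_halfK ek)/=.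
  by apply: complex_eqP; rewrite /= ?mul1r ?mul0r.
have kE : k = (k./2).*2.+1 by rewrite -[LHS]odd_double_half ok.
have -> : k.-1./2 = k./2 by rewrite [in LHS]kE /= doubleK.
rewrite {1 5}kE !exprS ev /=.
by apply: complex_eqP; rewrite ?ReM ?ImM/=; ring.
Qed.

Lemma expsum_im (y : R) :
  normc (expsum n (0 +i* y : C) - cis y) @[n --> \oo] --> 0.
Proof.
have E n : expsum n (0 +i* y : C) = series (cos_coeff y) n +i* series (sin_coeff y) n.
  rewrite /series/= /expsum.
  elim: n => [|n IH]; first by rewrite big_ord0 !big_geq.
  rewrite big_ord_recr/= IH !big_nat_recr//= im_power.
  have -> : (n`!%:R : C)^-1 = (n`!%:R^-1)%:C by rewrite fmorphV rmorph_nat.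
  apply: complex_eqP; rewrite ?ReD ?ImD ?ReM ?ImM/= mulr0 ?subr0 ?add0r -?exprnP /cos_coeff /sin_coeff/=.
    by rewrite -exprnP.
  by [].
have cc : series (cos_coeff y) n @[n --> \oo] --> cos y.
  by rewrite unlock; exact: is_cvg_series_cos_coeff.
have cs : series (sin_coeff y) n @[n --> \oo] --> sin y.
  by rewrite unlock; exact: is_cvg_series_sin_coeff.
have c0 : `|series (cos_coeff y) n - cos y| + `|series (sin_coeff y) n - sin y| @[n --> \oo] --> 0.
  by rewrite -[X in _ --> X]addr0; apply: cvgD; exact: dist0_cvg.
apply: (cvg0_squeeze _ c0); apply: nearW => n.
by rewrite normc_ge0 andTb (le_trans (normc_le_ReIm _))// E.
Qed.

(** The defect of additivity of the partial sums has nonnegative coefficients, so it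
is largest at the moduli, where it vanishes in the limit by the real case. *)
Lemma normc_expsumD n (a b : C) :
  normc (expsum n a * expsum n b - expsum n (a + b)) <=
  expsum n (normc a) * expsum n (normc b) - expsum n (normc a + normc b).
Proof.
rewrite !expsumD (le_trans (normc_sum _ _ _))//; apply: ler_sum => i _.
rewrite (le_trans (normc_sum _ _ _))//; apply: ler_sum => j _.
have nf (l : nat) : normc (l`!%:R^-1 : C) = l`!%:R^-1.
  rewrite -(rmorph_nat (real_complex R)) -fmorphV normc_real ger0_norm// invr_ge0//.
rewrite !normcM !normcX !nf; case: (n <= _)%N.
  by rewrite normc1.
by rewrite normc0 !mul0r.
Qed.

Lemma cvgMc (u v : nat -> C) a b :
  normc (u n - a) @[n --> \oo] --> 0 -> normc (v n - b) @[n --> \oo] --> 0 ->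
  normc (u n * v n - a * b) @[n --> \oo] --> 0.
Proof.
move=> ua vb.
have c0 : normc (u n - a) * normc (v n - b) + normc (u n - a) * normc b +
    normc a * normc (v n - b) @[n --> \oo] --> (0 : R).
  rewrite -[X in _ --> X](_ : 0 * 0 + 0 * normc b + normc a * 0 = 0); last by ring.
  by apply: cvgD; [apply: cvgD|]; apply: cvgM => //; exact: cvg_cst.
apply: (cvg0_squeeze _ c0); apply: nearW => n; rewrite normc_ge0 andTb.
rewrite (_ : u n * v n - a * b = (u n - a) * (v n - b) + (u n - a) * b + a * (v n - b)); last by ring.
rewrite (le_trans (le_normcD _ _))// -!normcM lerD2r.
exact: le_normcD.
Qed.

(** Real and imaginary parts are treated by the real series, and their product by
the vanishing defect of additivity. *)
Lemma cvg_expsum_cexp (z : C) : normc (expsum n z - cexp z) @[n --> \oo] --> 0.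
Proof.
have tri (p q r : C) : p - q = - (r - p) + (r - q) by ring.
case: z => x y; set a : C := x%:C; set b : C := 0 +i* y.
have -> : x +i* y = a + b by apply: complex_eqP; rewrite /= ?addr0 ?add0r.
have ca : normc (expsum n a - (expR x)%:C) @[n --> \oo] --> 0.
  have c0 := dist0_cvg (@cvg_expsum x).
  apply: (cvg0_squeeze _ c0); apply: nearW => n; rewrite normc_ge0 andTb.
  by rewrite expsum_real -rmorphB normc_real.
have cab := cvgMc ca (@expsum_im y).
have -> : cexp (a + b) = (expR x)%:C * cis y by rewrite /cexp/= addr0 add0r.
have c1 : expsum n (normc a) * expsum n (normc b) - expsum n (normc a + normc b)
    @[n --> \oo] --> (0 : R).
  rewrite -[X in _ --> X](subrr (expR (normc a + normc b))) {1}expRD.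
  by apply: cvgB; [apply: cvgM|]; exact: cvg_expsum.
have c2 : (expsum n (normc a) * expsum n (normc b) - expsum n (normc a + normc b)) +
   normc (expsum n a * expsum n b - (expR x)%:C * cis y) @[n --> \oo] --> (0 : R).
  by rewrite -[X in _ --> X]addr0; exact: cvgD.
apply: (cvg0_squeeze _ c2); apply: nearW => n; rewrite normc_ge0 andTb.
rewrite (tri _ _ (expsum n a * expsum n b)).
by rewrite (le_trans (le_normcD _ _))// normcN lerD2r normc_expsumD.
Qed.

Lemma poisson_pmfE (mu : R) k : 0 < mu ->
  poisson_pmf mu k = expR (- mu) * (mu ^+ k / k`!%:R).
Proof. by move=> mu0; rewrite /poisson_pmf mu0 mulrC. Qed.

Lemma expsum_le_expR (mu : R) n : 0 <= mu -> expsum n mu <= expR mu.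
Proof.
move=> mu0; apply: (cvgr_to_ge (@cvg_expsum mu)); near=> k.
have nk : (n <= k)%N by near: k; exact: nbhs_infty_ge.
rewrite /expsum (big_ord_widen _ (fun i => mu ^+ i / i`!%:R) nk) big_mkcond.
apply: ler_sum => i _; case: ifP => // _.
by rewrite divr_ge0 ?exprn_ge0.
Unshelve. all: by end_near.
Qed.

Lemma sum_poisson_le1 (mu : R) n : 0 < mu -> \sum_(k < n) poisson_pmf mu k <= 1.
Proof.
move=> mu0; under eq_bigr do rewrite poisson_pmfE//.
rewrite -mulr_sumr expRN ler_pdivrMl ?expR_gt0// mulr1.
exact: expsum_le_expR (ltW mu0).
Qed.

Lemma poisson_gf (mu : R) (u : C) : 0 < mu ->
  normc (\sum_(k < n) u ^+ k * (poisson_pmf mu k)%:C - cexp (mu%:C * (u - 1)))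
    @[n --> \oo] --> 0.
Proof.
move=> mu0.
have c := cvg_expsum_cexp (mu%:C * u).
have E n : \sum_(k < n) u ^+ k * (poisson_pmf mu k)%:C =
    (expR (- mu))%:C * expsum n (mu%:C * u).
  rewrite /expsum mulr_sumr; apply: eq_bigr => k _.
  rewrite poisson_pmfE// 2!rmorphM/= rmorphXn fmorphV rmorph_nat exprMn; ring.
have -> : cexp (mu%:C * (u - 1)) = (expR (- mu))%:C * cexp (mu%:C * u).
  by rewrite -cexp_real -cexpD; congr cexp; rewrite rmorphN; ring.
have c0 : `|expR (- mu)| * normc (expsum n (mu%:C * u) - cexp (mu%:C * u)) @[n --> \oo] --> 0.
  rewrite -[X in _ --> X](mulr0 `|expR (- mu)|).
  by apply: cvgM => //; exact: cvg_cst.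
apply: (cvg0_squeeze _ c0); apply: nearW => n; rewrite normc_ge0 andTb.
by rewrite E -mulrBr normcM normc_real.
Qed.

End exponential_sums.


(** * Conditional generating functions of the chain *)
Lemma measurable_invr (R : realType) : measurable_fun [set: R] (@GRing.inv R).
Proof.
have -> : @GRing.inv R = fun x => if 0 <= x then x `^ (-1) else - ((- x) `^ (-1)).
  apply/funext => x; case: leP => x0; first by rewrite powR_inv1.
  by rewrite powR_inv1 ?oppr_ge0 ?(ltW x0)// invrN opprK.
apply: measurable_fun_ifT; first exact: measurable_fun_ler.
  exact: measurable_powR.
apply: measurable_funN; apply: (measurableT_comp (measurable_powR (-1))).
exact: oppr_measurable.
Qed.

Section backward_recursion.
Context {R : realType} (th : nat -> R).
Local Notation C := R[i].

(** With [v = u - 1], integrating out the last value of the chain turns a factor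
[u ^+ X_(k+1)] into [(u') ^+ X_k], [u' - 1 = vstep a (th k) v], and [psi]
collects the exponents that are left behind. *)
Definition vstep (a t : R) (v : C) : C := (cis t - 1) * (1 + a%:C * v) + a%:C * v.

Fixpoint psi (K : nat) (a : R) (v : C) : C :=
  if K is K'.+1 then (cis (th K') - 1) * (1 + a%:C * v) + psi K' a (vstep a (th K') v)
  else 0.

Lemma vstepE a t v : 1 + vstep a t v = cis t * (1 + a%:C * v).
Proof. rewrite /vstep; ring. Qed.

Lemma normc_conv (a : R) (u : C) : 0 < a < 1 -> normc u <= 1 ->
  normc (1 + a%:C * (u - 1)) <= 1.
Proof.
move=> /andP[a0 a1] u1.
have -> : 1 + a%:C * (u - 1) = (1 - a)%:C + a%:C * u by rewrite rmorphB rmorph1; ring.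
rewrite (le_trans (le_normcD _ _))// normcM !normc_real ger0_norm ?subr_ge0 ?(ltW a1)//.
rewrite ger0_norm ?(ltW a0)//.
have : a * normc u <= a by rewrite ler_piMr// ltW.
lra.
Qed.

Lemma normc_vstep (a t : R) (v : C) : 0 < a < 1 -> normc (1 + v) <= 1 ->
  normc (1 + vstep a t v) <= 1.
Proof.
move=> a01 v1; rewrite vstepE normcM normc_cis mul1r.
by have := normc_conv a01 v1; rewrite (_ : 1 + v - 1 = v); last ring.
Qed.

Lemma Re_sub1_le0 (u : C) : normc u <= 1 -> Re (u - 1) <= 0.
Proof.
move=> u1; rewrite ReD ReN/= subr_le0 (le_trans _ u1)//.
exact: le_trans (ler_norm _) (Re_le_normc _).
Qed.

Lemma psi_measurable K (v : R -> C) : cmf v -> cmf (fun a => psi K a (v a)).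
Proof.
elim: K v => [|K IH] v mv /=; first exact: cmf_cst.
have mav : cmf (fun a : R => a%:C * v a).
  by apply: cmfM => //; apply: cmf_real; exact: measurable_id.
have m1 : cmf (fun a : R => (cis (th K) - 1) * (1 + a%:C * v a)).
  by apply: cmfM; [exact: cmf_cst|apply: cmfD => //; exact: cmf_cst].
by apply: cmfD => //; apply: IH; exact: cmfD.
Qed.

End backward_recursion.

Section conditional_structure.
Context d (T : measurableType d) (R : realType) (P : probability T R).
Context (lambda : R) (alpha : {RV P >-> R}).
Context (xi : nat -> nat -> {RV P >-> nat}) (eps : nat -> {RV P >-> nat}).
Context (X : nat -> {RV P >-> nat}).
Hypothesis lambda0 : 0 < lambda.
Hypothesis HX : randomized_INAR1 lambda alpha xi eps X.
Local Notation C := R[i].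
Local Notation index := (unit + (nat * nat) + nat)%type.

Let al01 w : 0 < alpha w < 1. Proof. exact: (inar_alpha HX). Qed.

Definition input (i : index) : T -> nat := inar_inputs (X 0) (fun k j => xi k j) eps i.

Definition inpmf (i : index) (a : R) (v : nat) : R :=
  match i with
  | inl (inl tt) => poisson_pmf (lambda / (1 - a)) v
  | inl (inr _) => if v == 0%N then 1 - a else if v == 1%N then a else 0
  | inr _ => poisson_pmf lambda v
  end.

Lemma input_measurable i : measurable_fun [set: T] (input i).
Proof. by case: i => [[[]|[k j]]|k] /=. Qed.

Lemma measurable_1B : measurable_fun [set: R] (fun a : R => (1 - a)^-1).
Proof. by apply: (measurableT_comp (@measurable_invr R)); exact: measurable_funB. Qed.

Lemma inpmf_measurable i v : measurable_fun [set: R] (inpmf i ^~ v).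
Proof.
case: i => [[[]|[k j]]|k] /=.
- apply: (measurableT_comp (f := @poisson_pmf R ^~ v)).
    exact: measurable_poisson_pmf.
  by apply: measurable_funM => //; exact: measurable_1B.
- by case: (v == 0%N); [exact: measurable_funB|case: (v == 1%N)].
- exact: measurable_cst.
Qed.

Lemma rate_gt0 (a : R) : 0 < a < 1 -> 0 < lambda / (1 - a).
Proof. by move=> /andP[_ a1]; rewrite divr_gt0// subr_gt0. Qed.

Lemma inpmf_ge0 i a v : 0 < a < 1 -> 0 <= inpmf i a v.
Proof.
move=> /andP[a0 a1]; case: i => [[[]|[k j]]|k] /=; rewrite ?poisson_pmf_ge0//.
by case: ifP => _; [lra|case: ifP => _; lra].
Qed.

Lemma sum_inpmf_le1 i a n : 0 < a < 1 -> \sum_(v < n) inpmf i a v <= 1.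
Proof.
move=> a01; case: i => [[[]|[k j]]|k] /=.
- by apply: sum_poisson_le1; exact: rate_gt0.
- move: a01 => /andP[a0 a1]; case: n => [|[|n]]; rewrite ?big_ord0 ?big_ord1/= ?ler01//; first lra.
  rewrite 2!big_ord_recl/= big1 ?addr0//; lra.
- exact: sum_poisson_le1.
Qed.

Lemma inpmf_le1 i a v : 0 < a < 1 -> inpmf i a v <= 1.
Proof.
move=> a01; rewrite (le_trans _ (sum_inpmf_le1 i v.+1 a01))//.
by rewrite big_ord_recr/= lerDr; apply: sumr_ge0 => k _; exact: inpmf_ge0.
Qed.

Lemma cond_expE (Y f : T -> R) : cond_exp P alpha Y f -> forall B, measurable B ->
  Ex P (fun w => \1_B (alpha w) * Y w) = Ex P (fun w => \1_B (alpha w) * f w).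
Proof.
move=> [_ H] B mB; have := H B mB.
have E (g : T -> R) : (\int[P]_(w in alpha @^-1` B) (g w)%:E =
    \int[P]_w (\1_B (alpha w) * g w)%:E)%E.
  rewrite integral_mkcond/=; apply: eq_integral => w _.
  rewrite patchE indicE.
  rewrite (_ : (w \in alpha @^-1` B) = (alpha w \in B)); last by apply/idP/idP; rewrite !inE.
  by case: ifPn => _; rewrite ?mul1r ?mul0r.
by rewrite !E /Ex => ->.
Qed.

Lemma measurable_alpha_pre (f : R -> R) : measurable_fun [set: R] f ->
  forall U : set R, measurable U -> g_sigma_algebra_preimage alpha ((f \o alpha) @^-1` U).
Proof.
move=> mf U mU; exists (f @^-1` U); last by rewrite setTI.
by rewrite -[X in measurable X]setTI; exact: mf.
Qed.

Lemma cond_prob_input i v :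
  cond_prob P alpha (input i @^-1` [set v]) (fun w => inpmf i (alpha w) v).
Proof.
case: i => [[[]|[k j]]|k] /=.
- exact: (inar_init HX).
- case: v => [|[|v]] /=.
  + exact: (inar_xi0 HX).
  + exact: (inar_xi1 HX).
  (* The values 0 and 1 of a Bernoulli input exhaust the probability. *)
  split; first by apply: (@measurable_alpha_pre (cst 0)).
  move=> B mB; rewrite [RHS]integral0_eq//.
  have mV u : measurable (xi k j @^-1` [set u]).
    by rewrite -[X in measurable X]setTI; exact: measurable_funPT.
  have mal : measurable (alpha @^-1` B).
    by rewrite -[X in measurable X]setTI; exact: measurable_funPT.
  rewrite integral_indic//.
  have Pu u : P (xi k j @^-1` [set u]) = (\int[P]_w (\1_(xi k j @^-1` [set u]) w)%:E)%E.
    by rewrite integral_indic// setIT.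
  have H1 := (inar_xi1 HX k j).2 setT measurableT.
  have H0 := (inar_xi0 HX k j).2 setT measurableT.
  rewrite preimage_setT in H1 H0.
  have ia : itg P alpha.
    apply: (@itg_bounded _ _ _ _ _ 1) => // w.
    by have /andP[a0 a1] := al01 w; rewrite ger0_norm ltW.
  have S : (P (xi k j @^-1` [set 0%N]) + P (xi k j @^-1` [set 1%N]) = 1)%E.
    rewrite !Pu H0 H1 -integralD//.
    - rewrite (eq_integral (cst 1%E)); last by move=> w _; rewrite /cst -EFinD subrK.
      by rewrite integral_cst// mul1e; exact: probability_setT.
    - exact: (itgB (itg_cst P 1) ia).
  apply/eqP; rewrite eq_le measure_ge0 andbT.
  have : (P (xi k j @^-1` [set v.+2]) + (P (xi k j @^-1` [set 0%N]) + P (xi k j @^-1` [set 1%N])) <= 1)%E.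
    have m01 : measurable (xi k j @^-1` [set 0%N] `|` xi k j @^-1` [set 1%N]).
      by apply: measurableU; exact: mV.
    rewrite -(measureU _ (mV 0%N) (mV 1%N)); last first.
      by apply/seteqP; split => w //= [-> ].
    rewrite -(measureU _ (mV v.+2) m01); last first.
      by apply/seteqP; split => w //= [-> []].
    exact: (probability_le1 P (measurableU _ _ (mV v.+2) m01)).
  rewrite S -leeBrDr// subee// => h.
  have mAB := measurableI _ _ (mV v.+2) mal.
  exact: (le_trans (le_measure P (mem_set mAB) (mem_set (mV v.+2)) (@subIsetl _ _ _)) h).
- exact: (inar_eps HX).
Qed.

(** [ok g]: coefficients depending on [alpha] only; as [alpha] takes its values in
[(0, 1)], boundedness matters there only. *)
Definition ok (g : R -> C) := cmf g /\ exists M, forall a, 0 < a < 1 -> normc (g a) <= M.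

Lemma ok_cst c : ok (cst c).
Proof. by split; [exact: cmf_cst|exists (normc c)]. Qed.

Lemma okM g h : ok g -> ok h -> ok (fun a => g a * h a).
Proof.
move=> [mg [M gM]] [mh [N hN]]; split; first exact: cmfM.
exists (M * N) => a a01; rewrite normcM ler_pM ?normc_ge0//; [exact: gM|exact: hN].
Qed.

Lemma ok_prod I (s : seq I) (g : I -> R -> C) : (forall i, ok (g i)) ->
  ok (fun a => \prod_(i <- s) g i a).
Proof.
move=> okg; elim: s => [|i s IH].
  by under eq_fun do rewrite big_nil; exact: ok_cst.
by under eq_fun do rewrite big_cons; exact: okM.
Qed.

Lemma ok_inpmf i v : ok (fun a => (inpmf i a v)%:C).
Proof.
split; first by apply: cmf_real; exact: inpmf_measurable.
exists 1 => a a01; rewrite normc_real ger0_norm; [exact: inpmf_le1|exact: inpmf_ge0].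
Qed.

Lemma ok_cbd g : ok g -> cbd (fun w => g (alpha w)).
Proof.
move=> [mg [M gM]]; split; first exact: (cmf_comp (measurable_funPT alpha)).
by exists M => w; exact: gM (al01 w).
Qed.

Lemma cbd_input i v : cbd (fun w => (input i w == v)%:R : C).
Proof. by apply: cbd_eqn; exact: input_measurable. Qed.

(** The bounded random variables [Y] that are conditionally independent, given
[alpha], of the inputs with indices in [S]. *)
Definition condind (Y : T -> C) (S : pred index) :=
  forall (s : seq index) (v : index -> nat) (g : R -> C), uniq s -> all S s -> ok g ->
  cEx P (fun w => g (alpha w) * Y w * \prod_(i <- s) (input i w == v i)%:R) =
  cEx P (fun w => g (alpha w) * Y w * \prod_(i <- s) (inpmf i (alpha w) (v i))%:C).

Lemma condind_sub Y (S S' : pred index) : {subset S' <= S} -> condind Y S -> condind Y S'.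
Proof.
move=> SS H s v g us Ss; apply: H => //.
by apply/allP => i /(allP Ss); exact: SS.
Qed.

(** The conditional independence of the inputs, as an identity of expectations. *)
Lemma condind1 : condind (cst 1) predT.
Proof.
move=> s v g us _ okg.
set F1 := fun w => \prod_(i <- s) (input i w == v i)%:R : C.
set F2 := fun w => \prod_(i <- s) (inpmf i (alpha w) (v i))%:C.
have b1 : cbd F1 by apply: cbd_prod => i; exact: cbd_input.
have b2 : cbd F2 by apply: cbd_prod => i; apply: (ok_cbd (ok_inpmf i (v i))).
have mset (i : index) : measurable [set v i] by [].
have CI := inar_cond_independent HX us mset
  (fun i _ => cond_prob_input i (v i)).
have [mg [M gM]] := okg.
pose g' (a : R) : C := if (0 < a) && (a < 1) then g a else 0.
have g'E w : g' (alpha w) = g (alpha w) by rewrite /g' al01.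
have mg' : cmf g'.
  have m01 : measurable_fun [set: R] (fun a : R => (0 < a) && (a < 1)).
    by apply: measurable_and; exact: measurable_fun_ltr.
  have [m1 m2] := mg; split.
    have -> : (fun a => Re (g' a)) = (fun a => if (0 < a) && (a < 1) then Re (g a) else 0).
      by apply/funext => a; rewrite /g'; case: ifP.
    exact: measurable_fun_ifT.
  have -> : (fun a => Im (g' a)) = (fun a => if (0 < a) && (a < 1) then Im (g a) else 0).
    by apply/funext => a; rewrite /g'; case: ifP.
  exact: measurable_fun_ifT.
have g'M a : normc (g' a) <= `|M|.
  rewrite /g'; case: ifP => [a01|_]; last by rewrite normc0.
  by rewrite (le_trans (gM a a01))// ler_norm.
have := complex_law_transfer (measurable_funPT alpha) (measurable_funPT alpha)
  (cbd_citg P b1) (cbd_citg P b2) _ mg' g'M.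
move=> tr.
transitivity (cEx P (fun w => g' (alpha w) * F1 w)).
  by apply: eq_cEx => w; rewrite g'E /cst mulr1.
transitivity (cEx P (fun w => g' (alpha w) * F2 w)); last first.
  by apply: eq_cEx => w; rewrite g'E /cst mulr1.
apply: tr => B mB.
have E := cond_expE CI mB.
transitivity (cEx P (fun w => (\1_B (alpha w) * \1_(\bigcap_(i in [set` s]) (input i @^-1` [set v i])) w)%:C)).
  apply: eq_cEx => w; rewrite indic_bigcap rmorphM/= rmorph_prod; congr (_ * _).
  apply: eq_bigr => i _; rewrite indicE rmorph_nat; congr (nat_of_bool _)%:R.
  by apply/eqP/idP; rewrite inE.
rewrite cEx_real E -cEx_real; apply: eq_cEx => w.
by rewrite rmorphM/= rmorph_prod.
Qed.

Lemma condind_mul_alpha Y S h : condind Y S -> ok h -> condind (fun w => h (alpha w) * Y w) S.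
Proof.
move=> H okh s v g us Ss okg.
transitivity (cEx P (fun w => (g (alpha w) * h (alpha w)) * Y w * \prod_(i <- s) (input i w == v i)%:R)).
  by apply: eq_cEx => w; rewrite mulrA.
rewrite (H s v _ us Ss (okM okg okh)); apply: eq_cEx => w; by rewrite !mulrA.
Qed.

Lemma eq_condind Y Y' S : Y =1 Y' -> condind Y S -> condind Y' S.
Proof. by move=> /funext ->. Qed.

(** Fixing the value of one input is a factor of the same kind as those in the
conclusion, so the hypothesis is used with and without it. *)
Lemma condind_point Y (S : pred index) i b : condind Y S -> S i ->
  condind (fun w => Y w * (input i w == b)%:R) (fun j => S j && (j != i)).
Proof.
move=> H Si s v g us Ss okg.
(* [v'] prescribes the value [b] at [i] and agrees with [v] elsewhere. *)
pose v' j := if j == i then b else v j.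
have v'i : v' i = b by rewrite /v' eqxx.
have is_ : i \notin s.
  by apply/negP => /(allP Ss); rewrite eqxx andbF.
have v's j : j \in s -> v' j = v j.
  by move=> js; rewrite /v' ifN//; apply: contraNneq is_ => <-.
have Ss' : all S (i :: s).
  by rewrite /= Si; apply/allP => j /(allP Ss) /andP[].
have us' : uniq (i :: s) by rewrite /= is_.
have okp : ok (fun a => \prod_(j <- s) (inpmf j a (v j))%:C) by apply: ok_prod => j; exact: ok_inpmf.
have := H (i :: s) v' g us' Ss' okg.
have := H [:: i] v' _ isT (_ : all S [:: i]) (okM okg okp).
rewrite /= Si => /(_ isT) E1 E2.
transitivity (cEx P (fun w => g (alpha w) * Y w * \prod_(j <- i :: s) (input j w == v' j)%:R)).
  apply: eq_cEx => w; rewrite big_cons v'i mulrA mulrA; congr (_ * _).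
  by rewrite !big_seq; apply: eq_bigr => j js; rewrite v's.
rewrite {}E2.
transitivity (cEx P (fun w => g (alpha w) * (\prod_(j <- s) (inpmf j (alpha w) (v j))%:C) * Y w *
         \prod_(i0 <- [:: i]) (inpmf i0 (alpha w) (v' i0))%:C)).
  apply: eq_cEx => w; rewrite big_cons big_seq1.
  rewrite [X in _ * (_ * X)](_ : _ = \prod_(j <- s) (inpmf j (alpha w) (v j))%:C); first by ring.
  by rewrite !big_seq; apply: eq_bigr => j js; rewrite v's.
rewrite -{}E1; apply: eq_cEx => w; rewrite big_seq1 v'i; ring.
Qed.

Lemma condind_partition Y S (Z : T -> nat) : measurable_fun [set: T] Z -> cbd Y ->
  (forall b, condind (fun w => Y w * (Z w == b)%:R) S) -> condind Y S.
Proof.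
move=> mZ bY H s v g us Ss okg.
have bg := ok_cbd okg.
apply: (cEx_partition mZ).
- by apply: cbdM; [exact: cbdM|apply: cbd_prod => i; exact: cbd_input].
- by apply: cbdM; [exact: cbdM|apply: cbd_prod => i; exact: (ok_cbd (ok_inpmf i (v i)))].
move=> b; have := H b s v g us Ss okg => E.
transitivity (cEx P (fun w => g (alpha w) * (Y w * (Z w == b)%:R) * \prod_(i <- s) (input i w == v i)%:R)).
  by apply: eq_cEx => w; ring.
by rewrite E; apply: eq_cEx => w; ring.
Qed.

(** Evaluating one more input inside a bounded function keeps the remaining inputs
independent. *)
Lemma condind_fun Y (S : pred index) i (h : R -> nat -> C) : condind Y S -> S i -> cbd Y ->
  (forall v, ok (h ^~ v)) -> cbd (fun w => h (alpha w) (input i w)) ->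
  condind (fun w => Y w * h (alpha w) (input i w)) (fun j => S j && (j != i)).
Proof.
move=> H Si bY okh bh; apply: (condind_partition (input_measurable i)); first exact: cbdM.
move=> b; have := condind_mul_alpha (condind_point b H Si) (okh b).
apply: eq_condind => w.
by case: eqP => [->|_]; rewrite ?mulr0// !mulr1 mulrC.
Qed.

(** Integrating one input out of a bounded function: [hh] is its conditional mean. *)
Lemma condind_integrate Y (S : pred index) i (h : R -> nat -> C) (hh g : R -> C) :
  condind Y S -> S i -> cbd Y -> ok g -> ok hh ->
  (forall v, ok (h ^~ v)) -> (forall a v, 0 < a < 1 -> normc (h a v) <= 1) ->
  (forall a, 0 < a < 1 ->
    normc (\sum_(v < n) h a v * (inpmf i a v)%:C - hh a) @[n --> \oo] --> 0) ->
  cEx P (fun w => g (alpha w) * Y w * h (alpha w) (input i w)) =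
  cEx P (fun w => g (alpha w) * Y w * hh (alpha w)).
Proof.
move=> H Si bY okg okhh okh h1 cvgh.
have bgY : cbd (fun w => g (alpha w) * Y w) by apply: cbdM => //; exact: ok_cbd.
have [mgY [M gYM]] := bgY.
have M0 : 0 <= M by rewrite (le_trans (normc_ge0 _) (gYM point)).
pose u n := \sum_(v < n) cEx P (fun w => g (alpha w) * Y w * (h (alpha w) v * (input i w == v)%:R)).
have bt1 (v : nat) : cbd (fun w => g (alpha w) * Y w * (h (alpha w) v * (input i w == v)%:R)).
  exact: (cbdM bgY (cbdM (ok_cbd (okh v)) (cbd_input i v))).
have bt2 (v : nat) : cbd (fun w => g (alpha w) * Y w * (h (alpha w) v * (inpmf i (alpha w) v)%:C)).
  exact: (cbdM bgY (cbdM (ok_cbd (okh v)) (ok_cbd (ok_inpmf i v)))).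
have u2 n : u n = \sum_(v < n) cEx P (fun w => g (alpha w) * Y w * (h (alpha w) v * (inpmf i (alpha w) v)%:C)).
  apply: eq_bigr => v _.
  have := H [:: i] (fun=> v : nat) _ isT (_ : all S [:: i]) (okM okg (okh v)).
  rewrite /= Si => /(_ isT) E.
  transitivity (cEx P (fun w => g (alpha w) * h (alpha w) v * Y w * \prod_(j <- [:: i]) (input j w == v)%:R)).
    by apply: eq_cEx => w; rewrite big_seq1; ring.
  by rewrite {}E; apply: eq_cEx => w; rewrite big_seq1; ring.
have u1E n : u n = cEx P (fun w => g (alpha w) * Y w * (\sum_(v < n) h (alpha w) v * (input i w == v)%:R)).
  rewrite /u -cEx_sum; last by move=> v; exact: cbd_citg.
  by apply: eq_cEx => w; rewrite mulr_sumr.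
have u2E n : u n = cEx P (fun w => g (alpha w) * Y w * (\sum_(v < n) h (alpha w) v * (inpmf i (alpha w) v)%:C)).
  rewrite u2 -cEx_sum; last by move=> v; exact: cbd_citg.
  by apply: eq_cEx => w; rewrite mulr_sumr.
have S1 n w : \sum_(v < n) h (alpha w) v * (input i w == v)%:R =
    (input i w < n)%N%:R * h (alpha w) (input i w).
  case: (ltnP (input i w) n) => Zn.
    rewrite (bigD1 (Ordinal Zn))//= eqxx mulr1 mul1r big1 ?addr0// => j jn.
    by case: eqP => [E'|_]; [case/eqP: jn; apply: val_inj|rewrite mulr0].
  rewrite mul0r big1// => j _; case: eqP => [E'|_]; last by rewrite mulr0.
  by move: Zn; rewrite E' leqNgt ltn_ord.
apply: (@normc_limit_unique _ u).
- under eq_fun do rewrite u1E.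
  apply: (@cEx_dct _ _ _ _ _ _ (cst M)).
  + move=> n; apply: cmfM => //; apply: cmf_sum => v; apply: cmfM.
      by have [] := ok_cbd (okh v).
    by have [] := cbd_input i v.
  + apply: cmfM => //; apply: (@cmf_natP _ _ _ (input i) (fun v w => h (alpha w) v)).
      exact: input_measurable.
    by move=> v; have [] := ok_cbd (okh v).
  + exact: itg_cst.
  + move=> n w; rewrite normcM /cst -[leRHS]mulr1 ler_pM ?normc_ge0//.
    by rewrite S1 normcM_le1 ?normc_bool// h1.
  + move=> w; apply: cvg_near_cst; near=> n; rewrite S1.
    rewrite (_ : (input i w < n)%N = true) ?mul1r ?subrr ?normc0//.
    by near: n; exact: nbhs_infty_gt.
- under eq_fun do rewrite u2E.
  apply: (@cEx_dct _ _ _ _ _ _ (cst M)).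
  + move=> n; apply: cmfM => //; apply: cmf_sum => v; apply: cmfM.
      by have [] := ok_cbd (okh v).
    by have [] := ok_cbd (ok_inpmf i v).
  + by apply: cmfM => //; have [] := ok_cbd okhh.
  + exact: itg_cst.
  + move=> n w; rewrite normcM /cst -[leRHS]mulr1 ler_pM ?normc_ge0//.
    rewrite (le_trans (normc_sum _ _ _))// (le_trans _ (sum_inpmf_le1 i n (al01 w)))//.
    apply: ler_sum => v _; rewrite normcM normc_real ger0_norm ?inpmf_ge0//.
    by rewrite ler_piMl ?inpmf_ge0// h1.
  + move=> w; have c := cvgh _ (al01 w).
    have c0 : M * normc (\sum_(v < n) h (alpha w) v * (inpmf i (alpha w) v)%:C - hh (alpha w))
        @[n --> \oo] --> 0.
      by rewrite -[X in _ --> X](mulr0 M); apply: cvgM => //; exact: cvg_cst.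
    apply: (cvg0_squeeze _ c0); apply: nearW => n; rewrite normc_ge0 andTb.
    by rewrite -mulrBr normcM ler_wpM2r ?normc_ge0.
Unshelve. all: by end_near.
Qed.


Let Xi k j : index := inl (inr (k, j)).
Let Ep k : index := inr k.

Let offspring K p w : nat := (\sum_(j < p) xi K j w + eps K w)%N.

Definition later (K : nat) : pred index := fun i =>
  match i with
  | inl (inl _) => false
  | inl (inr (k, _)) => (K <= k)%N
  | inr k => (K <= k)%N
  end.

Lemma offspring_measurable K p : measurable_fun [set: T] (offspring K p).
Proof.
elim: p => [|p IH].
  have -> : offspring K 0 = eps K by apply/funext => w; rewrite /offspring big_ord0.
  by [].
have -> : offspring K p.+1 = (fun w => (xi K p w + offspring K p w)%N).
  by apply/funext => w; rewrite /offspring big_ord_recr/= addnCA addnA.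
exact: measurable_fun_addn.
Qed.

Lemma cbd_comp_nat (Z : T -> nat) (h : R -> nat -> C) M : measurable_fun [set: T] Z ->
  (forall v, ok (h ^~ v)) -> (forall a v, 0 < a < 1 -> normc (h a v) <= M) ->
  cbd (fun w => h (alpha w) (Z w)).
Proof.
move=> mZ okh hM; split.
  apply: (@cmf_natP _ _ _ Z (fun v w => h (alpha w) v)) => // v.
  by have [] := ok_cbd (okh v).
by exists M => w; exact: hM.
Qed.

Lemma condind_offspring K p Y (S S' : pred index) (h : R -> nat -> C) M :
  condind Y S -> cbd Y -> S (Ep K) -> (forall j, (j < p)%N -> S (Xi K j)) ->
  {subset S' <= S} -> ~~ S' (Ep K) -> (forall j, (j < p)%N -> ~~ S' (Xi K j)) ->
  (forall v, ok (h ^~ v)) -> (forall a v, 0 < a < 1 -> normc (h a v) <= M) ->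
  condind (fun w => Y w * h (alpha w) (offspring K p w)) S'.
Proof.
elim: p Y S h => [|p IH] Y S h H bY SE SX S'S S'E S'X okh h1.
  apply: (@condind_sub _ (fun j => S j && (j != Ep K))).
    move=> i Si; rewrite unfold_in; apply/andP; split; first exact: S'S.
    by apply: contraTneq Si => ->.
  have bh : cbd (fun w => h (alpha w) (input (Ep K) w)).
    by apply: (cbd_comp_nat _ okh h1); exact: input_measurable.
  have -> : (fun w => Y w * h (alpha w) (offspring K 0 w)) =
      (fun w => Y w * h (alpha w) (input (Ep K) w)).
    by apply/funext => w; rewrite /offspring big_ord0.
  exact: (condind_fun H SE bY okh bh).
apply: (condind_partition (input_measurable (Xi K p))).
  by apply: cbdM => //; apply: (cbd_comp_nat _ okh h1); exact: offspring_measurable.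
move=> b.
have SXp : S (Xi K p) by exact: SX.
have H' := condind_point b H SXp.
have bY' : cbd (fun w => Y w * (input (Xi K p) w == b)%:R).
  by apply: cbdM => //; exact: cbd_input.
have -> : (fun w => Y w * h (alpha w) (offspring K p.+1 w) * (input (Xi K p) w == b)%:R) =
   (fun w => Y w * (input (Xi K p) w == b)%:R * h (alpha w) (b + offspring K p w)%N).
  apply/funext => w; rewrite /offspring big_ord_recr/=.
  case: eqP => [<-|_]; rewrite ?mulr0 ?mul0r// !mulr1.
  by rewrite addnCA addnA.
apply: (IH _ (fun j => S j && (j != Xi K p)) (fun a v => h a (b + v)%N) H' bY').
- by rewrite SE.
- move=> j jp; rewrite SX ?ltnS ?(ltnW jp)//=.
  by apply/eqP => -[] E; move: jp; rewrite E ltnn.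
- move=> i Si; rewrite unfold_in; apply/andP; split; first exact: S'S.
  by apply: contraTneq Si => ->; exact: S'X.
- by [].
- by move=> j jp; apply: S'X; rewrite ltnS ltnW.
- by move=> v; exact: okh.
- by move=> a v a01; exact: h1.
Qed.

Let conv (a : R) (u : C) : C := 1 + a%:C * (u - 1).

Lemma ok_conv u : ok u -> ok (fun a => conv a (u a)).
Proof.
move=> [mu [M uM]]; split.
  apply: cmfD; first exact: cmf_cst.
  apply: cmfM; first by apply: cmf_real; exact: measurable_id.
  by apply: cmfB => //; exact: cmf_cst.
exists (1 + (M + 1)) => a a01; rewrite (le_trans (le_normcD _ _))// normc1 lerD2l.
have /andP[a0 a1] := a01.
rewrite normcM normc_real (ger0_norm (ltW a0)).
have n1 : normc (u a - 1) <= M + 1.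
  by rewrite (le_trans (le_normcD _ _))// normcN normc1 lerD2r uM.
by rewrite (le_trans _ n1)// ler_piMl ?normc_ge0// ltW.
Qed.

Lemma ok_X u v : ok u -> (forall a, 0 < a < 1 -> normc (u a) <= 1) -> ok (fun a => u a ^+ v).
Proof.
move=> [mu _] u1; split; first exact: cmfX.
by exists 1 => a a01; apply: normcX_le1; exact: u1.
Qed.

Lemma ok_cexp_poisson u : ok u -> (forall a, 0 < a < 1 -> normc (u a) <= 1) ->
  ok (fun a => cexp (lambda%:C * (u a - 1))).
Proof.
move=> [mu _] u1; split.
  apply: cmf_cexp; apply: cmfM; first exact: cmf_cst.
  by apply: cmfB => //; exact: cmf_cst.
exists 1 => a a01; apply: normc_cexp_le1.
have := Re_sub1_le0 (u1 a a01); rewrite ReM/= mul0r subr0.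
by move=> h; rewrite mulr_ge0_le0// ltW.
Qed.

(** From [p] individuals, the generating function of the next value of the chain is
that of a sum of [p] Bernoulli variables and a Poisson variable. *)
Lemma integrate_offspring K p Y (S : pred index) (u g : R -> C) :
  condind Y S -> cbd Y -> S (Ep K) -> (forall j, (j < p)%N -> S (Xi K j)) ->
  ok u -> (forall a, 0 < a < 1 -> normc (u a) <= 1) -> ok g ->
  cEx P (fun w => g (alpha w) * Y w * u (alpha w) ^+ offspring K p w) =
  cEx P (fun w => g (alpha w) * Y w *
    (conv (alpha w) (u (alpha w)) ^+ p * cexp (lambda%:C * (u (alpha w) - 1)))).
Proof.
move=> H bY SE SX oku u1.
elim: p S g H SE SX => [|p IH] S g H SE SX okg.
  have okc := ok_cexp_poisson oku u1.
  transitivity (cEx P (fun w => g (alpha w) * Y w * u (alpha w) ^+ input (Ep K) w)).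
    by apply: eq_cEx => w; rewrite /offspring big_ord0.
  rewrite (@condind_integrate Y S (Ep K) (fun a v => u a ^+ v) (fun a => cexp (lambda%:C * (u a - 1))))//.
  - by apply: eq_cEx => w; rewrite expr0 mul1r.
  - by move=> v; exact: ok_X.
  - by move=> a v a01; apply: normcX_le1; exact: u1.
  - by move=> a a01; exact: poisson_gf.
pose S' : pred index := fun i => i == Xi K p.
have SXp : S (Xi K p) by exact: SX.
have SXj j : (j < p)%N -> S (Xi K j) by move=> jp; apply: SX; rewrite ltnS ltnW.
have H' : condind (fun w => Y w * u (alpha w) ^+ offspring K p w) S'.
  apply: (@condind_offspring K p Y S S' (fun a v => u a ^+ v) 1) => //.
  - by move=> i /eqP ->.
  - move=> j jp; rewrite /S'; apply/eqP => -[E]; by move: jp; rewrite E ltnn.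
  - by move=> v; exact: ok_X.
  - by move=> a v a01; apply: normcX_le1; exact: u1.
have bY' : cbd (fun w => Y w * u (alpha w) ^+ offspring K p w).
  apply: cbdM => //; apply: (@cbd_comp_nat (offspring K p) (fun a v => u a ^+ v) 1).
  - exact: offspring_measurable.
  - by move=> v; exact: ok_X.
  - by move=> a v a01; apply: normcX_le1; exact: u1.
have okc := ok_conv oku.
transitivity (cEx P (fun w => g (alpha w) * (Y w * u (alpha w) ^+ offspring K p w) *
    u (alpha w) ^+ input (Xi K p) w)).
  apply: eq_cEx => w; rewrite /offspring big_ord_recr/= -!mulrA -exprD.
  by congr (_ * (_ * _ ^+ _)); rewrite -addnA [(_ + eps K w)%N]addnC addnA.
rewrite (@condind_integrate _ S' (Xi K p) (fun a v => u a ^+ v) (fun a => conv a (u a)))//.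
- transitivity (cEx P (fun w => (g (alpha w) * conv (alpha w) (u (alpha w))) * Y w *
     u (alpha w) ^+ offspring K p w)).
    by apply: eq_cEx => w; ring.
  rewrite (IH S (fun a => g a * conv a (u a)))//; last exact: okM.
  by apply: eq_cEx => w; rewrite exprS; ring.
- exact: eqxx.
- by move=> v; exact: ok_X.
- by move=> a v a01; apply: normcX_le1; exact: u1.
- move=> a a01.
  have S2 n : \sum_(v < n.+2) u a ^+ v * (inpmf (Xi K p) a v)%:C = conv a (u a).
    rewrite 2!big_ord_recl/= expr0 mul1r expr1 big1 ?addr0; last first.
      by move=> i _; rewrite mulr0.
    by rewrite /conv rmorphB rmorph1; ring.
  apply: cvg_near_cst; near=> n.
  have n2 : (1 < n)%N by near: n; exact: nbhs_infty_gt.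
  by rewrite -(subnK n2) addn2 S2 subrr normc0.
Unshelve. all: by end_near.
Qed.

Section path.
Context (th : nat -> R).

Definition pathphase K w : C := \prod_(k < K) cis (th k * (X k w)%:R).

Lemma cbd_pathphase K : cbd (pathphase K).
Proof.
apply: cbd_prod => k; split; last by exists 1 => w; rewrite normc_cis.
apply: cmf_cis; apply: measurable_funM => //.
by apply: (measurableT_comp (f := fun n : nat => n%:R : R)).
Qed.

Let atX K x w : C := pathphase K w * (X K w == x)%:R.

Lemma cbd_atX K x : cbd (atX K x).
Proof. by apply: cbdM; [exact: cbd_pathphase|exact: cbd_eqn]. Qed.

Lemma offspringE K x w : X K w = x -> X K.+1 w = offspring K x w.
Proof. by move=> E; rewrite (inar_step HX) E. Qed.

(** The path up to time [K] is a function of the inputs of the earlier steps. *)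
Lemma condind_atX K x : condind (atX K x) (later K).
Proof.
elim: K x => [|K IH] y.
  apply: (@condind_sub _ (fun j => predT j && (j != inl (inl tt)))).
    by move=> [[[]|[k j]]|k].
  have := condind_point y condind1 (isT : predT (inl (inl tt))).
  by apply: eq_condind => w; rewrite /atX /pathphase big_ord0 /cst.
apply: (condind_partition (measurable_funPT (X K)) (cbd_atX K.+1 y)) => x.
have okh v : ok (fun=> cis (th K * x%:R) * (v == y)%:R) by exact: ok_cst.
have := @condind_offspring K x (atX K x) (later K) (later K.+1)
  (fun _ v => cis (th K * x%:R) * (v == y)%:R) 1 (IH x) (cbd_atX K x).
have -> : (fun w => atX K.+1 y w * (X K w == x)%:R) =
    (fun w => atX K x w * (cis (th K * x%:R) * (offspring K x w == y)%:R)).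
  apply/funext => w; rewrite /atX /pathphase big_ord_recr/=.
  case: (X K w =P x) => [E|_]; last by rewrite !mulr0 !mul0r.
  by rewrite (offspringE E) E !mulr1 mulrA.
apply => //.
- by rewrite /later/=.
- by move=> j _; rewrite /later/=.
- by move=> [[[]|[k j]]|k]; rewrite !unfold_in /later//=; exact: ltnW.
- by rewrite /later/= ltnn.
- by move=> j _; rewrite /later/= ltnn.
- by move=> a v _; apply: normcM_le1; [rewrite normc_cis|exact: normc_bool].
Qed.

(** The last value is integrated out given its predecessor, and what remains is of
the same form; the Poisson factors match because the initial law is the
stationary one: [lambda = lambda / (1 - a) * (1 - a)]. *)
Lemma path_gf K (u g : R -> C) : ok u -> (forall a, 0 < a < 1 -> normc (u a) <= 1) -> ok g ->
  cEx P (fun w => g (alpha w) * pathphase K w * u (alpha w) ^+ X K w) =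
  cEx P (fun w => g (alpha w) * cexp ((lambda / (1 - alpha w))%:C *
     ((u (alpha w) - 1) + psi th K (alpha w) (u (alpha w) - 1)))).
Proof.
elim: K u g => [|K IH] u g oku u1 okg.
  transitivity (cEx P (fun w => g (alpha w) * cst 1 w * u (alpha w) ^+ input (inl (inl tt)) w)).
    by apply: eq_cEx => w; rewrite /pathphase big_ord0.
  have [mu _] := oku.
  have mex : cmf (fun a : R => cexp ((lambda / (1 - a))%:C * (u a - 1))).
    apply: cmf_cexp; apply: cmfM; last by apply: cmfB => //; exact: cmf_cst.
    by apply: cmf_real; apply: measurable_funM => //; exact: measurable_1B.
  rewrite (@condind_integrate (cst 1) predT (inl (inl tt)) (fun a v => u a ^+ v)
    (fun a => cexp ((lambda / (1 - a))%:C * (u a - 1))))//.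
  - by apply: eq_cEx => w; rewrite /= addr0 /cst mulr1.
  - exact: condind1.
  - exact: cbd_cst.
  - split => //; exists 1 => a a01; apply: normc_cexp_le1.
    have := Re_sub1_le0 (u1 a a01); rewrite ReM/= mul0r subr0.
    by move=> h; rewrite mulr_ge0_le0// ltW// rate_gt0.
  - by move=> v; exact: ok_X.
  - by move=> a v a01; apply: normcX_le1; exact: u1.
  - by move=> a a01; apply: poisson_gf; exact: rate_gt0.
pose u' a := cis (th K) * conv a (u a).
have oku' : ok u' by apply: okM; [exact: ok_cst|exact: ok_conv].
have u'1 a : 0 < a < 1 -> normc (u' a) <= 1.
  by move=> a01; apply: normcM_le1; [rewrite normc_cis|apply: normc_conv => //; exact: u1].
have okp := ok_cexp_poisson oku u1.
have bu : cbd (fun w => u (alpha w) ^+ X K.+1 w).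
  apply: (@cbd_comp_nat (X K.+1) (fun a v => u a ^+ v) 1) => //.
  - by move=> v; exact: ok_X.
  - by move=> a v a01; apply: normcX_le1; exact: u1.
have bu' : cbd (fun w => u' (alpha w) ^+ X K w).
  apply: (@cbd_comp_nat (X K) (fun a v => u' a ^+ v) 1) => //.
  - by move=> v; exact: ok_X.
  - by move=> a v a01; apply: normcX_le1; exact: u'1.
transitivity (cEx P (fun w => (g (alpha w) * cexp (lambda%:C * (u (alpha w) - 1))) *
   pathphase K w * u' (alpha w) ^+ X K w)).
  apply: (cEx_partition (measurable_funPT (X K))).
  - apply: cbdM => //; apply: cbdM; [exact: ok_cbd|exact: cbd_pathphase].
  - apply: cbdM => //; apply: cbdM; [exact: (ok_cbd (okM okg okp))|exact: cbd_pathphase].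
  move=> x.
  transitivity (cEx P (fun w => (g (alpha w) * cis (th K * x%:R)) * atX K x w *
     u (alpha w) ^+ offspring K x w)).
    apply: eq_cEx => w; rewrite /atX /pathphase big_ord_recr/=.
    case: (X K w =P x) => [E|_]; last by rewrite !mulr0 !mul0r.
    by rewrite -(offspringE E) E; ring.
  rewrite (@integrate_offspring K x (atX K x) (later K) u (fun a => g a * cis (th K * x%:R)))//.
  - apply: eq_cEx => w; rewrite /atX.
    case: (X K w =P x) => [E|_]; last by rewrite !mulr0 !mul0r.
    by rewrite /u' E exprMn -cisMn mulr_natr; ring.
  - exact: condind_atX.
  - exact: cbd_atX.
  - by rewrite /later/=.
  - by move=> j _; rewrite /later/=.
  - by apply: okM => //; exact: ok_cst.
rewrite (IH u' (fun a => g a * cexp (lambda%:C * (u a - 1))))//; last exact: okM.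
apply: eq_cEx => w; rewrite -mulrA -cexpD; congr (_ * cexp _).
have /andP[_ a1] := al01 w.
have u'E : u' (alpha w) - 1 = vstep (alpha w) (th K) (u (alpha w) - 1).
  by rewrite /u' /conv -vstepE addrC addKr.
rewrite u'E /= /vstep.
(* The Poisson innovation contributes the part [1 - alpha] of the stationary rate. *)
have lE : lambda%:C = (lambda / (1 - alpha w))%:C * (1 - (alpha w)%:C) :> C.
  rewrite -(rmorph1 (real_complex R)) -rmorphB -rmorphM/= divfK//.
  by rewrite gt_eqF// subr_gt0.
rewrite {1}lE; ring.
Qed.

(** The centring multiplies [path_gf] by a function of [alpha]. *)
Lemma centred_charf K : cEx P (fun w => cis (\sum_(k < K) th k * ((X k w)%:R - lambda / (1 - alpha w)))) =
  cEx P (fun w => cexp ((lambda / (1 - alpha w))%:C *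
     (psi th K (alpha w) 0 - 0 +i* (\sum_(k < K) th k)))).
Proof.
pose g (a : R) : C := cis (- (\sum_(k < K) th k) * (lambda / (1 - a))).
have okg : ok g.
  split; last by exists 1 => a _; rewrite normc_cis.
  apply: cmf_cis; apply: measurable_funM => //.
  by apply: measurable_funM => //; exact: measurable_1B.
transitivity (cEx P (fun w => g (alpha w) * pathphase K w * cst 1 (alpha w) ^+ X K w)).
  apply: eq_cEx => w; rewrite expr1n mulr1 /g /pathphase -cis_sum -cisD; congr cis.
  under eq_bigr do rewrite mulrBr.
  by rewrite sumrB mulNr mulr_suml addrC.
rewrite path_gf//.
- apply: eq_cEx => w; rewrite /cst subrr add0r /g -cexp_im -cexpD; congr cexp.
  have -> : 0 +i* (- (\sum_(k < K) th k) * (lambda / (1 - alpha w))) =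
     - ((lambda / (1 - alpha w))%:C * (0 +i* (\sum_(k < K) th k))) :> C.
    by apply: complex_eqP; rewrite ?ReN ?ImN ?ReM ?ImM/=; ring.
  by rewrite mulrBr addrC.
- exact: ok_cst.
- by move=> a _; rewrite normc1.
Qed.

End path.

End conditional_structure.


(** * Expansion of the conditional log-characteristic function *)
Section log_characteristic.
Context {R : realType} (th : nat -> R).
Local Notation C := R[i].

Lemma im_mulE (x : R) : 0 +i* x = 'i * x%:C :> C.
Proof. by apply: complex_eqP; rewrite ?ReM ?ImM/=; ring. Qed.

Lemma mulii : 'i * 'i = -1 :> C.
Proof. by apply: complex_eqP; rewrite ?ReM ?ImM/=; ring. Qed.

Lemma normc_im (x : R) : normc ('i * x%:C : C) = `|x|.
Proof. by rewrite -im_mulE /= expr0n add0r sqrtr_sqr. Qed.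

Lemma vstep_order1 (a t h : R) (v : C) :
  vstep a t v - 'i * (t + a * h)%:C =
  (cis t - 1 - 0 +i* t) + (cis t - 1) * (a%:C * v) + a%:C * (v - 'i * h%:C).
Proof. rewrite /vstep im_mulE rmorphD rmorphM; ring. Qed.

Lemma vstep_order2 (a t h q : R) (v : C) :
  vstep a t v - 'i * (t + a * h)%:C + ((t ^+ 2 + 2 * a * t * h + a * q) / 2)%:C =
  (cis t - 1 - 0 +i* t + (t ^+ 2 / 2)%:C) + (cis t - 1 - 0 +i* t) * (a%:C * v)
  + 'i * t%:C * (a%:C * (v - 'i * h%:C)) + a%:C * (v - 'i * h%:C + (q / 2)%:C).
Proof.
have -> : ((t ^+ 2 + 2 * a * t * h + a * q) / 2)%:C =
    (t ^+ 2 / 2)%:C + (a%:C * t%:C * h%:C) + a%:C * (q / 2)%:C :> C.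
  rewrite -!rmorphM -!rmorphD; congr (_%:C); by field.
rewrite /vstep im_mulE rmorphD rmorphM.
have E : t%:C * (a%:C * h%:C) = - ('i * t%:C * (a%:C * ('i * h%:C))) :> C.
  transitivity (- ('i * 'i * t%:C * (a%:C * h%:C)) : C); last by ring.
  by rewrite mulii; ring.
have -> : a%:C * t%:C * h%:C = t%:C * (a%:C * h%:C) :> C by ring.
rewrite E; ring.
Qed.

(** The quadratic form [\sum_(k, l) th k * th l * a ^ |k - l|], in the shape in
which the recursion produces it. *)
Fixpoint quad (K : nat) (a h : R) : R :=
  if K is K'.+1 then th K' ^+ 2 + 2 * a * th K' * h + quad K' a (th K' + a * h)
  else 0.

Section bounds.
Context (a dl : R).
Hypothesis a01 : 0 < a < 1.
Hypothesis dl0 : 0 <= dl.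
Hypothesis thd : forall k, `|th k| <= dl.

Let b : R := 1 - a.
Let b0 : 0 < b. Proof. by rewrite subr_gt0; case/andP: a01. Qed.
Let ab : a = 1 - b. Proof. by rewrite /b; ring. Qed.

Let divb (x : R) : x / b = x + a * (x / b).
Proof. by rewrite ab; field; rewrite gt_eqF. Qed.

Let ale (z : C) (x : R) : normc z <= x -> normc (a%:C * z) <= a * x.
Proof.
have /andP[a0 _] := a01.
by move=> zx; rewrite normcM normc_real ger0_norm ?ler_wpM2l// ltW.
Qed.

Let cis1 k : normc (cis (th k) - 1 : C) <= dl.
Proof. exact: le_trans (normc_cis_sub1 _) (thd k). Qed.

Let cis2 k : normc (cis (th k) - 1 - 0 +i* th k : C) <= dl ^+ 2.
Proof.
rewrite (le_trans (normc_cis_sub2 _))// -[th k ^+ 2]real_normK ?num_real//.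
by rewrite lerXn2r ?nnegrE.
Qed.

Let cis3 k : normc (cis (th k) - 1 - 0 +i* th k + (th k ^+ 2 / 2)%:C : C) <= dl ^+ 3.
Proof. by rewrite (le_trans (normc_cis_sub3 _))// lerXn2r ?nnegrE. Qed.

Lemma vstep_bound0 k (v : C) : normc v <= dl / b -> normc (vstep a (th k) v) <= dl / b.
Proof.
move=> hv; have -> : vstep a (th k) v = (cis (th k) - 1) + cis (th k) * (a%:C * v).
  by rewrite /vstep; ring.
rewrite divb (le_trans (le_normcD _ _))// lerD//.
by rewrite normcM normc_cis mul1r ale.
Qed.

Lemma vstep_error1 k h (v : C) : normc v <= dl / b ->
  normc (vstep a (th k) v - 'i * (th k + a * h)%:C) <=
  a * normc (v - 'i * h%:C) + dl ^+ 2 / b.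
Proof.
move=> hv; rewrite vstep_order1.
have n1 : normc ((cis (th k) - 1) * (a%:C * v)) <= dl * (a * (dl / b)).
  by rewrite normcM ler_pM ?normc_ge0// ale.
have n2 := ale (lexx (normc (v - 'i * h%:C))); have n0 := cis2 k.
rewrite (le_trans (le_normcD _ _))// (le_trans (lerD (le_trans (le_normcD _ _) (lerD n0 n1)) n2))//.
rewrite addrC lerD2l le_eqVlt; apply/orP; left; apply/eqP.
by rewrite ab; field; rewrite gt_eqF.
Qed.

Lemma vstep_bound1 k h (v : C) : normc v <= dl / b ->
  normc (v - 'i * h%:C) <= (dl / b) ^+ 2 ->
  normc (vstep a (th k) v - 'i * (th k + a * h)%:C) <= (dl / b) ^+ 2.
Proof.
have /andP[a0 a1] := a01.
move=> hv hh; apply: (le_trans (vstep_error1 k h hv)).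
apply: (le_trans (lerD (ler_wpM2l (ltW a0) hh) (lexx _))).
rewrite le_eqVlt; apply/orP; left; apply/eqP.
by rewrite ab; field; rewrite gt_eqF.
Qed.

Lemma vstep_error2 k h q (v : C) : normc v <= dl / b ->
  normc (v - 'i * h%:C) <= (dl / b) ^+ 2 ->
  normc (vstep a (th k) v - 'i * (th k + a * h)%:C +
     ((th k ^+ 2 + 2 * a * th k * h + a * q) / 2)%:C) <=
  a * normc (v - 'i * h%:C + (q / 2)%:C) + 3 * (dl ^+ 3 / b ^+ 2).
Proof.
move=> hv hh; rewrite vstep_order2.
have /andP[a0 a1] := a01.
have n1 : normc ((cis (th k) - 1 - 0 +i* th k) * (a%:C * v)) <= dl ^+ 2 * (a * (dl / b)).
  by rewrite normcM ler_pM ?normc_ge0// ale.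
have n2 : normc ('i * (th k)%:C * (a%:C * (v - 'i * h%:C))) <= dl * (a * (dl / b) ^+ 2).
  by rewrite normcM normc_im ler_pM ?normc_ge0// ale.
have n3 := ale (lexx (normc (v - 'i * h%:C + (q / 2)%:C))); have n0 := cis3 k.
rewrite (le_trans (le_normcD _ _))// (le_trans (lerD (le_trans (le_normcD _ _)
  (lerD (le_trans (le_normcD _ _) (lerD n0 n1)) n2)) n3))//.
rewrite addrC lerD2l.
set x := dl / b.
have x0 : 0 <= x by rewrite divr_ge0// ltW.
have dx : dl = b * x by rewrite /x mulrC divfK// gt_eqF.
have b1 : b <= 1 by rewrite /b; lra.
have -> : dl ^+ 3 / b ^+ 2 = b * x ^+ 3 by rewrite dx; field; rewrite gt_eqF.
rewrite dx.
have -> : (b * x) ^+ 3 + (b * x) ^+ 2 * (a * x) + b * x * (a * x ^+ 2) =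
  3 * (b * x ^+ 3) - (b * x ^+ 3) * (3 - b ^+ 2 - b * a - a) by ring.
have bx0 : 0 <= b * x ^+ 3 by rewrite mulr_ge0 ?exprn_ge0// ltW.
rewrite lerBlDr lerDl; apply: mulr_ge0 => //.
have -> : 3 - b ^+ 2 - b * a - a = 2 :> R by rewrite /b; ring.
by [].
Qed.

(** Each step adds its own error once: the errors are discounted by [a] along the
recursion and summed with weight [1 - a]. *)
Lemma psi_order1 K h (v : C) : normc v <= dl / b ->
  normc (psi th K a v + v - 'i * (\sum_(k < K) th k + h)%:C) <=
  normc (v - 'i * h%:C) + K%:R * (dl ^+ 2 / b).
Proof.
elim: K h v => [|K IH] h v hv; first by rewrite big_ord0 /= !add0r mul0r addr0.
have /= := IH (th K + a * h) _ (vstep_bound0 K hv).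
rewrite big_ord_recr/= => h1.
have -> : (cis (th K) - 1) * (1 + a%:C * v) + psi th K a (vstep a (th K) v) + v -
   'i * (\sum_(i < K) th i + th K + h)%:C =
   (psi th K a (vstep a (th K) v) + vstep a (th K) v - 'i * (\sum_(k < K) th k + (th K + a * h))%:C)
   + b%:C * (v - 'i * h%:C).
  by set p := psi _ K a _; rewrite /vstep /b !rmorphD !rmorphM !rmorphN rmorph1; ring.
have h2 := vstep_error1 K h hv.
have h3 : normc (b%:C * (v - 'i * h%:C)) = (1 - a) * normc (v - 'i * h%:C).
  by rewrite normcM normc_real (ger0_norm (ltW b0)).
rewrite (le_trans (le_normcD _ _))// h3 -[K.+1%:R]natr1; lra.
Qed.

Lemma psi_order2 K h q (v : C) : normc v <= dl / b ->
  normc (v - 'i * h%:C) <= (dl / b) ^+ 2 ->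
  normc (psi th K a v + v - 'i * (\sum_(k < K) th k + h)%:C + ((quad K a h + q) / 2)%:C)
    <= normc (v - 'i * h%:C + (q / 2)%:C) + K%:R * (3 * (dl ^+ 3 / b ^+ 2)).
Proof.
elim: K h q v => [|K IH] h q v hv hh; first by rewrite big_ord0 /= !add0r mul0r addr0.
have /= := IH _ (th K ^+ 2 + 2 * a * th K * h + a * q) _ (vstep_bound0 K hv) (vstep_bound1 K hv hh).
have h2 := vstep_error2 K q hv hh.
rewrite big_ord_recr/= => h1.
set t := th K in h1 h2 *; set h' := t + a * h in h1 h2 *.
set q' := t ^+ 2 + 2 * a * t * h + a * q in h1 h2.
have -> : (cis t - 1) * (1 + a%:C * v) + psi th K a (vstep a t v) + v -
   'i * (\sum_(i < K) th i + t + h)%:C + ((t ^+ 2 + 2 * a * t * h + quad K a h' + q) / 2)%:C =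
   (psi th K a (vstep a t v) + vstep a t v - 'i * (\sum_(k < K) th k + h')%:C
     + ((quad K a h' + q') / 2)%:C)
   + b%:C * (v - 'i * h%:C + (q / 2)%:C).
  have -> : ((t ^+ 2 + 2 * a * t * h + quad K a h' + q) / 2)%:C =
     ((quad K a h' + q') / 2)%:C + b%:C * (q / 2)%:C :> C.
    rewrite -rmorphM -rmorphD; congr (_%:C); rewrite /q' /b; by field.
  by set p := psi _ K a _; rewrite /vstep /b /h' !rmorphD !rmorphM !rmorphN rmorph1; ring.
have h3 : normc (b%:C * (v - 'i * h%:C + (q / 2)%:C)) = (1 - a) * normc (v - 'i * h%:C + (q / 2)%:C).
  by rewrite normcM normc_real (ger0_norm (ltW b0)).
rewrite (le_trans (le_normcD _ _))// h3 -[K.+1%:R]natr1; lra.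
Qed.

Lemma logchar_order1 K :
  normc (psi th K a 0 - 0 +i* (\sum_(k < K) th k)) <= K%:R * (dl ^+ 2 / b).
Proof.
have x0 : 0 <= dl / b by rewrite divr_ge0// ltW.
have := @psi_order1 K 0 0; rewrite rmorph0 mulr0 subr0 normc0 => /(_ x0).
by rewrite !addr0 add0r im_mulE.
Qed.

Lemma logchar_order2 K :
  normc (psi th K a 0 - 0 +i* (\sum_(k < K) th k) + (quad K a 0 / 2)%:C)
    <= K%:R * (3 * (dl ^+ 3 / b ^+ 2)).
Proof.
have x0 : 0 <= dl / b by rewrite divr_ge0// ltW.
have := @psi_order2 K 0 0 0; rewrite !mul0r rmorph0 mulr0 subr0 addr0 normc0.
by move=> /(_ x0 (exprn_ge0 _ x0)); rewrite !addr0 normc0 add0r im_mulE.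
Qed.

End bounds.

(** The exponents collected by [psi] telescope, leaving only the values of the
recursion, which have nonpositive real parts. *)
Lemma Re_psi_le0 a K (v : C) : 0 < a < 1 -> normc (1 + v) <= 1 ->
  Re (psi th K a v + v) <= 0.
Proof.
move=> a01; elim: K v => [|K IH] v v1 /=.
  by have := Re_sub1_le0 v1; rewrite add0r [1 + v - 1](_ : _ = v)//; ring.
have := IH _ (normc_vstep (th K) a01 v1).
have := Re_sub1_le0 v1; rewrite [1 + v - 1](_ : _ = v); last by ring.
have -> : (cis (th K) - 1) * (1 + a%:C * v) + psi th K a (vstep a (th K) v) + v =
   (psi th K a (vstep a (th K) v) + vstep a (th K) v) + (1 - a)%:C * v.
  by set p := psi _ K a _; rewrite /vstep rmorphB rmorph1; ring.
move=> v0 h; rewrite ReD [Re ((1 - a)%:C * v)]ReM [Re (1 - a)%:C]/= [Im (1 - a)%:C]/= mul0r subr0.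
by have /andP[a0 a1] := a01; rewrite (le_trans (lerD h (mulr_ge0_le0 _ v0))) ?addr0// subr_ge0 ltW.
Qed.

Lemma Re_logchar_le0 a K : 0 < a < 1 ->
  Re (psi th K a 0 - 0 +i* (\sum_(k < K) th k)) <= 0.
Proof.
move=> a01; have := @Re_psi_le0 a K 0 a01; rewrite !addr0 normc1 => /(_ (lexx _)).
by rewrite ReD ReN/= oppr0 addr0.
Qed.

(** The initial state [h] interacts with the [k]-th phase through [a ^ (K - k)]. *)
Lemma quadE K a h : quad K a h =
  \sum_(k < K) \sum_(l < K) th k * th l * a ^+ (k - l + (l - k))
  + 2 * h * \sum_(k < K) th k * a ^+ (K - k).
Proof.
elim: K h => [|K IH] h; first by rewrite /= !big_ord0 mulr0 addr0.
rewrite [LHS]/= IH big_ord_recr/= [X in _ = _ + X + _]big_ord_recr/= subnn expr0.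
under [in X in _ = X + _ + _]eq_bigr do rewrite big_ord_recr/=.
rewrite big_split/= [X in _ = _ + X]mulrC.
under [in X in _ = _ + X]eq_bigr do rewrite subSn ?leq_ord//.
rewrite big_ord_recr/= subnn.
set A := \sum_(k < K) \sum_(l < K) _.
set S := \sum_(k < K) th k * a ^+ (K - k).
have E1 : \sum_(i < K) th i * th K * a ^+ (i - K + (K - i)) = th K * S.
  rewrite mulr_sumr; apply: eq_bigr => i _.
  by rewrite (eqP (ltnW (ltn_ord i))) add0n; ring.
have E2 : \sum_(i < K) th K * th i * a ^+ (K - i + (i - K)) = th K * S.
  rewrite mulr_sumr; apply: eq_bigr => i _.
  by rewrite (eqP (ltnW (ltn_ord i))) addn0; ring.
have E3 : \sum_(i < K) th i * a ^+ (K - i).+1 = a * S.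
  by rewrite mulr_sumr; apply: eq_bigr => i _; rewrite exprS; ring.
rewrite E1 E2 E3 /=; ring.
Qed.

End log_characteristic.


(** * Quadratic forms of partial sums *)
Section toeplitz_sums.
Context {R : realType}.
Implicit Types (a : R).

Definition toeplitz a (p q : nat) : R :=
  \sum_(k < p) \sum_(l < q) a ^+ (k - l + (l - k)).

Lemma toeplitzC a p q : toeplitz a p q = toeplitz a q p.
Proof.
rewrite /toeplitz exchange_big; apply: eq_bigr => k _; apply: eq_bigr => l _.
by rewrite addnC.
Qed.

(** A full row sums to [(1 + a) / (1 - a)], up to two geometric tails. *)
Lemma geom_row a k q : (k < q)%N ->
  (1 - a) * \sum_(l < q) a ^+ (k - l + (l - k)) = 1 + a - a ^+ k.+1 - a ^+ (q - k).
Proof.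
move=> /subnK <-; elim: (q - k.+1)%N => [|r IH].
  rewrite add0n subSnn expr1.
  have -> : \sum_(l < k.+1) a ^+ (k - l + (l - k)) = \sum_(l < k.+1) a ^+ l.
    rewrite (reindex_inj rev_ord_inj)/=; apply: eq_bigr => l _.
    rewrite subSS (eqP (leq_subr _ _)) addn0 subKn//.
    by rewrite -ltnS ltn_ord.
  by rewrite -[1 - a]opprB mulNr -subrX1; ring.
rewrite addSn big_ord_recr/= mulrDr IH.
have -> : (r + k.+1 - k = r.+1)%N by rewrite addnS subSn ?leq_addl// addnK.
have -> : ((r + k.+1).+1 - k = r.+2)%N by rewrite addnS !subSn ?leqW ?leq_addl// addnK.
have -> : (k - (r + k.+1) = 0)%N by apply/eqP; rewrite subn_eq0 addnS leqW// leq_addl.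
rewrite add0n !exprS; ring.
Qed.

Lemma geom_le a p : 0 < a < 1 -> (1 - a) * \sum_(k < p) a ^+ k.+1 <= 1.
Proof.
move=> /andP[a0 a1].
under eq_bigr do rewrite exprS.
rewrite -mulr_sumr mulrCA -[1 - a]opprB mulNr -subrX1 opprB.
have := exprn_ge0 p (ltW a0); nra.
Qed.

Lemma geom_tail a p q : 0 < a < 1 -> (p <= q)%N ->
  (1 - a) * \sum_(k < p) a ^+ (q - k) <= 1.
Proof.
move=> a01 pq; have /andP[a0 a1] := a01.
have -> : (1 - a) * \sum_(k < p) a ^+ (q - k) = a ^+ (q - p).+1 - a ^+ q.+1.
  elim: p pq => [|p IH] pq; first by rewrite big_ord0 mulr0 subn0 subrr.
  by rewrite big_ord_recr/= mulrDr IH ?(ltnW pq)// subnSK// !exprS; ring.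
have := exprn_ile1 (q - p).+1 (ltW a0) (ltW a1); have := exprn_ge0 q.+1 (ltW a0); lra.
Qed.

Lemma toeplitz_bound a p q : 0 < a < 1 ->
  `|toeplitz a p q - (minn p q)%:R * ((1 + a) / (1 - a))| <= 2 / (1 - a) ^+ 2.
Proof.
move=> a01; wlog pq : p q / (p <= q)%N.
  move=> h; case/orP: (leq_total p q) => pq; first exact: h.
  by rewrite toeplitzC minnC; exact: h.
have /andP[a0 a1] := a01.
have b0 : 0 < 1 - a by rewrite subr_gt0.
have -> : minn p q = p by apply/minn_idPl.
have E : (1 - a) * toeplitz a p q =
    p%:R * (1 + a) - \sum_(k < p) a ^+ k.+1 - \sum_(k < p) a ^+ (q - k).
  rewrite mulr_sumr.
  have -> : p%:R * (1 + a) = \sum_(k < p) (1 + a) by rewrite sumr_const card_ord mulr_natl.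
  by rewrite -!sumrB; apply: eq_bigr => k _; rewrite geom_row// (leq_trans (ltn_ord k)).
have n1 : 0 <= \sum_(k < p) a ^+ k.+1 by apply: sumr_ge0 => k _; rewrite exprn_ge0// ltW.
have n2 : 0 <= \sum_(k < p) a ^+ (q - k) by apply: sumr_ge0 => k _; rewrite exprn_ge0// ltW.
have h1 := geom_le p a01; have h2 := geom_tail a01 pq.
rewrite -(ler_pM2l (exprn_gt0 2 b0)) -[X in X * `|_|]ger0_norm ?sqr_ge0// -normrM.
have -> : (1 - a) ^+ 2 * (toeplitz a p q - p%:R * ((1 + a) / (1 - a))) =
   - ((1 - a) * \sum_(k < p) a ^+ k.+1 + (1 - a) * \sum_(k < p) a ^+ (q - k)).
  transitivity ((1 - a) * ((1 - a) * toeplitz a p q) - (1 - a) * p%:R * (1 + a)).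
    by field; rewrite gt_eqF.
  by rewrite E; ring.
rewrite normrN [leRHS]mulrC divfK ?gt_eqF ?exprn_gt0// ger0_norm; first lra.
by rewrite addr_ge0// mulr_ge0// ltW.
Qed.

Lemma toeplitz_ge0 a p q : 0 < a < 1 -> 0 <= toeplitz a p q.
Proof.
move=> /andP[a0 _]; apply: sumr_ge0 => k _; apply: sumr_ge0 => l _.
by rewrite exprn_ge0// ltW.
Qed.

Lemma toeplitz_le a p q : 0 < a < 1 -> toeplitz a p q <= p%:R * (2 / (1 - a)).
Proof.
move=> a01; have /andP[a0 a1] := a01.
have b0 : 0 < 1 - a by rewrite subr_gt0.
have -> : p%:R * (2 / (1 - a)) = \sum_(k < p) (2 / (1 - a)) by rewrite sumr_const card_ord mulr_natl.
apply: ler_sum => k _.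
have row r : (k < r)%N -> \sum_(l < r) a ^+ (k - l + (l - k)) <= 2 / (1 - a).
  move=> kr; rewrite ler_pdivlMr// mulrC geom_row//.
  have := exprn_ge0 k.+1 (ltW a0); have := exprn_ge0 (r - k) (ltW a0); lra.
case: (ltnP k q) => kq; first exact: row.
apply: le_trans (row k.+1 (ltnSn k)).
rewrite [leRHS](big_ord_widen_cond k.+1 predT (fun l => a ^+ (k - l + (l - k))))//.
rewrite (big_ord_widen_cond k.+1 predT (fun l => a ^+ (k - l + (l - k)))) ?leqW//=.
rewrite big_mkcond/= [leRHS]big_mkcond/=; apply: ler_sum => l _.
by rewrite ltn_ord; case: ifP => // _; rewrite exprn_ge0// ltW.
Qed.

End toeplitz_sums.

Section step_weights.
Context {R : realType}.

(** The weights of the partial sums: [\sum_i c i * \sum_(1 <= k <= p i) x k] is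
[\sum_k steps c p k * x k]. *)
Definition steps m (c : 'I_m -> R) (p : 'I_m -> nat) (k : nat) : R :=
  \sum_i c i * (0 < k <= p i)%N%:R.

Lemma sum_steps1 K p (F : nat -> R) : (p < K)%N ->
  \sum_(k < K) (0 < k <= p)%N%:R * F k = \sum_(k < p) F k.+1.
Proof.
case: K => // K; rewrite ltnS => pK; rewrite big_ord_recl/= mul0r add0r.
rewrite (big_ord_widen_cond K predT (fun k => F k.+1))//= [RHS]big_mkcond/=.
by apply: eq_bigr => k _; rewrite /bump/= add1n; case: ifP; rewrite ?mul1r ?mul0r.
Qed.

Lemma sum_steps m (c : 'I_m -> R) p K (F : nat -> R) : (forall i, p i < K)%N ->
  \sum_(k < K) steps c p k * F k = \sum_i c i * \sum_(k < p i) F k.+1.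
Proof.
move=> pK.
under eq_bigr do rewrite /steps mulr_suml.
rewrite exchange_big/=; apply: eq_bigr => i _.
rewrite -(sum_steps1 F (pK i)) mulr_sumr; apply: eq_bigr => k _.
by rewrite mulrA.
Qed.

Lemma norm_steps_le m (c : 'I_m -> R) p k : `|steps c p k| <= \sum_i `|c i|.
Proof.
rewrite (le_trans (ler_norm_sum _ _ _))//; apply: ler_sum => i _.
by rewrite normrM ler_piMr// ger0_norm// lern1 leq_b1.
Qed.

Lemma quadZ (th : nat -> R) s K a :
  quad (fun k => s * th k) K a 0 = s ^+ 2 * quad th K a 0.
Proof.
rewrite !quadE !mulr0 !mul0r !addr0 mulr_sumr; apply: eq_bigr => k _.
rewrite mulr_sumr; apply: eq_bigr => l _; ring.
Qed.

Lemma quad_steps m (c : 'I_m -> R) p K a : (forall i, p i < K)%N ->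
  quad (steps c p) K a 0 = \sum_i \sum_j c i * c j * toeplitz a (p i) (p j).
Proof.
move=> pK; rewrite quadE mulr0 mul0r addr0.
transitivity (\sum_(k < K) steps c p k * (\sum_(l < K) steps c p l * a ^+ (k - l + (l - k)))).
  by apply: eq_bigr => k _; rewrite mulr_sumr; apply: eq_bigr => l _; rewrite mulrA.
rewrite (sum_steps c (fun k => \sum_(l < K) steps c p l * a ^+ (k - l + (l - k))) pK).
apply: eq_bigr => i _.
under eq_bigr => k _ do rewrite (sum_steps c (fun l => a ^+ (k.+1 - l + (l - k.+1))) pK).
rewrite exchange_big/= mulr_sumr; apply: eq_bigr => j _.
rewrite -mulr_sumr mulrA; congr (_ * _).
Qed.

Lemma quad_steps_le m (c : 'I_m -> R) p K a n (D : R) : 0 < a < 1 ->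
  (forall i, p i < K)%N -> (forall i, (p i)%:R <= n * D) ->
  `|quad (steps c p) K a 0| <= n * (2 * D * (\sum_i `|c i|) ^+ 2 / (1 - a)).
Proof.
move=> a01 pK pn; rewrite quad_steps//.
have /andP[a0 a1] := a01.
have b0 : 0 < 1 - a by rewrite subr_gt0.
have -> : n * (2 * D * (\sum_i `|c i|) ^+ 2 / (1 - a)) =
    \sum_i \sum_j `|c i| * `|c j| * (n * D * (2 / (1 - a))).
  transitivity (\sum_i `|c i| * (\sum_j `|c j|) * (n * D * (2 / (1 - a)))).
    by rewrite -!mulr_suml expr2; ring.
  by apply: eq_bigr => i _; rewrite mulr_sumr mulr_suml.
rewrite (le_trans (ler_norm_sum _ _ _))//; apply: ler_sum => i _.
rewrite (le_trans (ler_norm_sum _ _ _))//; apply: ler_sum => j _.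
rewrite !normrM ler_wpM2l ?mulr_ge0// ger0_norm ?toeplitz_ge0//.
by rewrite (le_trans (toeplitz_le _ _ a01))// ler_wpM2r// divr_ge0// ltW.
Qed.

Lemma truncn_dist (x : R) : 0 <= x -> `|(Num.truncn x)%:R - x| <= 1.
Proof.
move=> x0; have /andP[h1 h2] := truncn_itv x0.
rewrite -natr1 in h2; rewrite ler_norml; apply/andP; split; lra.
Qed.

(** Truncation is monotone, so that it commutes with minima. *)
Lemma minn_truncn_dist (n : nat) (s t : R) : 0 <= s -> 0 <= t ->
  `|(minn (Num.truncn (n%:R * s)) (Num.truncn (n%:R * t)))%:R - n%:R * Num.min s t| <= 1.
Proof.
move=> s0 t0; wlog st : s t s0 t0 / s <= t.
  move=> h; case/orP: (le_total s t) => st; first exact: h.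
  by rewrite minnC minC; exact: h.
rewrite min_l// (minn_idPl _); first by rewrite truncn_dist// mulr_ge0.
by apply: le_truncn; rewrite ler_wpM2l.
Qed.

Lemma quad_steps_cvg m (t c : 'I_m -> R) (K : nat -> nat) a : 0 < a < 1 ->
  (forall i, 0 <= t i) ->
  (forall n i, Num.truncn (n%:R * t i) < K n)%N ->
  n%:R^-1 * quad (steps c (fun i => Num.truncn (n%:R * t i))) (K n) a 0 @[n --> \oo]
    --> (1 + a) / (1 - a) * minform t c.
Proof.
move=> a01 t0 tK; have /andP[a0 a1] := a01.
have b0 : 0 < 1 - a by rewrite subr_gt0.
set D := 2 / (1 - a) ^+ 2 + (1 + a) / (1 - a).
have D0 : 0 <= (1 + a) / (1 - a) by rewrite divr_ge0 ?(ltW b0)//; lra.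
pose A := \sum_i \sum_j `|c i * c j| * D.
apply: (@cvg_dist0 _ _ (fun n => A * n%:R^-1)); last first.
  by rewrite -[X in _ --> X](mulr0 A); apply: cvgM; [exact: cvg_cst|exact: cvg_invn0].
near=> n.
have n0 : 0 < n%:R :> R by rewrite ltr0n; near: n; exact: nbhs_infty_gt.
rewrite quad_steps//.
have -> : (1 + a) / (1 - a) * minform t c =
  n%:R^-1 * \sum_i \sum_j c i * c j * (n%:R * Num.min (t i) (t j) * ((1 + a) / (1 - a))).
  rewrite /minform !mulr_sumr; apply: eq_bigr => i _; rewrite !mulr_sumr.
  by apply: eq_bigr => j _; field; rewrite !gt_eqF.
rewrite -mulrBr normrM ger0_norm ?invr_ge0 ?ler0n// mulrC ler_wpM2r ?invr_ge0 ?ler0n//.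
rewrite -sumrB (le_trans (ler_norm_sum _ _ _))//; apply: ler_sum => i _.
rewrite -sumrB (le_trans (ler_norm_sum _ _ _))//; apply: ler_sum => j _.
rewrite -mulrBr normrM ler_wpM2l//.
have h1 := toeplitz_bound (Num.truncn (n%:R * t i)) (Num.truncn (n%:R * t j)) a01.
have h2 := minn_truncn_dist n (t0 i) (t0 j).
rewrite (le_trans (ler_distD ((minn (Num.truncn (n%:R * t i)) (Num.truncn (n%:R * t j)))%:R * ((1 + a) / (1 - a))) _ _))//.
rewrite /D lerD// -mulrBl normrM (ger0_norm D0).
by rewrite -[leRHS]mul1r ler_wpM2r.
Unshelve. all: by end_near.
Qed.

End step_weights.


(** * Integrability of the squared inverse of 1 - alpha *)

Section monotone_limits.
Context d (T : measurableType d) (R : realType) (P : probability T R).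

Lemma itg_monotone (F : nat -> T -> R) (f : T -> R) (M : R) :
  (forall n, itg P (F n)) -> (forall n w, 0 <= F n w) ->
  (forall w, nondecreasing_seq (F ^~ w)) ->
  (forall w, F n w @[n --> \oo] --> f w) -> measurable_fun [set: T] f ->
  (forall n, Ex P (F n) <= M) -> itg P f.
Proof.
move=> iF F0 ndF cF mf FM.
have f0 w : 0 <= f w.
  rewrite -(cvg_lim _ (cF w))//; apply: limr_ge; first exact: (cvgP _ (cF w)).
  by apply: nearW => n; exact: F0.
apply/integrableP; split; first exact/measurable_EFinP.
under eq_integral do rewrite gee0_abs ?lee_fin//.
apply: (@le_lt_trans _ _ M%:E); last exact: ltry.
have -> : (\int[P]_w (f w)%:E = lim (\int[P]_w (F n w)%:E @[n --> \oo]))%E.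
  rewrite -monotone_convergence//=.
  - by apply: eq_integral => w _; apply/esym/cvg_lim => //; apply: cvg_EFin; [exact: nearW|exact: cF].
  - by move=> n; apply/measurable_EFinP; exact: itg_meas (iF n).
  - by move=> n w _; rewrite lee_fin.
  - by move=> w _ m n mn; rewrite lee_fin; exact: ndF.
apply: lime_le.
  apply: ereal_nondecreasing_is_cvgn => m n mn; apply: ge0_le_integral => //.
  - by move=> w _; rewrite lee_fin.
  - by apply/measurable_EFinP; exact: itg_meas (iF m).
  - by apply/measurable_EFinP; exact: itg_meas (iF n).
  - by move=> w _; rewrite lee_fin; exact: ndF.
by apply: nearW => n; rewrite Ex_fin// lee_fin.
Qed.

Lemma itg_indicator_le (Y : T -> R) (y : R) : measurable_fun [set: T] Y ->
  itg P (fun w => (Y w <= y)%R%:R).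
Proof.
move=> mY; apply: (@itg_bounded _ _ _ _ _ 1); last by move=> w; rewrite ger0_norm// lern1 leq_b1.
rewrite (_ : (fun w => _) = (fun w => if Y w <= y then 1 else 0)).
  by apply: measurable_fun_ifT => //; exact: measurable_fun_ler.
by apply/funext => w; case: ifP.
Qed.

(** Truncating the function 1 / y ^ 2 at dyadic levels, each level costs the
probability of being below it. *)
Lemma itg_inv_square (Y : T -> R) (C q : R) : measurable_fun [set: T] Y ->
  (forall w, 0 < Y w < 1) -> 0 <= q -> 4 * q < 1 ->
  (forall n, Ex P (fun w => (Y w <= 2^-1 ^+ n)%R%:R) <= C * q ^+ n) ->
  itg P (fun w => (Y w)^-1 ^+ 2).
Proof.
move=> mY Y01 q0 q1 HC.
pose l n : R := 2^-1 ^+ n.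
have l0 n : 0 < l n by rewrite exprn_gt0.
pose F n w := (Num.max (Y w) (l n))^-1 ^+ 2.
have mx0 n w : 0 < Num.max (Y w) (l n) by rewrite lt_max l0 orbT.
have minv (g : T -> R) : measurable_fun [set: T] g -> measurable_fun [set: T] (fun w => (g w)^-1 ^+ 2).
  by move=> mg; apply: measurable_funX; exact: (measurableT_comp (@measurable_invr R)).
have ll n : l n.+1 <= l n by rewrite /l exprS ler_piMl ?(ltW (l0 n))//; lra.
have lE n : (l n)^-1 ^+ 2 = 4 ^+ n.
  rewrite /l -exprVn invrK -exprM mulnC exprM; congr (_ ^+ _); ring.
have iF n : itg P (F n).
  apply: (@itg_bounded _ _ _ _ _ (4 ^+ n)).
    by apply: minv; apply: measurable_maxr => //; exact: measurable_cst.
  move=> w; rewrite -lE ger0_norm ?sqr_ge0// lerXn2r ?nnegrE ?invr_ge0 ?(ltW (mx0 _ _)) ?(ltW (l0 _))//.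
  by rewrite lef_pV2 ?posrE// le_max lexx orbT.
have i1 n := itg_indicator_le (2^-1 ^+ n) mY.
(* Lowering the truncation level matters only where [Y] is below the old one. *)
have stepF n w : F n.+1 w <= F n w + 4 ^+ n.+1 * (Y w <= 2^-1 ^+ n)%R%:R.
  case: (leP (Y w) (2^-1 ^+ n)) => h; last first.
    rewrite mulr0 addr0 /F !max_l//; first exact: ltW.
    exact: (le_trans (ll n) (ltW h)).
  rewrite mulr1 -lE (le_trans (_ : _ <= (l n.+1)^-1 ^+ 2))//; last by rewrite lerDr sqr_ge0.
  rewrite lerXn2r ?nnegrE ?invr_ge0 ?(ltW (mx0 _ _)) ?(ltW (l0 _))//.
  by rewrite lef_pV2 ?posrE// le_max lexx orbT.
have C0 : 0 <= C.
  by have := HC 0%N; rewrite expr0 mulr1; apply: le_trans; apply: Ex_ge0.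
have EF n : Ex P (F n) <= 1 + 4 * C * \sum_(k < n) (4 * q) ^+ k.
  elim: n => [|n IH].
    rewrite big_ord0 mulr0 addr0 -[leRHS](Ex_cst P); apply: Ex_le => //.
      exact: itg_cst.
    by move=> w; rewrite /F /l expr0 max_r ?invr1 ?expr1n//; have /andP[_ /ltW] := Y01 w.
  apply: (@le_trans _ _ (Ex P (F n) + 4 ^+ n.+1 * Ex P (fun w => (Y w <= 2^-1 ^+ n)%R%:R))).
    rewrite -ExZ// -ExD//; last exact: itgZ.
    by apply: Ex_le => //; apply: itgD => //; exact: itgZ.
  rewrite big_ord_recr/= mulrDr addrA lerD//.
  have -> : 4 * C * (4 * q) ^+ n = 4 ^+ n.+1 * (C * q ^+ n) by rewrite exprMn exprS; ring.
  by rewrite ler_wpM2l// exprn_ge0.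
apply: (@itg_monotone F _ (1 + 4 * C * (1 - 4 * q)^-1)) => //.
- by move=> n w; exact: sqr_ge0.
- move=> w; apply/nondecreasing_seqP => n.
  rewrite lerXn2r ?nnegrE ?invr_ge0 ?(ltW (mx0 _ _))//.
  rewrite lef_pV2 ?posrE// ge_max le_max lexx/= le_max ll orbT//.
- move=> w; apply: cvg_near_cst.
  have Y0 : 0 < Y w by have /andP[] := Y01 w.
  have l_0 : l n @[n --> \oo] --> 0.
    by apply: cvg_expr; rewrite ger0_norm//; lra.
  near=> n; rewrite /F max_l//; apply: ltW; near: n; exact: (cvgr_lt _ l_0).
- exact: minv.
- move=> n; apply: (le_trans (EF n)); rewrite lerD2l ler_wpM2l ?mulr_ge0//.
  have p0 : 0 < 1 - 4 * q by lra.
  rewrite -(ler_pM2l p0) divff ?gt_eqF// -[X in X * _]opprB mulNr -subrX1 opprB.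
  by rewrite gerBl exprn_ge0// mulr_ge0.
Unshelve. all: by end_near.
Qed.

(** Near [1] the density is at most a constant times [(1 - x) ^ beta]. *)
Lemma density_tail (alpha : {RV P >-> R}) (psi : R -> R) (psi1 beta : R) :
  has_density01 P alpha (fun x => psi x * (1 - x) `^ beta) ->
  psi x @[x --> 1^'-] --> psi1 -> 0 < psi1 -> 1 < beta ->
  exists C, forall e, 0 < e <= 1 ->
    Ex P (fun w => (1 - alpha w <= e)%R%:R) <= C * e `^ (beta + 1).
Proof.
move=> [mh h0 Ph] cpsi p0 b1.
have : \forall x \near 1^'-, psi x <= psi1 + 1 by apply: (cvgr_le _ cpsi); rewrite ltrDl.
case/nbhs_ballP => /= eta eta0 Heta.
(* The second term takes care of the [e] for which [psi] is not yet bounded. *)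
pose C := Num.max (psi1 + 1) ((eta / 2) `^ (beta + 1))^-1.
have eta2 : 0 < eta / 2 by rewrite divr_gt0.
have mA e : measurable [set x : R | 1 - x <= e].
  have -> : [set x : R | 1 - x <= e] = `[1 - e, +oo[%classic.
    by apply/seteqP; split => x /=; rewrite in_itv/= andbT lerBlDr addrC -lerBlDr.
  exact: measurable_itv.
have PE e : Ex P (fun w => (1 - alpha w <= e)%R%:R) = fine (P (alpha @^-1` [set x | 1 - x <= e])).
  rewrite -Ex_prob; first by apply: eq_Ex => w; rewrite indicE; congr (nat_of_bool _)%:R;
    apply/idP/idP; rewrite inE.
  by rewrite -[X in measurable X]setTI; apply: measurable_funPT => //; exact: mA.
have P1 e : Ex P (fun w => (1 - alpha w <= e)%R%:R) <= 1.
  rewrite -[leRHS](Ex_cst P); apply: Ex_le; last by move=> w; rewrite lern1 leq_b1.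
    by apply: itg_indicator_le; exact: measurable_funB.
  exact: itg_cst.
have pw0 (x : R) : 0 < x -> 0 < x `^ (beta + 1) by move=> ?; rewrite powR_gt0.
exists C => e /andP[e0 e1].
case: (ltP e (eta / 2)) => he; last first.
  rewrite (le_trans (P1 e))// -(ler_pdivrMr _ _ (pw0 _ e0)) mul1r le_max; apply/orP; right.
  rewrite lef_pV2 ?posrE ?pw0//; apply: ge0_ler_powR; rewrite ?nnegrE ?(ltW e0) ?(ltW eta2)//; lra.
rewrite PE Ph; last exact: mA.
set D := _ `&` _.
have mD : measurable D by apply: measurableI => //; exact: mA.
have cst0 : 0 <= (psi1 + 1) * e `^ beta by rewrite mulr_ge0 ?powR_ge0//; lra.
have le1 : (\int[lebesgue_measure]_(x in D) (psi x * (1 - x) `^ beta)%:E <=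
   ((psi1 + 1) * e `^ beta)%:E * e%:E)%E.
  apply: (@le_trans _ _ (\int[lebesgue_measure]_(x in D) ((psi1 + 1) * e `^ beta)%:E)%E).
    apply: ge0_le_integral => //.
    - by move=> x [_ x01]; rewrite lee_fin; apply: h0; move: x01; rewrite /= in_itv.
    - apply/measurable_EFinP; apply: (measurable_funS _ _ mh) => //; exact: subIsetr.
    - move=> x [/= xe]; rewrite in_itv/= => /andP[x0 x1]; rewrite lee_fin.
      have px : psi x <= psi1 + 1.
        by apply: Heta => //; rewrite /ball/= ger0_norm ?subr_ge0 ?(ltW x1)//; lra.
      have pb : (1 - x) `^ beta <= e `^ beta.
        by apply: ge0_ler_powR; rewrite ?nnegrE ?subr_ge0 ?(ltW x1) ?(ltW e0)//; lra.
      apply: (le_trans (ler_wpM2r (powR_ge0 _ _) px)).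
      by rewrite ler_wpM2l//; lra.
  rewrite integral_cst// lee_wpmul2l ?lee_fin//.
  apply: (@le_trans _ _ (lebesgue_measure (`[1 - e, 1[%classic : set R))).
    apply: le_measure; [by rewrite inE|by rewrite inE; exact: measurable_itv|].
    move=> x [/= xe]; rewrite !in_itv/= => /andP[_ ->]; rewrite andbT; lra.
  rewrite lebesgue_measure_itv/= lte_fin; case: ifP => _; last by rewrite lee_fin ltW.
  by rewrite -EFinB lee_fin; lra.
have le2 : (psi1 + 1) * e `^ beta * e <= C * e `^ (beta + 1).
  rewrite powRD; last by rewrite (gt_eqF e0) implybT.
  rewrite powRr1 ?(ltW e0)// -mulrA ler_wpM2r ?mulr_ge0 ?powR_ge0 ?(ltW e0)//.
  by rewrite le_max lexx.
apply: (le_trans _ le2); rewrite -lee_fin fineK ?EFinM//.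
rewrite ge0_fin_numE; last first.
  by apply: integral_ge0 => x [_ x01]; rewrite lee_fin; apply: h0; move: x01; rewrite /= in_itv.
by apply: (le_lt_trans le1); rewrite -EFinM ltry.
Qed.

(** The tail exponent [beta + 1] exceeds the order [2] of the moment. *)
Lemma itg_inv1B_square (alpha : {RV P >-> R}) (psi : R -> R) (psi1 beta : R) :
  (forall w, 0 < alpha w < 1) ->
  has_density01 P alpha (fun x => psi x * (1 - x) `^ beta) ->
  psi x @[x --> 1^'-] --> psi1 -> 0 < psi1 -> 1 < beta ->
  itg P (fun w => (1 - alpha w)^-1 ^+ 2).
Proof.
move=> al01 hd cpsi p0 b1.
have [C HC] := density_tail hd cpsi p0 b1.
have h0 : 0 < 2^-1 :> R by rewrite invr_gt0.
apply: (@itg_inv_square (fun w => 1 - alpha w) C (2^-1 `^ (beta + 1))).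
- exact: measurable_funB.
- by move=> w; have := al01 w; lra.
- exact: powR_ge0.
- have -> : 4 * 2^-1 `^ (beta + 1) = 2^-1 `^ (beta - 1) :> R.
    rewrite (_ : beta + 1 = (beta - 1) + 2%:R); last by ring.
    rewrite powRD; last by rewrite (gt_eqF h0) implybT.
    by rewrite powR_mulrn ?(ltW h0)//; field.
  rewrite /powR gt_eqF// expR_lt1; have : ln 2^-1 < 0 :> R.
    by apply: ln_lt0; rewrite h0; lra.
  by move=> l0; rewrite pmulr_rlt0//; lra.
- move=> n; have := HC (2^-1 ^+ n); rewrite exprn_gt0// exprn_ile1 ?(ltW h0)//; last lra.
  move=> /(_ isT); congr (_ <= C * _).
  by rewrite -(powR_mulrn n (ltW h0)) -powRrM mulrC powRrM (powR_mulrn n (powR_ge0 _ _)).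
Qed.

End monotone_limits.


(** * Conditional expectations and conditional means *)
Section conditional_expectation_uniqueness.
Context d (T : measurableType d) (R : realType) (P : probability T R).
Context (alpha : {RV P >-> R}).

Lemma sigma_alpha_measurable (D : set T) : g_sigma_algebra_preimage alpha D -> measurable D.
Proof. by move=> [B mB <-]; exact: measurable_funPT. Qed.

Lemma cond_exp_event (Y f : T -> R) (D : set T) : cond_exp P alpha Y f ->
  g_sigma_algebra_preimage alpha D ->
  Ex P (fun w => \1_D w * Y w) = Ex P (fun w => \1_D w * f w).
Proof.
move=> H [B mB]; rewrite setTI => <-.
have E w : \1_(alpha @^-1` B) w = \1_B (alpha w) :> R.
  by rewrite !indicE; congr (nat_of_bool _)%:R; apply/idP/idP; rewrite !inE.
transitivity (Ex P (fun w => \1_B (alpha w) * Y w)); first by apply: eq_Ex => w; rewrite E.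
by rewrite (cond_expE H mB); apply: eq_Ex => w; rewrite E.
Qed.

(** [f] is integrable because its truncations integrate to at most the mean of [Y];
the events [f < g] and [g < f] are generated by [alpha], and on them the two
versions have the same integral. *)
Lemma cond_exp_unique (Y f g : T -> R) : measurable_fun [set: T] f ->
  cond_exp P alpha Y f -> cond_exp P alpha Y g ->
  itg P Y -> (forall w, 0 <= Y w) -> itg P g -> {ae P, forall w, f w = g w}.
Proof.
move=> mf Hf Hg iY Y0 ig.
pose Ta := g_sigma_algebra_preimageType alpha.
have mfa : measurable_fun [set: Ta] f by move=> _ U mU; rewrite setTI; exact: (Hf.1 U mU).
have mga : measurable_fun [set: Ta] g by move=> _ U mU; rewrite setTI; exact: (Hg.1 U mU).
have evt (b : Ta -> bool) : measurable_fun [set: Ta] b ->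
    g_sigma_algebra_preimage alpha [set w | b w].
  move=> mb; have mt : measurable [set true] by [].
  by have := mb measurableT _ mt; rewrite setTI.
have i1 (D : set T) (h : T -> R) : g_sigma_algebra_preimage alpha D -> itg P h ->
    itg P (fun w => \1_D w * h w).
  move=> /sigma_alpha_measurable mD ih.
  apply: (itg_le _ (itg_norm ih)).
    by apply: measurable_funM; [exact: measurable_indic|exact: itg_meas ih].
  by move=> w; rewrite normrM ler_piMl// indicE ger0_norm// lern1 leq_b1.
(* [F n] is [`|f|] cut off above [n], split by the sign of [f]. *)
have if_ : itg P f.
  suff iaf : itg P (fun w => `|f w|) by exact: (itg_le mf iaf).
  pose Dp n : set T := [set w | 0 <= f w <= n%:R].
  pose Dm n : set T := [set w | - n%:R <= f w < 0].
  have sp n : g_sigma_algebra_preimage alpha (Dp n).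
    apply: (evt (fun w => 0 <= f w <= n%:R)); apply: measurable_and; exact: measurable_fun_ler.
  have sm n : g_sigma_algebra_preimage alpha (Dm n).
    apply: (evt (fun w => - n%:R <= f w < 0)); apply: measurable_and.
      exact: measurable_fun_ler.
    exact: measurable_fun_ltr.
  pose F n w := \1_(Dp n) w * f w - \1_(Dm n) w * f w.
  have ibnd n (D : set T) : g_sigma_algebra_preimage alpha D ->
      (forall w, D w -> `|f w| <= n%:R) -> itg P (fun w => \1_D w * f w).
    move=> sD Dn; apply: (@itg_bounded _ _ _ _ _ n%:R).
      by apply: measurable_funM => //; apply: measurable_indic; exact: sigma_alpha_measurable.
    move=> w; rewrite indicE; case: (boolP (w \in D)) => [|_]; last by rewrite mul0r normr0.
    by rewrite inE mul1r => /Dn.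
  have ip n : itg P (fun w => \1_(Dp n) w * f w).
    by apply: (ibnd n) => // w /andP[h1 h2]; rewrite ger0_norm.
  have im n : itg P (fun w => \1_(Dm n) w * f w).
    by apply: (ibnd n) => // w /andP[h1 h2]; rewrite ltr0_norm// lerNl.
  have FE n w : F n w = if `|f w| <= n%:R then `|f w| else 0.
    rewrite /F !indicE.
    have -> : (w \in Dp n) = (0 <= f w <= n%:R) by apply/idP/idP; rewrite inE.
    have -> : (w \in Dm n) = (- n%:R <= f w < 0) by apply/idP/idP; rewrite inE.
    case: (leP 0 (f w)) => f0; rewrite /= ?andbT ?andbF.
      by rewrite (ger0_norm f0) mul0r subr0; case: ifP => _; rewrite ?mul1r ?mul0r.
    by rewrite (ltr0_norm f0) mul0r sub0r lerNl; case: ifP => _; rewrite ?mul1r ?mul0r ?oppr0.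
  apply: (@itg_monotone _ _ _ _ F _ (Ex P Y)).
  - by move=> n; apply: itgB.
  - by move=> n w; rewrite FE; case: ifP.
  - move=> w m n mn; rewrite !FE; case: ifP => h1; case: ifP => h2//.
    by move: h2; rewrite (le_trans h1)// ler_nat.
  - move=> w; apply: cvg_near_cst; near=> n; rewrite FE ifT//.
    by near: n; exact: nbhs_infty_ger.
  - exact: measurableT_comp.
  - move=> n; rewrite ExB// -!(cond_exp_event Hf)//.
    have m0 : 0 <= Ex P (fun w => \1_(Dm n) w * Y w).
      by apply: Ex_ge0 => w; rewrite mulr_ge0.
    have p1 : Ex P (fun w => \1_(Dp n) w * Y w) <= Ex P Y.
      apply: Ex_le => //; first exact: i1.
      by move=> w; rewrite ler_piMl// indicE lern1 leq_b1.
    lra.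
pose D1 : set T := [set w | f w < g w]. pose D2 : set T := [set w | g w < f w].
have s1 : g_sigma_algebra_preimage alpha D1.
  by apply: (evt (fun w => f w < g w)); exact: measurable_fun_ltr.
have s2 : g_sigma_algebra_preimage alpha D2.
  by apply: (evt (fun w => g w < f w)); exact: measurable_fun_ltr.
have E0 : Ex P (fun w => `|f w - g w|) = 0.
  rewrite (@eq_Ex _ _ _ _ _ (fun w => (\1_D1 w * g w - \1_D1 w * f w) + (\1_D2 w * f w - \1_D2 w * g w))).
    rewrite ExD; last 2 first.
      by apply: itgB; exact: i1.
      by apply: itgB; exact: i1.
    rewrite !ExB; try exact: i1.
    by rewrite -!(cond_exp_event Hf)// -!(cond_exp_event Hg)// !subrr addr0.
  move=> w; rewrite !indicE.
  have -> : (w \in D1) = (f w < g w) by apply/idP/idP; rewrite inE.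
  have -> : (w \in D2) = (g w < f w) by apply/idP/idP; rewrite inE.
  case: (ltgtP (f w) (g w)) => h; rewrite ?mul1r ?mul0r ?subr0 ?add0r ?addr0.
  - by rewrite distrC gtr0_norm// subr_gt0.
  - by rewrite gtr0_norm// subr_gt0.
  - by rewrite h subrr normr0.
have mfg : measurable_fun [set: T] (fun w => (f w - g w)%:E).
  by apply/measurable_EFinP; apply: measurable_funB => //; exact: itg_meas ig.
have /(ae_eq_integral_abs P measurableT mfg) : (\int[P]_w `|(f w - g w)%:E| = 0)%E.
  by rewrite -[RHS]/(0%:E) -E0 -Ex_fin; [by []|apply: itg_norm; exact: itgB].
apply: filterS => w /(_ I) /= [] /eqP; rewrite subr_eq0 => /eqP.
by [].
Unshelve. all: by end_near.
Qed.

End conditional_expectation_uniqueness.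

Section equal_laws.
Context (R : realType) d' (T' : measurableType d').
Context d1 (T1 : measurableType d1) (P1 : probability T1 R).
Context d2 (T2 : measurableType d2) (P2 : probability T2 R).
Context (Z1 : T1 -> T') (Z2 : T2 -> T').
Hypothesis mZ1 : measurable_fun [set: T1] Z1.
Hypothesis mZ2 : measurable_fun [set: T2] Z2.
Hypothesis same_law : forall A, measurable A -> P1 (Z1 @^-1` A) = P2 (Z2 @^-1` A).
Local Notation C := R[i].

(** Equality of laws on events extends to bounded functions. *)
Lemma law_cEx (g : T' -> C) M : cmf g -> (forall x, normc (g x) <= M) ->
  cEx P1 (g \o Z1) = cEx P2 (g \o Z2).
Proof.
move=> mg gM.
have := @complex_law_transfer _ _ _ _ _ P1 _ _ P2 Z1 Z2 (cst 1) (cst 1) mZ1 mZ2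
  (citg_cst P1 1) (citg_cst P2 1) _ g M mg gM.
move=> h; transitivity (cEx P1 (fun w => g (Z1 w) * cst 1 w)).
  by apply: eq_cEx => w; rewrite mulr1.
rewrite h; first by apply: eq_cEx => w; rewrite mulr1.
move=> A mA.
have E d (T : measurableType d) (P : probability T R) (Z : T -> T') :
    measurable_fun [set: T] Z ->
    cEx P (fun w => (\1_A (Z w))%:C * cst 1 w) = (fine (P (Z @^-1` A)))%:C.
  move=> mZ; have mD : measurable (Z @^-1` A) by rewrite -[X in measurable X]setTI; exact: mZ.
  rewrite -(Ex_prob P mD) -cEx_real; apply: eq_cEx => w; rewrite mulr1 !indicE.
  by congr ((nat_of_bool _)%:R)%:C; apply/idP/idP; rewrite !inE.
by rewrite !E// same_law.
Qed.

Lemma law_Ex (g : T' -> R) M : measurable_fun [set: T'] g -> (forall x, `|g x| <= M) ->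
  Ex P1 (g \o Z1) = Ex P2 (g \o Z2).
Proof.
move=> mg gM.
have := @law_cEx (fun x => (g x)%:C) M (cmf_real mg).
move=> /(_ _)/wrap[]; first by move=> x; rewrite normc_real.
by rewrite [cEx P1 _]cEx_real [cEx P2 _]cEx_real => -[].
Qed.

Lemma law_itg (g : T' -> R) : measurable_fun [set: T'] g -> (forall x, 0 <= g x) ->
  itg P2 (g \o Z2) -> itg P1 (g \o Z1).
Proof.
move=> mg g0 i2.
pose F n x := Num.min (g x) n%:R.
have F0 n x : 0 <= F n x by rewrite le_min g0 ler0n.
have Fn n x : `|F n x| <= n%:R by rewrite ger0_norm// ge_min lexx orbT.
have mF n : measurable_fun [set: T'] (F n) by apply: measurable_minr => //; exact: measurable_cst.
have mFZ n d (T : measurableType d) (Z : T -> T') : measurable_fun [set: T] Z ->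
  measurable_fun [set: T] (F n \o Z) by move=> mZ; exact: measurableT_comp.
apply: (@itg_monotone _ _ _ _ (fun n => F n \o Z1) _ (Ex P2 (g \o Z2))).
- by move=> n; apply: (@itg_bounded _ _ _ _ _ n%:R); [exact: mFZ|move=> w; exact: Fn].
- by move=> n w; exact: F0.
- move=> w m n mn; rewrite /= /F le_min !ge_min lexx/=.
  by rewrite ler_nat mn orbT.
- move=> w; apply: cvg_near_cst; near=> n; rewrite /= /F min_l//.
  by near: n; exact: nbhs_infty_ger.
- exact: measurableT_comp.
- move=> n; rewrite (law_Ex (mF n) (Fn n)); apply: Ex_le => //.
    by apply: (@itg_bounded _ _ _ _ _ n%:R); [exact: mFZ|move=> w; exact: Fn].
  by move=> w /=; rewrite /F ge_min lexx.
Unshelve. all: by end_near.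
Qed.

End equal_laws.

Section conditional_mean.
Context d (T : measurableType d) (R : realType) (P : probability T R).
Context (alpha : {RV P >-> R}).

Lemma cond_expP (Y f : T -> R) : itg P Y -> itg P f ->
  (forall U : set R, measurable U -> g_sigma_algebra_preimage alpha (f @^-1` U)) ->
  (forall B, measurable B -> Ex P (fun w => \1_B (alpha w) * Y w) = Ex P (fun w => \1_B (alpha w) * f w)) ->
  cond_exp P alpha Y f.
Proof.
move=> iY if_ mf H; split => // B mB.
have E (g : T -> R) : itg P g -> (\int[P]_(w in alpha @^-1` B) (g w)%:E =
    (Ex P (fun w => (\1_B (alpha w) * g w)%R))%:E)%E.
  move=> ig; rewrite -Ex_fin; last first.
    by apply: (itgMb (measurable_funPT alpha) _ ig); exact: bmf_indic.
  rewrite integral_mkcond/=; apply: eq_integral => w _.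
  rewrite patchE indicE.
  rewrite (_ : (w \in alpha @^-1` B) = (alpha w \in B)); last by apply/idP/idP; rewrite !inE.
  by case: ifPn => _; rewrite ?mul1r ?mul0r.
by rewrite !E// H.
Qed.

(** A conditionally Poisson variable, given through its conditional generating
function, has its rate as conditional mean: differentiate at [z = 1]. *)
Lemma conditional_poisson_mean (X : T -> nat) (rate : R -> R) :
  measurable_fun [set: T] X -> measurable_fun [set: R] rate -> (forall a, 0 <= rate a) ->
  itg P (rate \o alpha) ->
  (forall B z, measurable B -> 0 <= z <= 1 ->
     Ex P (fun w => \1_B (alpha w) * z ^+ X w) =
     Ex P (fun w => \1_B (alpha w) * expR (rate (alpha w) * (z - 1)))) ->
  itg P (fun w => (X w)%:R) /\ cond_exp P alpha (fun w => (X w)%:R) (rate \o alpha).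
Proof.
move=> mX mr r0 ir HZ.
pose z n : R := 1 - n.+1%:R^-1.
have n0 n : 0 < n.+1%:R :> R by rewrite ltr0n.
have z01 n : 0 <= z n <= 1.
  by rewrite /z subr_ge0 invf_le1// ler1n gerBl invr_ge0 ler0n.
have z1 n : z n - 1 = - n.+1%:R^-1 by rewrite /z; ring.
(* Difference quotients at 1 of the generating function and of its mean. *)
pose G n w : R := \sum_(i < X w) z n ^+ i.
pose H n w : R := n.+1%:R * (1 - expR (rate (alpha w) * (z n - 1))).
have GE n w : G n w = n.+1%:R * (1 - z n ^+ X w).
  rewrite /G -[1 - _ ^+ _]opprB subrX1 z1; field.
  by rewrite addrC natr1 pnatr_eq0.
have mz n : measurable_fun [set: T] (fun w => z n ^+ X w).
  by apply: (measurableT_comp (f := fun k : nat => z n ^+ k)).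
have mH n : measurable_fun [set: T] (H n).
  apply: measurable_funM => //; apply: measurable_funB => //.
  apply: (measurableT_comp (@measurable_expR R)); apply: measurable_funM => //.
  by apply: (measurableT_comp mr).
have mG n : measurable_fun [set: T] (G n).
  have -> : G n = fun w => n.+1%:R * (1 - z n ^+ X w) by apply/funext => w; exact: GE.
  by apply: measurable_funM => //; exact: measurable_funB.
have zX n w : 0 <= z n ^+ X w <= 1.
  by have /andP[h0 h1] := z01 n; rewrite exprn_ge0// exprn_ile1.
have rz n w : rate (alpha w) * (z n - 1) <= 0.
  by rewrite z1 mulrN oppr_le0 mulr_ge0// invr_ge0 ltW.
have H0 n w : 0 <= H n w <= rate (alpha w).
  have := expR_sub1_le (rz n w); rewrite ler0_norm; last by rewrite subr_le0 expR_le1.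
  rewrite opprB => h; apply/andP; split.
    by rewrite mulr_ge0 ?ler0n// subr_ge0 expR_le1.
  rewrite /H mulrC -ler_pdivlMr//; apply: (le_trans h).
  by rewrite z1 mulrN opprK.
have iG n : itg P (G n).
  apply: (@itg_bounded _ _ _ _ _ n.+1%:R) => // w; rewrite GE.
  have /andP[h0 h1] := zX n w.
  by rewrite ger0_norm ?mulr_ge0 ?subr_ge0 ?(ltW (n0 n))// ler_piMr ?(ltW (n0 n))//; lra.
have iH n : itg P (H n).
  apply: (itg_le (mH n) ir) => w; have /andP[h0 h1] := H0 n w.
  by rewrite ger0_norm.
have i1 B (h : T -> R) : measurable B -> itg P h -> itg P (fun w => \1_B (alpha w) * h w).
  by move=> mB ih; apply: (itgMb (measurable_funPT alpha) _ ih); exact: bmf_indic.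
have EGH B n : measurable B -> Ex P (fun w => \1_B (alpha w) * G n w) = Ex P (fun w => \1_B (alpha w) * H n w).
  move=> mB.
  have ib (h : T -> R) : measurable_fun [set: T] h -> (forall w, 0 <= h w <= 1) ->
      itg P (fun w => \1_B (alpha w) * h w).
    move=> mh h01; apply: i1 => //; apply: (@itg_bounded _ _ _ _ _ 1) => // w.
    by have /andP[h0 h1] := h01 w; rewrite ger0_norm.
  have S (h : T -> R) : measurable_fun [set: T] h -> (forall w, 0 <= h w <= 1) ->
     Ex P (fun w => \1_B (alpha w) * (n.+1%:R * (1 - h w))) =
     n.+1%:R * (Ex P (fun w => \1_B (alpha w) * cst 1 w) - Ex P (fun w => \1_B (alpha w) * h w)).
    move=> mh h01; rewrite -ExB ?ib//; last by move=> w; rewrite ler01 lexx.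
    rewrite -ExZ; last by apply: itgB; apply: ib => //; move=> w; rewrite ler01 lexx.
    by apply: eq_Ex => w; rewrite /cst; ring.
  under eq_Ex do rewrite GE.
  rewrite (S (fun w => z n ^+ X w))// (S (fun w => expR (rate (alpha w) * (z n - 1)))).
  - by rewrite HZ.
  - apply: (measurableT_comp (@measurable_expR R)); apply: measurable_funM => //.
    by apply: (measurableT_comp mr).
  - by move=> w; rewrite expR_ge0 expR_le1 rz.
have cz : z n @[n --> \oo] --> (1 : R).
  rewrite -[X in _ --> X]subr0; apply: cvgB; first exact: cvg_cst.
  exact: (@cvg_harmonic R).
have cG w : G n w @[n --> \oo] --> ((X w)%:R : R).
  have -> : (X w)%:R = \sum_(i < X w) (1 : R) by rewrite sumr_const card_ord.
  apply: cvg_sum_seq => i; rewrite -[X in _ --> X](expr1n _ i).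
  by apply: (@cvg_comp _ _ _ z (fun x => x ^+ i) _ _ _ cz); exact: exprn_continuous.
have cH w : H n w @[n --> \oo] --> rate (alpha w).
  apply: (@cvg_dist0 _ _ (fun n => rate (alpha w) ^+ 2 * n.+1%:R^-1)).
    apply: nearW => n; have := expR_sub_quad (rz n w); rewrite z1 => h.
    rewrite /H z1.
    have -> : n.+1%:R * (1 - expR (rate (alpha w) * - n.+1%:R^-1)) - rate (alpha w) =
      - (n.+1%:R * (expR (rate (alpha w) * - n.+1%:R^-1) - 1 - rate (alpha w) * - n.+1%:R^-1)).
      by field; rewrite addrC natr1 pnatr_eq0.
    rewrite normrN normrM ger0_norm ?ler0n//.
    apply: (le_trans (ler_wpM2l _ h)); first by rewrite ler0n.
    rewrite le_eqVlt; apply/orP; left; apply/eqP; field.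
    by rewrite addrC natr1 pnatr_eq0.
  rewrite -[X in _ --> X](mulr0 (rate (alpha w) ^+ 2)); apply: cvgM; first exact: cvg_cst.
  exact: (@cvg_harmonic R).
have mXR : measurable_fun [set: T] (fun w => (X w)%:R : R).
  by apply: (measurableT_comp (f := fun n : nat => n%:R : R)).
have G0 n w : 0 <= G n w.
  by apply: sumr_ge0 => i _; rewrite exprn_ge0//; have /andP[] := z01 n.
have iX : itg P (fun w => (X w)%:R).
  apply: (@itg_monotone _ _ _ _ G _ (Ex P (rate \o alpha))) => //.
  - move=> w m n mn; apply: ler_sum => i _.
    have /andP[h0 _] := z01 m; have /andP[h1 _] := z01 n.
    rewrite lerXn2r ?nnegrE// /z lerD2l lerN2 lef_pV2 ?posrE// ler_nat//.
  - move=> n; have := EGH setT n measurableT.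
    have E h : Ex P (fun w => \1_setT (alpha w) * h w) = Ex P h.
      by apply: eq_Ex => w; rewrite indicT mul1r.
    rewrite !E => ->; apply: Ex_le => // w.
    by have /andP[] := H0 n w.
split=> //; apply: cond_expP => //.
  by move=> U mU; exact: (measurable_alpha_pre alpha mr).
move=> B mB.
have c1 : Ex P (fun w => \1_B (alpha w) * G n w) @[n --> \oo] --> Ex P (fun w => \1_B (alpha w) * (X w)%:R).
  apply: (Ex_dct (g := fun w => (X w)%:R)) => //.
  - by move=> n; apply: itg_meas; exact: i1.
  - by apply: itg_meas; exact: i1.
  - move=> n w; rewrite ger0_norm; last exact: mulr_ge0.
    apply: (@le_trans _ _ (G n w)); first by rewrite ler_piMl// indicE lern1 leq_b1.
    have -> : (X w)%:R = \sum_(i < X w) (1 : R) by rewrite sumr_const card_ord.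
    by apply: ler_sum => i _; have /andP[h0 h1] := z01 n; rewrite exprn_ile1.
  - by move=> w; apply: cvgM => //; exact: cvg_cst.
have c2 : Ex P (fun w => \1_B (alpha w) * H n w) @[n --> \oo] --> Ex P (fun w => \1_B (alpha w) * rate (alpha w)).
  apply: (Ex_dct (g := rate \o alpha)) => //.
  - by move=> n; apply: itg_meas; exact: i1.
  - by apply: itg_meas; exact: i1.
  - move=> n w; have /andP[h0 h1] := H0 n w; rewrite ger0_norm; last exact: mulr_ge0.
    by rewrite (le_trans _ h1)// ler_piMl// indicE lern1 leq_b1.
  - by move=> w; apply: cvgM => //; exact: cvg_cst.
have E : (fun n => Ex P (fun w => \1_B (alpha w) * G n w)) =
    (fun n => Ex P (fun w => \1_B (alpha w) * H n w)) by apply/funext => n; exact: EGH.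
by rewrite E in c1; apply: (cvg_unique _ c1 c2).
Qed.

End conditional_mean.


(** * Independent copies of the chain *)
Section path_space_measurability.
Context {R : realType}.

Lemma measurable_coordinate k : measurable_fun [set: path_space] (fun x : path_space => (x : nat -> nat) k).
Proof.
move=> _ U _; rewrite setTI; apply: sub_sigma_algebra.
by exists k, U.
Qed.

Lemma measurable_alpha_path d (T : measurableType d) (alpha : T -> R) (X : nat -> T -> nat) :
  measurable_fun [set: T] alpha -> (forall k, measurable_fun [set: T] (X k)) ->
  measurable_fun [set: T] (alpha_path alpha X).
Proof.
move=> mal mX; apply: measurable_fun_pair => //.
apply: (@measurability _ _ T path_space _ (fun w k => X k w) path_cylinders) => //.
move=> _ [_ [k [U ->]] <-].
have -> : [set: T] `&` (fun w k => X k w) @^-1` [set x | U (x k)] = X k @^-1` U by rewrite setTI.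
by rewrite -[X in measurable X]setTI; exact: mX.
Qed.

End path_space_measurability.

Section copies_of_the_process.
Context (R : realType) d0 (T0 : measurableType d0) (P0 : probability T0 R).
Context (lambda : R) (alpha : {RV P0 >-> R}).
Context (xi : nat -> nat -> {RV P0 >-> nat}) (eps : nat -> {RV P0 >-> nat}).
Context (X : nat -> {RV P0 >-> nat}).
Context d (T : measurableType d) (P : probability T R).
Context (alpha_ : nat -> {RV P >-> R}) (X_ : nat -> nat -> {RV P >-> nat}).
Context (m_ : nat -> nat -> {RV P >-> R}).
Hypothesis lambda0 : 0 < lambda.
Hypothesis HX : randomized_INAR1 lambda alpha xi eps X.
Hypothesis copies : independent_copies alpha X alpha_ X_.
Hypothesis condm : forall j k, cond_exp P (alpha_ j) (fun w => (X_ j k w)%:R) (m_ j k).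
Hypothesis inv2 : itg P0 (fun w => (1 - alpha w)^-1 ^+ 2).
Local Notation C := R[i].

Let al01 w : 0 < alpha w < 1. Proof. exact: (inar_alpha HX). Qed.

(** The conditional mean as a function of [alpha]; the truncation accounts for
the copies of [alpha], which lie in [(0, 1)] only almost surely. *)
Definition rate (a : R) : R := if 0 < a < 1 then lambda / (1 - a) else 0.

Lemma measurable_rate : measurable_fun [set: R] rate.
Proof.
apply: measurable_fun_ifT => //.
  by apply: measurable_and; exact: measurable_fun_ltr.
by apply: measurable_funM => //; exact: measurable_1B.
Qed.

Lemma rate_ge0 a : 0 <= rate a.
Proof. by rewrite /rate; case: ifP => // /andP[_ a1]; rewrite divr_ge0 ?ltW// subr_gt0. Qed.

Lemma rateE w : rate (alpha w) = lambda / (1 - alpha w).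
Proof. by rewrite /rate al01. Qed.

Lemma itg_rate : itg P0 (rate \o alpha).
Proof.
apply: (itg_le _ (itgZ lambda inv2)).
  by apply: (measurableT_comp measurable_rate).
move=> w; rewrite ger0_norm ?rate_ge0//= rateE ler_wpM2l ?(ltW lambda0)//.
have /andP[a0 a1] := al01 w.
have b0 : 0 < 1 - alpha w by rewrite subr_gt0.
rewrite expr2 ler_peMr ?invr_ge0 ?(ltW b0)// invf_ge1//.
by lra.
Qed.

(** With vanishing phases: given [alpha], every value of the chain is Poisson. *)
Lemma poisson_gf_alpha k (B : set R) (z : R) : measurable B -> 0 <= z <= 1 ->
  Ex P0 (fun w => \1_B (alpha w) * z ^+ X k w) =
  Ex P0 (fun w => \1_B (alpha w) * expR (rate (alpha w) * (z - 1))).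
Proof.
move=> mB /andP[z0 z1].
have psi0 K a (v : C) : psi (fun=> 0) K a v = 0.
  by elim: K v => [//|K IH] v /=; rewrite IH cis0 subrr mul0r addr0.
have okB : ok (fun a => (\1_B a)%:C : C).
  split; first by apply: cmf_real; exact: measurable_indic.
  by exists 1 => a _; rewrite normc_real indicE ger0_norm// lern1 leq_b1.
have okz : ok (fun=> z%:C : C) by exact: ok_cst.
have := path_gf lambda0 HX (fun=> 0) k okz _ okB.
move=> /(_ _)/wrap[]; first by move=> a _; rewrite normc_real ger0_norm.
have -> : cEx P0 (fun w => (\1_B (alpha w))%:C * pathphase X (fun=> 0) k w * z%:C ^+ X k w) =
   (Ex P0 (fun w => \1_B (alpha w) * z ^+ X k w))%:C.
  rewrite -cEx_real; apply: eq_cEx => w; rewrite rmorphM rmorphXn.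
  by rewrite /pathphase big1 ?mulr1// => i _; rewrite mul0r cis0.
have -> : cEx P0 (fun w => (\1_B (alpha w))%:C * cexp ((lambda / (1 - alpha w))%:C *
      (z%:C - 1 + psi (fun=> 0) k (alpha w) (z%:C - 1)))) =
   (Ex P0 (fun w => \1_B (alpha w) * expR (rate (alpha w) * (z - 1))))%:C.
  rewrite -cEx_real; apply: eq_cEx => w; rewrite psi0 addr0 rateE.
  by rewrite -(rmorph1 (real_complex R)) -rmorphB -rmorphM cexp_real rmorphM.
by case.
Qed.

Let Z0 := alpha_path alpha X.
Let Z j := alpha_path (alpha_ j) (X_ j).

Let mZ0 : measurable_fun [set: T0] Z0.
Proof. by apply: measurable_alpha_path. Qed.

Let mZ j : measurable_fun [set: T] (Z j).
Proof. by apply: measurable_alpha_path. Qed.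

Let mfst (g : R -> R) : measurable_fun [set: R] g ->
  measurable_fun [set: (R * path_space)%type] (fun p : R * path_space => g p.1).
Proof. by move=> mg; apply: (measurableT_comp mg); exact: measurable_fst. Qed.

Let mcoord k (g : nat -> R) :
  measurable_fun [set: (R * path_space)%type] (fun p : R * path_space => g ((p.2 : nat -> nat) k)).
Proof.
have mg : measurable_fun [set: nat] g by [].
apply: (measurableT_comp mg); apply: (measurableT_comp (measurable_coordinate k)).
exact: measurable_snd.
Qed.

Lemma copies_itg_rate j : itg P (rate \o alpha_ j).
Proof.
apply: (law_itg (Z1 := Z j) (Z2 := Z0) (P2 := P0) _ _ (copies.1 j) (g := rate \o fst)) => //.
- by apply: mfst; exact: measurable_rate.
- by move=> x; exact: rate_ge0.
- exact: itg_rate.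
Qed.

(** The conditional generating function depends on the joint law only, hence so
does the conditional mean. *)
Lemma copies_cond_mean j k : {ae P, forall w, m_ j k w = rate (alpha_ j w)}.
Proof.
have [iX cX] : itg P (fun w => (X_ j k w)%:R) /\
    cond_exp P (alpha_ j) (fun w => (X_ j k w)%:R) (rate \o alpha_ j).
  apply: conditional_poisson_mean => //.
  - exact: measurable_rate.
  - exact: rate_ge0.
  - exact: copies_itg_rate.
  - move=> B z mB z01; have /andP[z0 z1] := z01.
    have mind : measurable_fun [set: R] (\1_B : R -> R) by exact: measurable_indic.
    have b1 (x y : R) : 0 <= x <= 1 -> 0 <= y <= 1 -> `|x * y| <= 1.
      by move=> /andP[x0 x1] /andP[y0 y1]; rewrite ger0_norm ?mulr_ge0// mulr_ile1.
    have ind01 a : 0 <= (\1_B a : R) <= 1 by rewrite indicE ler0n lern1 leq_b1.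
    transitivity (Ex P0 (fun w => \1_B (alpha w) * z ^+ X k w)).
      apply: (law_Ex (mZ j) mZ0 (copies.1 j)
        (g := fun p => \1_B p.1 * z ^+ (p.2 : nat -> nat) k) (M := 1)).
        by apply: measurable_funM; [exact: mfst|exact: (mcoord k (fun n => z ^+ n))].
      by move=> p; apply: b1 => //; rewrite exprn_ge0// exprn_ile1.
    rewrite poisson_gf_alpha//; apply/esym.
    apply: (law_Ex (mZ j) mZ0 (copies.1 j)
        (g := fun p => \1_B p.1 * expR (rate p.1 * (z - 1))) (M := 1)).
      apply: (mfst (g := fun a => \1_B a * expR (rate a * (z - 1)))).
      apply: measurable_funM => //; apply: (measurableT_comp (@measurable_expR R)).
      by apply: measurable_funM => //; exact: measurable_rate.
    move=> p; apply: b1 => //; rewrite expR_ge0 expR_le1 mulr_ge0_le0 ?rate_ge0//.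
    by rewrite subr_le0.
apply: (cond_exp_unique _ (condm j k) cX iX) => //.
exact: copies_itg_rate.
Qed.

Let centred (th : nat -> R) K (p : R * path_space) : R :=
  \sum_(k < K) th k * (((p.2 : nat -> nat) k)%:R - rate p.1).

Let mcentred th K : measurable_fun [set: (R * path_space)%type] (centred th K).
Proof.
apply: measurable_sum => k; apply: measurable_funM => //; apply: measurable_funB.
  exact: (mcoord k (fun n => n%:R)).
by apply: mfst; exact: measurable_rate.
Qed.

(** Independence and equality in law reduce the aggregated process to one copy of
the randomized chain. *)
Lemma copies_charf (th : nat -> R) K N :
  cEx P (fun w => cis (\sum_(j < N) \sum_(k < K) th k * ((X_ j k w)%:R - m_ j k w))) =
  cEx P0 (fun w => cis (\sum_(k < K) th k * ((X k w)%:R - lambda / (1 - alpha w)))) ^+ N.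
Proof.
have mcis : cmf (fun p => cis (centred th K p)) by apply: cmf_cis; exact: mcentred.
transitivity (cEx P (fun w => \prod_(j <- index_iota 0 N) cis (centred th K (Z j w)))).
  apply: cEx_ae.
  - apply: cmf_cis; apply: measurable_sum => j; apply: measurable_sum => k.
    apply: measurable_funM => //; apply: measurable_funB => //.
    by apply: (measurableT_comp (f := fun n : nat => n%:R : R)).
  - by apply: cmf_prod => j; exact: (cmf_comp (mZ j) mcis).
  have : {ae P, forall w, forall j k, m_ j k w = rate (alpha_ j w)}.
    by apply: ae_foralln => j; apply: ae_foralln => k; exact: copies_cond_mean.
  apply: filterS => w mw.
  rewrite big_mkord -cis_sum; congr cis; apply: eq_bigr => j _.
  by apply: eq_bigr => k _; rewrite mw.
rewrite (independent_cEx_prod (f := fun=> fun p => cis (centred th K p)) mZ copies.2)//; last 2 first.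
- by move=> _ p; rewrite normc_cis.
- exact: iota_uniq.
have E j : cEx P (fun w => cis (centred th K (Z j w))) =
    cEx P0 (fun w => cis (\sum_(k < K) th k * ((X k w)%:R - lambda / (1 - alpha w)))).
  transitivity (cEx P0 (fun w => cis (centred th K (Z0 w)))).
    apply: (law_cEx (mZ j) mZ0 (copies.1 j) (M := 1) mcis) => p.
    by rewrite normc_cis.
  by apply: eq_cEx => w; congr cis; apply: eq_bigr => k _; rewrite rateE.
under eq_bigr do rewrite E.
by rewrite prodr_const_nat subn0.
Qed.

End copies_of_the_process.


(** * Powers of the mixed characteristic function *)
Section inverse_square_roots.
Context {R : realType}.

Definition sqrtV (n : nat) : R := (Num.sqrt n%:R)^-1.

Lemma sqrtV_ge0 n : 0 <= sqrtV n.
Proof. by rewrite invr_ge0 sqrtr_ge0. Qed.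

Lemma sqrtV2 n : sqrtV n ^+ 2 = n%:R^-1.
Proof. by rewrite /sqrtV exprVn sqr_sqrtr. Qed.

Lemma sqrtVM n N : (Num.sqrt (n * N)%N%:R)^-1 = sqrtV N * sqrtV n.
Proof. by rewrite natrM sqrtrM// invfM mulrC. Qed.

Lemma sqrtV_sqr n : (0 < n)%N -> n%:R * sqrtV n ^+ 2 = 1.
Proof. by move=> n0; rewrite sqrtV2 mulfV// pnatr_eq0 -lt0n. Qed.

Lemma natV_le1 n : n%:R * sqrtV n ^+ 2 <= 1.
Proof. by case: n => [|n]; rewrite ?mul0r ?ler01// sqrtV_sqr. Qed.

Lemma cvg_sqrtV : sqrtV n @[n --> \oo] --> (0 : R).
Proof.
have -> : sqrtV = fun n => Num.sqrt (n%:R^-1) by apply/funext => n; rewrite /sqrtV sqrtrV.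
rewrite -[X in _ --> X](@sqrtr0 R).
by apply: (@cvg_comp _ _ _ (fun n : nat => n%:R^-1 : R) Num.sqrt _ _ _ cvg_invn0); exact: sqrt_continuous.
Qed.

End inverse_square_roots.

Section quadratic_form_sign.
Context {R : realType} (th : nat -> R) (a : R).
Hypothesis a01 : 0 < a < 1.

(** Completing the square at each step. *)
Lemma quad_square K h : quad th K.+1 a h + a ^+ 2 * h ^+ 2 =
  (1 - a ^+ 2) * (th K + a * h) ^+ 2 +
  (quad th K a (th K + a * h) + a ^+ 2 * (th K + a * h) ^+ 2).
Proof. by rewrite /=; ring. Qed.

Let a2 : 0 < 1 - a ^+ 2.
Proof. by have /andP[a0 a1] := a01; nra. Qed.

Lemma quad_shift_ge0 K h : 0 <= quad th K a h + a ^+ 2 * h ^+ 2.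
Proof.
elim: K h => [|K IH] h; first by rewrite add0r mulr_ge0// sqr_ge0.
by rewrite quad_square addr_ge0// mulr_ge0 ?sqr_ge0// ltW.
Qed.

Lemma quad_ge0 K : 0 <= quad th K a 0.
Proof. by have := quad_shift_ge0 K 0; rewrite expr0n mulr0 addr0. Qed.

(** The squares in [quad_square] vanish one after the other. *)
Lemma quad_eq0 K : quad th K a 0 = 0 -> forall k, (k < K)%N -> th k = 0.
Proof.
elim: K => // K IH q0.
have := quad_square K 0; rewrite q0 expr0n !mulr0 !addr0 => /esym E.
have h1 : 0 <= (1 - a ^+ 2) * th K ^+ 2 by rewrite mulr_ge0 ?sqr_ge0// ltW.
have h2 := quad_shift_ge0 K (th K).
have : (1 - a ^+ 2) * th K ^+ 2 = 0 by lra.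
move=> /eqP; rewrite mulf_eq0 gt_eqF//= expf_eq0/= => /eqP tK.
move=> k; rewrite ltnS leq_eqVlt => /orP[/eqP ->//|]; apply: IH.
by move: E; rewrite tK expr0n !mulr0 addr0 add0r.
Qed.

End quadratic_form_sign.

Section mean_of_powers.
Context d (T : measurableType d) (R : realType) (P : probability T R).
Local Notation C := R[i].

(** The exponential is Lipschitz on the left half plane. *)
Lemma normc_cexpB (z w : C) : Re z <= 0 -> Re w <= 0 ->
  normc (cexp z - cexp w) <= 2 * normc (z - w).
Proof.
wlog zw : z w / Re z <= Re w.
  move=> h z0 w0; case/orP: (le_total (Re z) (Re w)) => zw; first exact: h.
  by rewrite normcB [normc (z - w)]normcB; exact: h.
move=> z0 w0.
have -> : cexp z - cexp w = cexp w * (cexp (z - w) - 1).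
  by rewrite mulrBr mulr1 -cexpD addrCA subrr addr0.
rewrite normcM (le_trans (ler_piMl (normc_ge0 _) (normc_cexp_le1 w0)))//.
by apply: normc_cexp_sub1; rewrite ReD ReN subr_le0.
Qed.

(** The [N]-th power of the mean of an infinitesimal factor: the randomness is
averaged in the exponent. *)
Lemma cvg_mean_power (L : nat -> T -> C) (V g : T -> R) :
  (forall N, cmf (L N)) -> (forall N w, Re (L N w) <= 0) ->
  itg P g -> (forall N w, normc (N%:R * L N w) <= g w) ->
  itg P V -> (forall w, 0 <= V w) ->
  (forall w, normc (N%:R * L N w + (V w / 2)%:C) @[N --> \oo] --> 0) ->
  normc (cEx P (fun w => cexp (L N w)) ^+ N - (expR (- (Ex P V / 2)))%:C) @[N --> \oo] --> 0.
Proof.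
move=> mL L0 ig Lg iV V0 cL.
have mcL N : cmf (fun w => cexp (L N w)) by exact: cmf_cexp.
have n1 N w : normc (cexp (L N w)) <= 1 by exact: normc_cexp_le1.
have g0 w : 0 <= g w by apply: le_trans (Lg 0%N w); exact: normc_ge0.
have EV0 : 0 <= Ex P V by exact: Ex_ge0.
rewrite -cexp_real; apply: cvg_power_cexp.
- by move=> N; apply: normc_cEx_le.
- by rewrite /= oppr_le0 divr_ge0.
have nN N : normc (N%:R : C) = N%:R.
  by rewrite -(rmorph_nat (real_complex R)) normc_real ger0_norm.
have mV : measurable_fun [set: T] (fun w => - (V w / 2)).
  by apply: measurable_funN; apply: measurable_funM => //; exact: itg_meas iV.
have E N : N%:R * (cEx P (fun w => cexp (L N w)) - 1) =
    cEx P (fun w => N%:R * (cexp (L N w) - 1)).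
  have ic := citg_bounded P (mcL N) (n1 N).
  rewrite cExZ; last by apply: citgB => //; exact: citg_cst.
  by rewrite cExB ?cEx_cst//; exact: citg_cst.
have -> : (- (Ex P V / 2))%:C = cEx P (fun w => (- (V w / 2))%:C).
  rewrite cEx_real; congr (_%:C).
  transitivity (- 2^-1 * Ex P V); first by ring.
  by rewrite -ExZ//; apply: eq_Ex => w; ring.
under eq_fun do rewrite E.
apply: (cEx_dct (g := fun w => 2 * g w)).
- by move=> N; apply: cmfM; [exact: cmf_cst|apply: cmfB => //; exact: cmf_cst].
- exact: cmf_real.
- exact: itgZ.
- move=> N w; rewrite normcM nN.
  apply: (le_trans (ler_wpM2l (ler0n _ N) (normc_cexp_sub1 (L0 N w)))).
  by rewrite mulrCA ler_wpM2l// -nN -normcM.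
- move=> w.
  have c0 : (3 * g w ^+ 2 * N%:R^-1 + normc (N%:R * L N w + (V w / 2)%:C)) @[N --> \oo] --> 0.
    rewrite -[X in _ --> X]addr0; apply: cvgD => //.
    rewrite -[X in _ --> X](mulr0 (3 * g w ^+ 2)); apply: cvgM; first exact: cvg_cst.
    exact: cvg_invn0.
  apply: (cvg0_squeeze _ c0); near=> N; rewrite normc_ge0 andTb.
  have N0 : 0 < N%:R :> R by rewrite ltr0n; near: N; exact: nbhs_infty_gt.
  have -> : N%:R * (cexp (L N w) - 1) - (- (V w / 2))%:C =
     N%:R * (cexp (L N w) - 1 - L N w) + (N%:R * L N w + (V w / 2)%:C).
    by rewrite rmorphN; ring.
  rewrite (le_trans (le_normcD _ _))// lerD2r normcM nN.
  apply: (le_trans (ler_wpM2l (ltW N0) (normc_cexp_sub2 (L0 N w)))).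
  rewrite ler_pdivlMr//.
  have := Lg N w; rewrite normcM nN => h.
  have h2 : (N%:R * normc (L N w)) ^+ 2 <= g w ^+ 2.
    by rewrite lerXn2r ?nnegrE ?mulr_ge0 ?normc_ge0.
  by move: h2; rewrite exprMn; lra.
Unshelve. all: by end_near.
Qed.

End mean_of_powers.

Section mixed_log_characteristic.
Context d (T : measurableType d) (R : realType) (P : probability T R).
Context (lambda : R) (alpha : {RV P >-> R}).
Hypothesis lambda0 : 0 < lambda.
Hypothesis al01 : forall w, 0 < alpha w < 1.
Hypothesis inv2 : itg P (fun w => (1 - alpha w)^-1 ^+ 2).
Local Notation C := R[i].

Definition logchar (th : nat -> R) K (a : R) : C :=
  (lambda / (1 - a))%:C * (psi th K a 0 - 0 +i* (\sum_(k < K) th k)).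

(** The characteristic function of the conditionally centred [\sum_k th k * X_k]. *)
Definition phi th K : C := cEx P (fun w => cexp (logchar th K (alpha w))).

(** The conditional variance of [\sum_k th k * X_k]. *)
Definition cvar th K (a : R) : R := lambda / (1 - a) * quad th K a 0.

Let mu_gt0 a : 0 < a < 1 -> 0 < lambda / (1 - a).
Proof. by move=> /andP[_ a1]; rewrite divr_gt0// subr_gt0. Qed.

Lemma Re_logchar th K a : 0 < a < 1 -> Re (logchar th K a) <= 0.
Proof.
move=> a01; rewrite ReM [Re _%:C]/= [Im _%:C]/= mul0r subr0.
by rewrite mulr_ge0_le0 ?Re_logchar_le0// ltW// mu_gt0.
Qed.

(** [2] is the largest integer power of [(1 - alpha)^-1] that is integrable for all
exponents [beta > 1] of the mixing density. *)
Lemma normc_logchar th K a dl : 0 < a < 1 -> 0 <= dl -> (forall k, `|th k| <= dl) ->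
  normc (logchar th K a) <= lambda * K%:R * dl ^+ 2 * (1 - a)^-1 ^+ 2.
Proof.
move=> a01 dl0 thd; have m0 := mu_gt0 a01.
rewrite normcM normc_real (gtr0_norm m0).
apply: (le_trans (ler_wpM2l (ltW m0) (logchar_order1 a01 dl0 thd K))).
rewrite le_eqVlt; apply/orP; left; apply/eqP; field.
by have /andP[_ a1] := a01; rewrite gt_eqF// subr_gt0.
Qed.

Lemma logchar_cvar th K a dl : 0 < a < 1 -> 0 <= dl -> (forall k, `|th k| <= dl) ->
  normc (logchar th K a + (cvar th K a / 2)%:C) <= 3 * lambda * K%:R * dl ^+ 3 * (1 - a)^-1 ^+ 3.
Proof.
move=> a01 dl0 thd; have m0 := mu_gt0 a01.
have -> : logchar th K a + (cvar th K a / 2)%:C = (lambda / (1 - a))%:C *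
    (psi th K a 0 - 0 +i* (\sum_(k < K) th k) + (quad th K a 0 / 2)%:C).
  by rewrite mulrDr -rmorphM /cvar mulrA.
rewrite normcM normc_real (gtr0_norm m0).
apply: (le_trans (ler_wpM2l (ltW m0) (logchar_order2 a01 dl0 thd K))).
rewrite le_eqVlt; apply/orP; left; apply/eqP; field.
by have /andP[_ a1] := a01; rewrite gt_eqF// subr_gt0.
Qed.

Lemma cmf_logchar th K : cmf (logchar th K).
Proof.
apply: cmfM.
  by apply: cmf_real; apply: measurable_funM => //; exact: measurable_1B.
by apply: cmfB; [apply: psi_measurable; exact: cmf_cst|exact: cmf_cst].
Qed.

Let mLal th K : cmf (fun w => logchar th K (alpha w)).
Proof. exact: (cmf_comp (measurable_funPT alpha) (cmf_logchar th K)). Qed.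

Lemma normc_phi th K : normc (phi th K) <= 1.
Proof.
apply: normc_cEx_le; first by apply: cmf_cexp.
by move=> w; apply: normc_cexp_le1; exact: Re_logchar.
Qed.

Lemma phi_power_bound th K dl N : 0 <= dl -> (forall k, `|th k| <= dl) ->
  1 - Re (phi th K ^+ N) <=
  N%:R * (2 * (lambda * K%:R * dl ^+ 2 * Ex P (fun w => (1 - alpha w)^-1 ^+ 2))).
Proof.
move=> dl0 thd.
have mc : cmf (fun w => cexp (logchar th K (alpha w))) by exact: cmf_cexp.
have bc w : normc (cexp (logchar th K (alpha w))) <= 1.
  by apply: normc_cexp_le1; exact: Re_logchar.
have h1 : normc (1 - phi th K) <= 2 * (lambda * K%:R * dl ^+ 2 * Ex P (fun w => (1 - alpha w)^-1 ^+ 2)).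
  have ic := citg_bounded P mc bc.
  have -> : 1 - phi th K = cEx P (fun w => 1 - cexp (logchar th K (alpha w))).
    by rewrite cExB ?cEx_cst//; exact: citg_cst.
  have i1 : citg P (fun w => 1 - cexp (logchar th K (alpha w))).
    by apply: citgB => //; exact: citg_cst.
  rewrite (le_trans (normc_cEx i1))// -!ExZ//; last exact: itgZ.
  apply: Ex_le; [exact: citg_norm|by do 2 apply: itgZ|].
  move=> w; rewrite normcB (le_trans (normc_cexp_sub1 (Re_logchar th K (al01 w))))//.
  by rewrite ler_wpM2l// normc_logchar.
have n11 : normc (1 : C) <= 1 by rewrite normc1.
have h2 := normc_subX N n11 (normc_phi th K); rewrite expr1n in h2.
have h3 : 1 - Re (phi th K ^+ N) <= normc (1 - phi th K ^+ N).
  apply: le_trans (Re_le_normc _); rewrite ReD ReN; exact: ler_norm.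
by apply: (le_trans h3); apply: (le_trans h2); rewrite ler_wpM2l.
Qed.

Lemma cvar_ge0 th K a : 0 < a < 1 -> 0 <= cvar th K a.
Proof. by move=> a01; rewrite mulr_ge0 ?quad_ge0// ltW// mu_gt0. Qed.

Lemma cvar_le th K a dl : 0 < a < 1 -> 0 <= dl -> (forall k, `|th k| <= dl) ->
  cvar th K a <= 2 * lambda * K%:R * dl ^+ 2 * (1 - a)^-1 ^+ 2.
Proof.
move=> a01 dl0 thd; have m0 := mu_gt0 a01.
have /andP[a0 a1] := a01.
have b0 : 0 < 1 - a by rewrite subr_gt0.
suff q : quad th K a 0 <= K%:R * dl ^+ 2 * (2 / (1 - a)).
  rewrite (le_trans (ler_wpM2l (ltW m0) q))// le_eqVlt; apply/orP; left; apply/eqP.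
  by field; rewrite gt_eqF.
rewrite quadE mulr0 mul0r addr0.
apply: (@le_trans _ _ (dl ^+ 2 * toeplitz a K K)).
  rewrite mulr_sumr; apply: ler_sum => k _; rewrite mulr_sumr; apply: ler_sum => l _.
  rewrite ler_wpM2r ?exprn_ge0 ?(ltW a0)// expr2 (le_trans (ler_norm _))// normrM.
  by rewrite ler_pM.
by rewrite -mulrA mulrCA ler_wpM2l ?sqr_ge0// toeplitz_le.
Qed.

Lemma measurable_cvar th K : measurable_fun [set: R] (cvar th K).
Proof.
apply: measurable_funM.
  by apply: measurable_funM => //; exact: measurable_1B.
rewrite (_ : quad th K ^~ 0 = fun a : R => \sum_(k < K) \sum_(l < K) th k * th l * a ^+ (k - l + (l - k))).
  apply: measurable_sum => k; apply: measurable_sum => l; exact: measurable_funM.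
by apply/funext => a; rewrite quadE mulr0 mul0r addr0.
Qed.

Lemma itg_cvar th K dl : 0 <= dl -> (forall k, `|th k| <= dl) ->
  itg P (fun w => cvar th K (alpha w)).
Proof.
move=> dl0 thd; apply: (itg_le _ (itgZ (2 * lambda * K%:R * dl ^+ 2) inv2)).
  by apply: (measurableT_comp (measurable_cvar th K)).
by move=> w; rewrite ger0_norm ?cvar_ge0// cvar_le.
Qed.

Lemma cvarZ s th K a : cvar (fun k => s * th k) K a = s ^+ 2 * cvar th K a.
Proof. by rewrite /cvar quadZ; ring. Qed.

(** Over many copies the conditional variances are averaged over [alpha]. *)
Lemma phi_power_cvg th K dl : 0 <= dl -> (forall k, `|th k| <= dl) ->
  normc (phi (fun k => sqrtV N * th k) K ^+ N -
    (expR (- (Ex P (fun w => cvar th K (alpha w)) / 2)))%:C) @[N --> \oo] --> 0.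
Proof.
move=> dl0 thd.
have s0 N : 0 <= sqrtV N :> R by exact: sqrtV_ge0.
have thN N k : `|sqrtV N * th k| <= sqrtV N * dl.
  by rewrite normrM ger0_norm// ler_wpM2l.
apply: (cvg_mean_power (L := fun N w => logchar (fun k => sqrtV N * th k) K (alpha w))
   (g := fun w => lambda * K%:R * dl ^+ 2 * (1 - alpha w)^-1 ^+ 2)).
- by [].
- by move=> N w; exact: Re_logchar.
- exact: itgZ.
- move=> N w; rewrite normcM -(rmorph_nat (real_complex R)) normc_real ger0_norm//.
  have := normc_logchar K (al01 w) (mulr_ge0 (s0 N) dl0) (thN N).
  move=> /(ler_wpM2l (ler0n R N)) h; apply: (le_trans h).
  case: (posnP N) => [->|N0].
    by rewrite mul0r !mulr_ge0 ?invr_ge0 ?exprn_ge0 ?(ltW lambda0)// ?invr_ge0 subr_ge0 ltW//; have /andP[] := al01 w.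
  rewrite le_eqVlt; apply/orP; left; apply/eqP.
  transitivity (N%:R * sqrtV N ^+ 2 * (lambda * K%:R * dl ^+ 2 * (1 - alpha w)^-1 ^+ 2)); first by ring.
  by rewrite sqrtV_sqr// mul1r.
- exact: itg_cvar dl0 thd.
- by move=> w; exact: cvar_ge0.
- move=> w; set b3 := (1 - alpha w)^-1 ^+ 3.
  have c0 : (3 * lambda * K%:R * dl ^+ 3 * b3 * sqrtV N) @[N --> \oo] --> 0.
    rewrite -[X in _ --> X](mulr0 (3 * lambda * K%:R * dl ^+ 3 * b3)).
    by apply: cvgM; [exact: cvg_cst|exact: cvg_sqrtV].
  apply: (cvg0_squeeze _ c0); near=> N; rewrite normc_ge0 andTb.
  have N0 : (0 < N)%N by near: N; exact: nbhs_infty_gt.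
  have -> : N%:R * logchar (fun k => sqrtV N * th k) K (alpha w) + (cvar th K (alpha w) / 2)%:C =
     (N%:R)%:C * (logchar (fun k => sqrtV N * th k) K (alpha w) +
       (cvar (fun k => sqrtV N * th k) K (alpha w) / 2)%:C).
    rewrite mulrDr -rmorphM cvarZ rmorph_nat; congr (_ + _%:C).
    transitivity (N%:R * sqrtV N ^+ 2 * (cvar th K (alpha w) / 2)); last by ring.
    by rewrite sqrtV_sqr// mul1r.
  rewrite normcM normc_real ger0_norm//.
  have := logchar_cvar K (al01 w) (mulr_ge0 (s0 N) dl0) (thN N).
  move=> /(ler_wpM2l (ler0n R N)) h; apply: (le_trans h).
  rewrite -/b3 le_eqVlt; apply/orP; left; apply/eqP.
  transitivity ((N%:R * sqrtV N ^+ 2) * (3 * lambda * K%:R * dl ^+ 3 * b3 * sqrtV N)); first by ring.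
  by rewrite sqrtV_sqr// mul1r.
Unshelve. all: by end_near.
Qed.

End mixed_log_characteristic.

Section step_limits.
Context d (T : measurableType d) (R : realType) (P : probability T R).
Context (lambda : R) (alpha : {RV P >-> R}).
Hypothesis lambda0 : 0 < lambda.
Hypothesis al01 : forall w, 0 < alpha w < 1.
Hypothesis inv2 : itg P (fun w => (1 - alpha w)^-1 ^+ 2).
Local Notation C := R[i].

(** The limit of the conditional variance of [n ^- 1/2 * \sum_(k <= n) X_k]. *)
Definition vlim (a : R) : R := lambda * ((1 + a) * (1 - a)^-1 ^+ 2).

Lemma vlim_ge0 a : 0 < a < 1 -> 0 <= vlim a.
Proof. by move=> /andP[a0 a1]; rewrite mulr_ge0 ?(ltW lambda0)// mulr_ge0 ?sqr_ge0//; lra. Qed.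

Lemma measurable_vlim : measurable_fun [set: R] vlim.
Proof.
apply: measurable_funM => //; apply: measurable_funM; first exact: measurable_funD.
by apply: measurable_funX; exact: measurable_1B.
Qed.

Let M2 := Ex P (fun w => (1 - alpha w)^-1 ^+ 2).

Lemma itg_vlim : itg P (fun w => vlim (alpha w)).
Proof.
apply: (itg_le _ (itgZ (2 * lambda) inv2)).
  by apply: (measurableT_comp measurable_vlim).
move=> w; rewrite ger0_norm ?vlim_ge0// /vlim [2 * _]mulrC -mulrA ler_wpM2l ?(ltW lambda0)//.
by rewrite ler_wpM2r ?sqr_ge0//; have := al01 w; lra.
Qed.

Section weights.
Context (m : nat) (t c : 'I_m -> R).
Hypothesis t0 : forall i, 0 <= t i.

Definition tidx (n : nat) (i : 'I_m) : nat := Num.truncn (n%:R * t i).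

(** A number of terms that contains all the steps. *)
Definition horizon (n : nat) : nat := (Num.truncn (n%:R * \sum_i t i)).+1.

(** The weights of [n ^- 1/2 * \sum_i c i * \sum_(1 <= k <= n * t i) x k]. *)
Definition stepw (n k : nat) : R := sqrtV n * steps c (tidx n) k.

Let D := \sum_i t i.
Let A := \sum_i `|c i|.

Let D0 : 0 <= D. Proof. exact: sumr_ge0. Qed.
Let A0 : 0 <= A. Proof. exact: sumr_ge0. Qed.

Let tD i : t i <= D.
Proof. by rewrite /D (bigD1 i)//= lerDl sumr_ge0. Qed.

Lemma tidx_horizon n i : (tidx n i < horizon n)%N.
Proof. by rewrite ltnS le_truncn// ler_wpM2l. Qed.

Lemma horizon_le n : (horizon n)%:R <= n%:R * D + 1.
Proof.
by rewrite /horizon -natr1 lerD2r truncn_le// mulr_ge0.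
Qed.

Lemma horizon_sqrtV n : (horizon n)%:R * sqrtV n ^+ 2 <= D + 1.
Proof.
rewrite sqrtV2; case: n => [|n]; first by rewrite invr0 mulr0 addr_ge0.
have n0 : 0 < n.+1%:R :> R by rewrite ltr0n.
rewrite ler_pdivrMr// (le_trans (horizon_le n.+1))// mulrDl mul1r mulrC lerD2l.
by rewrite ler1n.
Qed.

Lemma norm_stepw n k : `|stepw n k| <= sqrtV n * A.
Proof. by rewrite normrM ger0_norm ?sqrtV_ge0// ler_wpM2l ?sqrtV_ge0// norm_steps_le. Qed.

Lemma cvar_stepwE n a : cvar lambda (stepw n) (horizon n) a =
  lambda / (1 - a) * (n%:R^-1 * quad (steps c (tidx n)) (horizon n) a 0).
Proof. by rewrite /stepw cvarZ /cvar sqrtV2 mulrCA. Qed.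

Lemma cvar_stepw_cvg a : 0 < a < 1 ->
  cvar lambda (stepw n) (horizon n) a @[n --> \oo] --> vlim a * minform t c.
Proof.
move=> a01; have cq := @quad_steps_cvg R m t c horizon a a01 t0 tidx_horizon.
have -> : vlim a * minform t c = lambda / (1 - a) * ((1 + a) / (1 - a) * minform t c).
  by rewrite /vlim; field; have /andP[_ a1] := a01; rewrite gt_eqF// subr_gt0.
under eq_fun do rewrite cvar_stepwE.
by apply: cvgM => //; exact: cvg_cst.
Qed.

Lemma cvar_stepw_le n a : 0 < a < 1 ->
  cvar lambda (stepw n) (horizon n) a <= 2 * lambda * D * A ^+ 2 * (1 - a)^-1 ^+ 2.
Proof.
move=> a01; rewrite cvar_stepwE.
have /andP[a0 a1] := a01.
have b0 : 0 < 1 - a by rewrite subr_gt0.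
have tn i : (tidx n i)%:R <= n%:R * D.
  by rewrite (le_trans (_ : _ <= n%:R * t i)) ?truncn_le ?mulr_ge0// ler_wpM2l.
have := quad_steps_le c a01 (tidx_horizon n) tn; rewrite -/A => h.
have := le_trans (ler_norm _) h => {}h.
apply: (@le_trans _ _ (lambda / (1 - a) * (2 * D * A ^+ 2 / (1 - a)))); last first.
  by rewrite le_eqVlt; apply/orP; left; apply/eqP; field; rewrite gt_eqF.
rewrite ler_wpM2l ?divr_ge0 ?(ltW lambda0) ?(ltW b0)//.
have c0 : 0 <= 2 * D * A ^+ 2 / (1 - a) by rewrite !mulr_ge0 ?invr_ge0 ?(ltW b0) ?exprn_ge0.
case: n {tn} h => [|n] h; first by rewrite invr0 mul0r.
by rewrite mulrC ler_pdivrMr ?ltr0n// mulrC.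
Qed.

Lemma Ex_cvar_stepw_cvg :
  Ex P (fun w => cvar lambda (stepw n) (horizon n) (alpha w)) @[n --> \oo] -->
  Ex P (fun w => vlim (alpha w)) * minform t c.
Proof.
have -> : Ex P (fun w => vlim (alpha w)) * minform t c = Ex P (fun w => vlim (alpha w) * minform t c).
  by rewrite mulrC -ExZ ?itg_vlim//; apply: eq_Ex => w; rewrite mulrC.
apply: (Ex_dct (g := fun w => 2 * lambda * D * A ^+ 2 * (1 - alpha w)^-1 ^+ 2)).
- by move=> n; apply: (measurableT_comp (measurable_cvar _ _ _)).
- by apply: measurable_funM => //; apply: (measurableT_comp measurable_vlim).
- exact: itgZ.
- by move=> n w; rewrite ger0_norm ?cvar_ge0// cvar_stepw_le.
- by move=> w; exact: cvar_stepw_cvg.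
Qed.

(** The number of copies cancels against their normalization, and the number of time
steps against theirs: the bound, which gives tightness, is uniform in both. *)
Lemma phi_stepw_bound n N :
  1 - Re (phi lambda alpha (fun k => sqrtV N * stepw n k) (horizon n) ^+ N) <=
  2 * lambda * (D + 1) * M2 * A ^+ 2.
Proof.
have dl0 : 0 <= sqrtV N * (sqrtV n * A) by rewrite !mulr_ge0 ?sqrtV_ge0.
have thd k : `|sqrtV N * stepw n k| <= sqrtV N * (sqrtV n * A).
  by rewrite normrM ger0_norm ?sqrtV_ge0// ler_wpM2l ?sqrtV_ge0// norm_stepw.
apply: (le_trans (phi_power_bound lambda0 al01 inv2 _ N dl0 thd)).
rewrite -/M2.
have M20 : 0 <= M2 by apply: Ex_ge0 => w; exact: sqr_ge0.
have -> : N%:R * (2 * (lambda * (horizon n)%:R * (sqrtV N * (sqrtV n * A)) ^+ 2 * M2)) =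
   (N%:R * sqrtV N ^+ 2) * ((horizon n)%:R * sqrtV n ^+ 2) * (2 * lambda * M2 * A ^+ 2) by ring.
have -> : 2 * lambda * (D + 1) * M2 * A ^+ 2 = 1 * (D + 1) * (2 * lambda * M2 * A ^+ 2) by ring.
have l0 := ltW lambda0.
rewrite ler_wpM2r ?mulr_ge0 ?exprn_ge0//.
apply: ler_pM; [by rewrite mulr_ge0 ?sqr_ge0|by rewrite mulr_ge0 ?sqr_ge0|exact: natV_le1|exact: horizon_sqrtV].
Qed.

Let Q := minform t c.
Let Q0 : 0 <= Q. Proof. exact: minform_ge0. Qed.

(** The characteristic function of a centred Gaussian variable whose random
variance is [s ^+ 2 * Q * vlim alpha]. *)
Definition mixchar (s : R) : C :=
  cEx P (fun w => cexp (- (s ^+ 2 * (Q * vlim (alpha w)) / 2))%:C).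

(** For each value of [alpha] the exponent converges to the limiting conditional
variance, and the characteristic functions are bounded. *)
Lemma phi_stepw_cvg s : 0 <= s ->
  normc (phi lambda alpha (fun k => s * stepw n k) (horizon n) - mixchar s)
    @[n --> \oo] --> 0.
Proof.
move=> s0.
have dl0 n : 0 <= s * (sqrtV n * A) by rewrite !mulr_ge0 ?sqrtV_ge0.
have thd n k : `|s * stepw n k| <= s * (sqrtV n * A).
  by rewrite normrM ger0_norm// ler_wpM2l// norm_stepw.
have v0 w : Re (- (s ^+ 2 * (Q * vlim (alpha w)) / 2))%:C <= 0.
  by rewrite /= oppr_le0 divr_ge0// mulr_ge0 ?sqr_ge0// mulr_ge0// vlim_ge0.
apply: (cEx_dct (g := cst 1)).
- move=> n; apply: cmf_cexp; apply: (cmf_comp (measurable_funPT alpha)).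
  exact: cmf_logchar.
- apply: cmf_cexp; apply: cmf_real; apply: measurable_funN.
  apply: measurable_funM => //; apply: measurable_funM => //; apply: measurable_funM => //.
  by apply: (measurableT_comp measurable_vlim).
- exact: itg_cst.
- by move=> n w; apply: normc_cexp_le1; exact: Re_logchar.
- move=> w.
  set b3 := (1 - alpha w)^-1 ^+ 3.
  pose L n := logchar lambda (fun k => s * stepw n k) (horizon n) (alpha w).
  pose V n := cvar lambda (fun k => s * stepw n k) (horizon n) (alpha w).
  have cV : V n @[n --> \oo] --> s ^+ 2 * (Q * vlim (alpha w)).
    rewrite /V; under eq_fun do rewrite cvarZ.
    apply: cvgM; first exact: cvg_cst.
    by rewrite mulrC; exact: cvar_stepw_cvg.
  have c0 : (2 * (3 * lambda * (D + 1) * (s * A) ^+ 3 * b3 * sqrtV n +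
      2^-1 * `|V n - s ^+ 2 * (Q * vlim (alpha w))|)) @[n --> \oo] --> 0.
    rewrite -[X in _ --> X](mulr0 2); apply: cvgM; first exact: cvg_cst.
    rewrite -[X in _ --> X]addr0; apply: cvgD.
      rewrite -[X in _ --> X](mulr0 (3 * lambda * (D + 1) * (s * A) ^+ 3 * b3)).
      by apply: cvgM; [exact: cvg_cst|exact: cvg_sqrtV].
    rewrite -[X in _ --> X](mulr0 2^-1); apply: cvgM; first exact: cvg_cst.
    exact: dist0_cvg.
  apply: (cvg0_squeeze _ c0); apply: nearW => n; rewrite normc_ge0 andTb.
  apply: (le_trans (normc_cexpB (Re_logchar lambda0 _ _ (al01 w)) (v0 w))).
  rewrite ler_wpM2l// -/(L n).
  have -> : L n - (- (s ^+ 2 * (Q * vlim (alpha w)) / 2))%:C =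
     (L n + (V n / 2)%:C) + (2^-1 * (s ^+ 2 * (Q * vlim (alpha w)) - V n))%:C.
    rewrite -addrA -rmorphD -rmorphN; congr (_ + _%:C); by field.
  rewrite (le_trans (le_normcD _ _))// lerD//; last first.
    by rewrite normc_real normrM ger0_norm// distrC.
  apply: (le_trans (logchar_cvar lambda0 _ (al01 w) (dl0 n) (thd n))).
  rewrite -/b3.
  have b30 : 0 <= b3 by rewrite exprn_ge0// invr_ge0 subr_ge0 ltW//; have /andP[] := al01 w.
  have -> : 3 * lambda * (horizon n)%:R * (s * (sqrtV n * A)) ^+ 3 * b3 =
    ((horizon n)%:R * sqrtV n ^+ 2) * (3 * lambda * (s * A) ^+ 3 * b3 * sqrtV n) by ring.
  have -> : 3 * lambda * (D + 1) * (s * A) ^+ 3 * b3 * sqrtV n =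
    (D + 1) * (3 * lambda * (s * A) ^+ 3 * b3 * sqrtV n) by ring.
  have l0 := ltW lambda0.
  have s3 : 0 <= (s * A) ^+ 3 by rewrite exprn_ge0// mulr_ge0.
  apply: ler_wpM2r; last exact: horizon_sqrtV.
  by rewrite mulr_ge0 ?sqrtV_ge0// mulr_ge0// mulr_ge0// mulr_ge0.
Qed.

Lemma normc_mixchar s : normc (mixchar s) <= 1.
Proof.
apply: normc_cEx_le.
  apply: cmf_cexp; apply: cmf_real; apply: measurable_funN.
  apply: measurable_funM => //; apply: measurable_funM => //; apply: measurable_funM => //.
  by apply: (measurableT_comp measurable_vlim).
move=> w; apply: normc_cexp_le1.
by rewrite /= oppr_le0 divr_ge0// mulr_ge0 ?sqr_ge0// mulr_ge0// vlim_ge0.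
Qed.

Lemma phi_stepw_power_cvg s N : 0 <= s ->
  normc (phi lambda alpha (fun k => s * stepw n k) (horizon n) ^+ N - mixchar s ^+ N)
    @[n --> \oo] --> 0.
Proof.
move=> s0; have c0 : (N%:R * normc (phi lambda alpha (fun k => s * stepw n k) (horizon n) - mixchar s))
    @[n --> \oo] --> 0.
  rewrite -[X in _ --> X](mulr0 N%:R); apply: cvgM; [exact: cvg_cst|exact: phi_stepw_cvg].
apply: (cvg0_squeeze _ c0); apply: nearW => n; rewrite normc_ge0 andTb.
by apply: normc_subX; [exact: normc_phi|exact: normc_mixchar].
Qed.

Lemma mixchar_power_cvg :
  normc (mixchar (sqrtV N) ^+ N - (expR (- (Q * Ex P (fun w => vlim (alpha w)) / 2)))%:C)
    @[N --> \oo] --> 0.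
Proof.
rewrite -ExZ ?itg_vlim//.
apply: (cvg_mean_power (V := fun w => Q * vlim (alpha w)) (g := fun w => Q * vlim (alpha w))
  (L := fun N w => (- (sqrtV N ^+ 2 * (Q * vlim (alpha w)) / 2))%:C)).
- move=> N; apply: cmf_real; apply: measurable_funN.
  apply: measurable_funM => //; apply: measurable_funM => //; apply: measurable_funM => //.
  by apply: (measurableT_comp measurable_vlim).
- by move=> N w; rewrite /= oppr_le0 divr_ge0// mulr_ge0 ?sqr_ge0// mulr_ge0// vlim_ge0.
- by apply: itgZ; exact: itg_vlim.
- move=> N w; have x0 : 0 <= Q * vlim (alpha w) by rewrite mulr_ge0// vlim_ge0.
  rewrite -(rmorph_nat (real_complex R)) -rmorphM normc_real mulrN normrN ger0_norm; last first.
    by rewrite mulr_ge0// divr_ge0// mulr_ge0// sqr_ge0.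
  have -> : N%:R * (sqrtV N ^+ 2 * (Q * vlim (alpha w)) / 2) =
     (N%:R * sqrtV N ^+ 2) * (Q * vlim (alpha w)) / 2 by ring.
  have := ler_wpM2r x0 (natV_le1 (R := R) N); rewrite mul1r.
  have : 0 <= N%:R * sqrtV N ^+ 2 * (Q * vlim (alpha w)) by rewrite mulr_ge0// mulr_ge0// sqr_ge0.
  lra.
- by apply: itgZ; exact: itg_vlim.
- by move=> w; rewrite mulr_ge0// vlim_ge0.
- move=> w; apply: cvg_near_cst; near=> N.
  have N0 : (0 < N)%N by near: N; exact: nbhs_infty_gt.
  rewrite -(rmorph_nat (real_complex R)) -rmorphM -rmorphD.
  have -> : N%:R * - (sqrtV N ^+ 2 * (Q * vlim (alpha w)) / 2) + Q * vlim (alpha w) / 2 =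
     (1 - N%:R * sqrtV N ^+ 2) * (Q * vlim (alpha w) / 2) by ring.
  by rewrite sqrtV_sqr// subrr mul0r rmorph0 normc0.
Unshelve. all: by end_near.
Qed.

End weights.

End step_limits.


(** * Gaussian sequences on a Wiener process *)
Section cholesky.
Context {R : realType} (Gam : nat -> nat -> R).

Definition form (th : nat -> R) K : R := \sum_(k < K) \sum_(l < K) th k * th l * Gam k l.

Hypothesis GamC : forall k l, Gam k l = Gam l k.
Hypothesis form_ge0 : forall th K, 0 <= form th K.
Hypothesis form_eq0 : forall th K, form th K = 0 -> forall k, (k < K)%N -> th k = 0.

Let factor (g : nat -> nat -> R) K :=
  (forall k l, (k < K)%N -> (l < K)%N -> \sum_(j < K) g k j * g l j = Gam k l) /\
  (forall k j, (k < K)%N -> (K <= j)%N -> g k j = 0).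

Let ext K (u : 'rV[R]_K) (k : nat) : R := if insub k is Some i then u 0 i else 0.

Let extE K (u : 'rV[R]_K) (i : 'I_K) : ext u i = u 0 i.
Proof. by rewrite /ext valK. Qed.

Let ext0 K (u : 'rV[R]_K) k : (K <= k)%N -> ext u k = 0.
Proof. by move=> Kk; rewrite /ext insubF// ltnNge Kk. Qed.

(** The next row of the factor: the triangular system is solvable because the
form is definite, and the diagonal entry exists because it is nonnegative. *)
Let next_row g K : factor g K -> exists r : nat -> R,
  [/\ forall l, (l < K)%N -> \sum_(j < K) r j * g l j = Gam K l,
      \sum_(j < K.+1) r j ^+ 2 = Gam K K & forall j, (K < j)%N -> r j = 0].
Proof.
move=> [gG g0].
pose L : 'M[R]_K := \matrix_(i, j) g i j.
pose G : 'M[R]_K := \matrix_(i, j) Gam i j.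
have LL : L *m L^T = G.
  by apply/matrixP => i j; rewrite !mxE -gG//; apply: eq_bigr => k _; rewrite !mxE.
have formE (u : 'rV[R]_K) : form (ext u) K = (u *m G *m u^T) 0 0.
  rewrite mxE /form exchange_big; apply: eq_bigr => j _.
  rewrite !mxE mulr_suml; apply: eq_bigr => i _.
  by rewrite !extE !mxE; ring.
have uL : L \in unitmx.
  rewrite -row_free_unit -kermx_eq0; apply/rowV0P => u /sub_kermxP uL0.
  have : form (ext u) K = 0 by rewrite formE -LL mulmxA uL0 !mul0mx mxE.
  move=> /form_eq0 h; apply/rowP => i.
  by rewrite -extE h ?ltn_ord// mxE.
pose gam : 'rV[R]_K := \row_j Gam K j.
pose y : 'rV[R]_K := gam *m invmx L^T.
have yL : y *m L^T = gam by rewrite -mulmxA mulVmx ?unitmx_tr// mulmx1.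
pose u := y *m invmx L.
have uLy : u *m L = y by rewrite -mulmxA mulVmx// mulmx1.
(* The square of the diagonal entry is the value of the form at [(- u, 1)]. *)
have s0 : 0 <= Gam K K - (y *m y^T) 0 0.
  pose th k := if k == K then 1 else - ext u k.
  have thi (i : 'I_K) : th i = - u 0 i by rewrite /th ltn_eqF// extE.
  suff <- : form th K.+1 = Gam K K - (y *m y^T) 0 0 by [].
  rewrite /form big_ord_recr/= [X in _ + X]big_ord_recr/=.
  under eq_bigr do rewrite big_ord_recr/=.
  rewrite big_split/=.
  have E1 : \sum_(i < K) \sum_(j < K) th i * th j * Gam i j = (y *m y^T) 0 0.
    rewrite -uLy trmx_mul mulmxA -[u *m L *m _]mulmxA LL -formE /form.
    apply: eq_bigr => i _; apply: eq_bigr => j _; rewrite !thi !extE; ring.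
  have E3 : (gam *m u^T) 0 0 = (y *m y^T) 0 0.
    by rewrite -{1}yL -mulmxA -trmx_mul uLy.
  have E2 : \sum_(i < K) th K * th i * Gam K i = - (gam *m u^T) 0 0.
    rewrite mxE -sumrN; apply: eq_bigr => i _.
    by rewrite thi !mxE /th eqxx; ring.
  have E2' : \sum_(i < K) th i * th K * Gam i K = - (gam *m u^T) 0 0.
    by rewrite -E2; apply: eq_bigr => i _; rewrite GamC; ring.
  have thK : th K = 1 by rewrite /th eqxx.
  by rewrite E1 E2' E2 E3 thK; ring.
exists (fun j => if j == K then Num.sqrt (Gam K K - (y *m y^T) 0 0) else ext y j); split.
- move=> l lK; have -> : Gam K l = gam 0 (Ordinal lK) by rewrite mxE.
  rewrite -yL [RHS]mxE; apply: eq_bigr => j _.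
  by rewrite ltn_eqF// extE; congr (_ * _); rewrite !mxE.
- rewrite big_ord_recr/= eqxx sqr_sqrtr//.
  have -> : \sum_(j < K) (if j == K :> nat then Num.sqrt (Gam K K - (y *m y^T) 0 0) else ext y j) ^+ 2 = (y *m y^T) 0 0.
    rewrite [RHS]mxE; apply: eq_bigr => j _.
    by rewrite ltn_eqF// extE expr2; congr (_ * _); rewrite [RHS]mxE.
  by rewrite addrC subrK.
- by move=> j Kj; rewrite gtn_eqF// ext0// ltnW.
Qed.

Let step g K : nat -> R :=
  if pselect (factor g K) is left H then sval (cid (next_row H)) else fun=> 0.

Let rows : nat -> nat -> nat -> R :=
  fix rows K := if K is K'.+1 then fun k => if k == K' then step (rows K') K' else rows K' k
                else fun=> fun=> 0.

Let rows_factor K : factor (rows K) K.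
Proof.
elim: K => [|K IH]; first by split.
have stepE : exists r, step (rows K) K = r /\
   [/\ forall l, (l < K)%N -> \sum_(j < K) r j * rows K l j = Gam K l,
      \sum_(j < K.+1) r j ^+ 2 = Gam K K & forall j, (K < j)%N -> r j = 0].
  rewrite /step; case: pselect => // H; eexists; split; first reflexivity.
  exact: (svalP (cid (next_row H))).
have [r [sE [r1 r2 r3]]] := stepE.
have [gG g0] := IH.
have rK k : (k < K)%N -> rows K.+1 k = rows K k by move=> kK /=; rewrite ltn_eqF.
have rr : rows K.+1 K = r by rewrite /= eqxx.
have rl l : (l < K)%N -> \sum_(j < K.+1) r j * rows K l j = Gam K l.
  by move=> lK; rewrite big_ord_recr/= g0// mulr0 addr0 r1.
split.
- move=> k l; rewrite ltnS leq_eqVlt => /orP[/eqP ->|kK];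
    rewrite ltnS leq_eqVlt => /orP[/eqP ->|lK].
  + by rewrite rr -r2; apply: eq_bigr => j _; rewrite expr2.
  + by rewrite rr rK// rl.
  + rewrite rr rK// GamC -rl//; apply: eq_bigr => j _; ring.
  + by rewrite !rK// big_ord_recr/= g0// mul0r addr0 gG.
- move=> k j; rewrite ltnS leq_eqVlt => /orP[/eqP ->|kK] Kj; first by rewrite rr r3.
  by rewrite rK// g0// ltnW.
Qed.

(** Cholesky factorization of an infinite positive definite matrix. *)
Lemma infinite_cholesky : exists g : nat -> nat -> R, forall K k l, (k < K)%N -> (l < K)%N ->
  (\sum_(j < K) g k j * g l j = Gam k l) /\ (forall j, (K <= j)%N -> g k j = 0).
Proof.
have rowsE K k : (k < K)%N -> rows K k = rows k.+1 k.
  elim: K => // K IH; rewrite ltnS leq_eqVlt => /orP[/eqP ->//|kK].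
  by rewrite -IH// [LHS]/= ltn_eqF.
exists (fun k => rows k.+1 k) => K k l kK lK.
have [h1 h2] := rows_factor K.
split; last by move=> j Kj; rewrite -(rowsE _ _ kK) h2.
by rewrite -(rowsE _ _ kK) -(rowsE _ _ lK) h1.
Qed.

(** A centred Gaussian sequence with covariance [Gam], built on the increments of
a Wiener process over unit intervals. *)
Lemma gaussian_from_wiener (W : process R) : standard_wiener W ->
  exists G : nat -> pr_space W -> R,
    (forall k, measurable_fun [set: pr_space W] (G k)) /\
    forall (th : nat -> R) K, cEx (pr_prob W) (fun w => cis (\sum_(k < K) th k * G k w)) =
      (expR (- (form th K / 2)))%:C.
Proof.
move=> wW; have [g gP] := infinite_cholesky.
pose G k w := \sum_(j < k.+1) g k j * (W j.+1%:R w - W j%:R w).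
exists G; split.
  move=> k; apply: measurable_sum => j; apply: measurable_funM => //.
  exact: measurable_funB.
move=> th K.
pose gam j := \sum_(k < K) th k * g k j.
have tau0 : 0 <= (0%:R : R) by [].
have ndtau : nondecreasing_seq (fun k : nat => k%:R : R) by move=> i j ij; rewrite ler_nat.
have := wiener_increments wW (fun j : 'I_K => gam j) tau0 ndtau.
have -> : \sum_(k < K) gam k ^+ 2 * (k.+1%:R - k%:R) = form th K.
  transitivity (\sum_(k < K) \sum_(l < K) th k * th l * \sum_(j < K) g k j * g l j).
    under eq_bigr do rewrite -natr1 addrAC subrr add0r mulr1 expr2 /gam mulr_suml.
    rewrite exchange_big; apply: eq_bigr => k _.
    under eq_bigr do rewrite mulr_sumr.
    rewrite exchange_big; apply: eq_bigr => l _.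
    rewrite mulr_sumr; apply: eq_bigr => j _; ring.
  apply: eq_bigr => k _; apply: eq_bigr => l _; congr (_ * _).
  by have [] := gP K k l (ltn_ord k) (ltn_ord l).
move=> <-; apply: eq_cEx => w; congr cis.
under [RHS]eq_bigr do rewrite /gam mulr_suml.
rewrite exchange_big; apply: eq_bigr => k _ /=.
rewrite /G mulr_sumr (big_ord_widen_cond K predT (fun j => th k * (g k j * (W j.+1%:R w - W j%:R w))))//=.
rewrite big_mkcond; apply: eq_bigr => j _ /=.
case: ifP => [_|jk]; first by rewrite mulrA.
have [_ ->] := gP k.+1 k k (ltnSn k) (ltnSn k); first by rewrite mulr0 mul0r.
by rewrite leqNgt jk.
Qed.

End cholesky.


(** * The intermediate limit processes *)
Section product_spaces.
Context (R : realType) d1 (T1 : measurableType d1) d2 (T2 : measurableType d2).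
Context (P : probability T1 R) (Q : probability T2 R).
Local Notation C := R[i].

Lemma Ex_product (f : T1 * T2 -> R) M : measurable_fun [set: T1 * T2] f ->
  (forall x, `|f x| <= M) ->
  Ex (P \x Q)%E f = Ex P (fun x => Ex Q (fun y => f (x, y))).
Proof.
move=> mf fM; have i1 : itg (P \x Q)%E f by apply: (@itg_bounded _ _ _ _ _ M).
rewrite /Ex -(integral12_prod_meas1 i1); congr fine; apply: eq_integral => x _.
rewrite /fubini_F fineK//; apply: integrable_fin_num => //.
apply: (@itg_bounded _ _ _ _ _ M); last by move=> y; exact: fM.
exact: (measurableT_comp mf (measurable_pair1 x)).
Qed.

Lemma cEx_product (F : T1 * T2 -> C) M : cmf F -> (forall x, normc (F x) <= M) ->
  cEx (P \x Q)%E F = cEx P (fun x => cEx Q (fun y => F (x, y))).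
Proof.
move=> [mR mI] FM; apply: complex_eqP => /=.
- apply: (Ex_product (M := M) mR) => x; exact: le_trans (Re_le_normc _) (FM x).
- apply: (Ex_product (M := M) mI) => x; exact: le_trans (Im_le_normc _) (FM x).
Qed.

End product_spaces.

Section limit_processes.
Context (R : realType).
Local Notation C := R[i].

Lemma sum_stepw m (t c : 'I_m -> R) n (F : nat -> R) : (forall i, 0 <= t i) ->
  \sum_(k < horizon t n) stepw t c n k * F k =
  \sum_i c i * (sqrtV n * \sum_(k < tidx t n i) F k.+1).
Proof.
move=> t0; under eq_bigr do rewrite /stepw -mulrA.
rewrite -mulr_sumr (sum_steps c F (tidx_horizon t0 n)) mulr_sumr.
by apply: eq_bigr => i _; rewrite mulrCA.
Qed.

(** Quadratic bounds at the origin pass to the limit. *)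
Lemma Re_bound_limit (u : nat -> C) z A : normc (u n - z) @[n --> \oo] --> 0 ->
  (forall n, 1 - Re (u n) <= A) -> 1 - Re z <= A.
Proof.
move=> uz uA; rewrite leNgt; apply/negP => Az.
have e0 : 0 < 1 - Re z - A by rewrite subr_gt0.
have [n _ /(_ n (leqnn n)) /= h] := cvgr_lt _ uz _ e0.
have := Re_le_normc (u n - z); have := ler_norm (Re (u n - z)).
by rewrite ReD ReN; have := uA n; lra.
Qed.

(** The limit in distribution, as the number of copies grows, is the partial sum
process of a Gaussian sequence [G] that has the covariances of the chain. *)
Section gaussian_sums.
Context (W : process R) (G : nat -> pr_space W -> R).
Hypothesis mG : forall k, measurable_fun [set: pr_space W] (G k).

Definition gauss_sum n (t : R) (w : pr_space W) : R :=
  sqrtV n * \sum_(k < Num.truncn (n%:R * t)) G k.+1 w.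

Lemma measurable_gauss_sum n t : measurable_fun [set: pr_space W] (gauss_sum n t).
Proof. by apply: measurable_funM => //; apply: measurable_sum. Qed.

Definition gauss_process n : process R :=
  Process (pr_prob W) (fun t => mfun_Sub (mem_set (measurable_gauss_sum n t))).

Lemma charf_gauss_process n m (t c : 'I_m -> R) : (forall i, 0 <= t i) ->
  charf (gauss_process n) t c =
  cEx (pr_prob W) (fun w => cis (\sum_(k < horizon t n) stepw t c n k * G k w)).
Proof.
move=> t0; apply: eq_cEx => w; congr cis; rewrite (sum_stepw c n (fun k => G k w) t0).
by apply: eq_bigr => i _.
Qed.

End gaussian_sums.

(** The limit in distribution, as the time horizon grows, is a Wiener process with
an independent random variance. *)
Section wiener_mixture.
Context d (T : measurableType d) (P : probability T R) (W : process R).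
Context (S : {RV P >-> R}).
Hypothesis S0 : forall w, 0 <= S w.

Definition mixture (t : R) (w : T * pr_space W) : R := Num.sqrt (S w.1) * W t w.2.

Lemma measurable_mixture t : measurable_fun [set: T * pr_space W] (mixture t).
Proof.
have msqrt : measurable_fun [set: R] (Num.sqrt : R -> R).
  by apply: continuous_measurable_fun; exact: sqrt_continuous.
apply: measurable_funM.
  apply: (measurableT_comp msqrt).
  by apply: (measurableT_comp (measurable_funPT S)); exact: measurable_fst.
by apply: (measurableT_comp (measurable_funPT (W t))); exact: measurable_snd.
Qed.

Definition mixture_process : process R :=
  Process (P \x pr_prob W)%E (fun t => mfun_Sub (mem_set (measurable_mixture t))).

Lemma charf_mixture m (t c : 'I_m -> R) : standard_wiener W -> (forall i, 0 <= t i) ->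
  charf mixture_process t c =
  cEx P (fun w => (expR (- (S w * minform t c / 2)))%:C).
Proof.
move=> wW t0; rewrite /charf.
rewrite (@cEx_product _ _ _ _ _ _ _ _ 1); last 2 first.
- apply: cmf_cis; apply: measurable_sum => i; exact: measurable_funM.
- by move=> w; rewrite normc_cis.
apply: eq_cEx => w /=.
transitivity (charf W t (fun i => Num.sqrt (S w) * c i)).
  apply: eq_cEx => w'; congr cis; apply: eq_bigr => i _; rewrite /mixture/=; ring.
by rewrite wiener_charf// minformZ sqr_sqrtr.
Qed.

End wiener_mixture.

End limit_processes.


(** * The iterated limits *)
Section aggregated_limits.
Context (R : realType) d0 (T0 : measurableType d0) (P0 : probability T0 R).
Context (lambda : R) (alpha : {RV P0 >-> R}).
Context (xi : nat -> nat -> {RV P0 >-> nat}) (eps : nat -> {RV P0 >-> nat}).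
Context (X : nat -> {RV P0 >-> nat}).
Context d (T : measurableType d) (P : probability T R).
Context (alpha_ : nat -> {RV P >-> R}) (X_ : nat -> nat -> {RV P >-> nat}).
Context (m_ : nat -> nat -> {RV P >-> R}) (B : process R).
Hypothesis lambda0 : 0 < lambda.
Hypothesis HX : randomized_INAR1 lambda alpha xi eps X.
Hypothesis copies : independent_copies alpha X alpha_ X_.
Hypothesis condm : forall j k, cond_exp P (alpha_ j) (fun w => (X_ j k w)%:R) (m_ j k).
Hypothesis inv2 : itg P0 (fun w => (1 - alpha w)^-1 ^+ 2).
Hypothesis wB : standard_wiener B.
Local Notation C := R[i].

Let al01 w : 0 < alpha w < 1. Proof. exact: (inar_alpha HX). Qed.

Definition scaled n N : process R :=
  scale_process (Num.sqrt (n * N)%N%:R)^-1 (aggregated X_ m_ N n).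

(** A linear combination of values of the aggregated process weighs the paths of all
copies by the same phases. *)
Lemma charf_scaled n N m (t c : 'I_m -> R) : (forall i, 0 <= t i) ->
  charf (scaled n N) t c =
  phi lambda alpha (fun k => sqrtV N * stepw t c n k) (horizon t n) ^+ N.
Proof.
move=> t0.
transitivity (cEx P (fun w => cis (\sum_(j < N) \sum_(k < horizon t n)
   (sqrtV N * stepw t c n k) * ((X_ j k w)%:R - m_ j k w)))).
  apply: eq_cEx => w; congr cis.
  under [RHS]eq_bigr => j _.
    under eq_bigr do rewrite -mulrA.
    rewrite -mulr_sumr (sum_stepw c n (fun k => (X_ j k w)%:R - m_ j k w) t0) mulr_sumr.
    over.
  rewrite exchange_big/=; apply: eq_bigr => i _.
  rewrite /scaled/= sqrtVM [partial_sum _ _ _ _ _ _ * _]mulrC /partial_sum !mulr_sumr; apply: eq_bigr => j _.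
  by rewrite big_add1 big_mkord /tidx; ring.
rewrite (copies_charf lambda0 HX copies condm inv2 (fun k => sqrtV N * stepw t c n k)).
by rewrite (centred_charf lambda0 HX (fun k => sqrtV N * stepw t c n k)).
Qed.

Lemma scaled_bound n N (t : R) : 0 <= t -> forall s,
  1 - Re (charf1 (scaled n N) t s) <=
  2 * lambda * (t + 1) * Ex P0 (fun w => (1 - alpha w)^-1 ^+ 2) * s ^+ 2.
Proof.
move=> t0 s; rewrite charf1E charf_scaled//.
have := phi_stepw_bound lambda0 al01 inv2 (fun=> s) (t := fun _ : 'I_1 => t) (fun=> t0) n N.
by rewrite !big_ord1 real_normK ?num_real.
Qed.

(** The covariances of the chain, [E (lambda * alpha ^ |k - l| / (1 - alpha))]. *)
Definition chain_cov (k l : nat) : R :=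
  Ex P0 (fun w => lambda / (1 - alpha w) * alpha w ^+ (k - l + (l - k))).

Let icov p : itg P0 (fun w => lambda / (1 - alpha w) * alpha w ^+ p).
Proof.
apply: (itg_le _ (itgZ lambda inv2)).
  apply: measurable_funM; last exact: measurable_funX.
  apply: measurable_funM => //.
  by apply: (measurableT_comp (measurable_1B (R := R))).
move=> w; have /andP[a0 a1] := al01 w.
have b0 : 0 < 1 - alpha w by rewrite subr_gt0.
have i1 : 1 <= (1 - alpha w)^-1 by rewrite invf_ge1//; lra.
have p0 : 0 <= alpha w ^+ p by rewrite exprn_ge0// ltW.
have p1 : alpha w ^+ p <= 1 by rewrite exprn_ile1// ltW.
have l0 := ltW lambda0.
have i0 : 0 <= (1 - alpha w)^-1 by rewrite invr_ge0 ltW.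
rewrite ger0_norm ?mulr_ge0// -mulrA ler_wpM2l// expr2 ler_wpM2l//.
exact: le_trans p1 i1.
Qed.

Lemma form_chain_cov th K : form chain_cov th K = Ex P0 (fun w => cvar lambda th K (alpha w)).
Proof.
transitivity (Ex P0 (fun w => \sum_(k < K) \sum_(l < K) th k * th l *
   (lambda / (1 - alpha w) * alpha w ^+ (k - l + (l - k))))).
  rewrite Ex_sum; last by move=> k; apply: itg_sum => l; exact: itgZ.
  apply: eq_bigr => k _; rewrite Ex_sum; last by move=> l; exact: itgZ.
  by apply: eq_bigr => l _; rewrite ExZ.
apply: eq_Ex => w; rewrite /cvar quadE mulr0 mul0r addr0 mulr_sumr.
apply: eq_bigr => k _; rewrite mulr_sumr; apply: eq_bigr => l _; ring.
Qed.

Let icvar th K : itg P0 (fun w => cvar lambda th K (alpha w)).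
Proof.
have -> : (fun w => cvar lambda th K (alpha w)) = (fun w => \sum_(k < K) \sum_(l < K) th k * th l *
   (lambda / (1 - alpha w) * alpha w ^+ (k - l + (l - k)))).
  apply/funext => w; rewrite /cvar quadE mulr0 mul0r addr0 mulr_sumr.
  apply: eq_bigr => k _; rewrite mulr_sumr; apply: eq_bigr => l _; ring.
by apply: itg_sum => k; apply: itg_sum => l; exact: itgZ.
Qed.

Lemma form_chain_cov_ge0 th K : 0 <= form chain_cov th K.
Proof. by rewrite form_chain_cov; apply: Ex_ge0 => w; exact: cvar_ge0. Qed.

(** The conditional variances are definite for every value of [alpha], so already
one value at which they vanish suffices. *)
Lemma form_chain_cov_eq0 th K : form chain_cov th K = 0 -> forall k, (k < K)%N -> th k = 0.
Proof.
rewrite form_chain_cov => E0.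
have [w q0] : exists w, cvar lambda th K (alpha w) = 0.
  apply/not_existsP => h.
  have mc := itg_meas (icvar th K).
  have : (\int[P0]_w `|(cvar lambda th K (alpha w))%:E| = 0)%E.
    rewrite -[RHS]/(0%:E) -E0 -Ex_fin//; apply: eq_integral => w _.
    by rewrite gee0_abs// lee_fin cvar_ge0.
  move=> /(ae_eq_integral_abs P0 measurableT); case; first exact/measurable_EFinP.
  move=> A [mA PA0 sA].
  have AT : A = setT.
    apply/seteqP; split => // w _; apply: sA => /= /(_ I) [] /h; exact.
  have := probability_setT P0; rewrite -AT => P1.
  have : (0 = 1 :> \bar R)%E by rewrite -P1 -PA0.
  by move=> /eqP; rewrite eq_sym onee_eq0.
apply: (@quad_eq0 _ _ (alpha w) (al01 w)).
move: q0 => /eqP; rewrite mulf_eq0 => /orP[|/eqP//].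
have /andP[_ a1] := al01 w.
by rewrite gt_eqF// divr_gt0// subr_gt0.
Qed.

Lemma chain_covC k l : chain_cov k l = chain_cov l k.
Proof. by apply: eq_Ex => w; rewrite addnC. Qed.

Definition limit_sigma : R := Num.sqrt (Ex P0 (fun w => vlim lambda (alpha w))).

Let Ev0 : 0 <= Ex P0 (fun w => vlim lambda (alpha w)).
Proof. by apply: Ex_ge0 => w; exact: vlim_ge0. Qed.

Lemma charf_limit m (t c : 'I_m -> R) : (forall i, 0 <= t i) ->
  charf (scale_process limit_sigma B) t c =
  (expR (- (minform t c * Ex P0 (fun w => vlim lambda (alpha w)) / 2)))%:C.
Proof.
move=> t0; rewrite charf_scale wiener_charf// minformZ sqr_sqrtr//.
by rewrite [minform t c * _]mulrC.
Qed.

(** For a fixed horizon the central limit theorem over the copies averages the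
conditional covariances; then the variances of the Gaussian limits converge. *)
Lemma iterated_limit_copies_first :
  iterated_fdd_lim scaled (scale_process limit_sigma B).
Proof.
have [G [mG charG]] := gaussian_from_wiener chain_covC form_chain_cov_ge0 form_chain_cov_eq0 wB.
have charZ n m (t c : 'I_m -> R) : (forall i, 0 <= t i) ->
    charf (gauss_process mG n) t c =
    (expR (- (Ex P0 (fun w => cvar lambda (stepw t c n) (horizon t n) (alpha w)) / 2)))%:C.
  by move=> t0; rewrite charf_gauss_process// charG form_chain_cov.
have cin n m (t c : 'I_m -> R) : (forall i, 0 <= t i) ->
    normc (charf (scaled n N) t c - charf (gauss_process mG n) t c) @[N --> \oo] --> 0.
  move=> t0; rewrite charZ//; under eq_fun do rewrite charf_scaled//.
  apply: (phi_power_cvg lambda0 al01 inv2 _ _ (norm_stepw t c n)).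
  by rewrite mulr_ge0 ?sqrtV_ge0// sumr_ge0.
exists (gauss_process mG); split.
  move=> n _; apply: fdd_cvg_charf; first exact: cin.
  by move=> t t0; eexists => N s; exact: scaled_bound.
apply: fdd_cvg_charf.
- move=> m t c t0; rewrite charf_limit//.
  under eq_fun do rewrite charZ// -rmorphB normc_real.
  apply: dist0_cvg.
  apply: (@cvg_comp _ _ _ (fun n => - (Ex P0 (fun w => cvar lambda (stepw t c n) (horizon t n) (alpha w)) / 2)) expR);
    last exact: continuous_expR.
  apply: cvgN; apply: cvgM; last exact: cvg_cst.
  by rewrite mulrC; exact: Ex_cvar_stepw_cvg.
- move=> t t0; eexists => n s; rewrite charf1E.
  apply: (Re_bound_limit (cin n 1%N (fun=> t) (fun=> s) (fun=> t0))) => N.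
  by rewrite -charf1E; exact: scaled_bound.
Qed.

Lemma copies_cEx_prod (f : R -> C) N : cmf f -> (forall a, normc (f a) <= 1) ->
  cEx P (fun w => \prod_(j < N) f (alpha_ j w)) = cEx P0 (fun w => f (alpha w)) ^+ N.
Proof.
move=> mf f1.
have mZ j : measurable_fun [set: T] (alpha_path (alpha_ j) (X_ j)) by exact: measurable_alpha_path.
have mZ0 : measurable_fun [set: T0] (alpha_path alpha X) by exact: measurable_alpha_path.
have mg : cmf (fun p : R * path_space => f p.1) by exact: (cmf_comp measurable_fst mf).
transitivity (cEx P (fun w => \prod_(j <- index_iota 0 N) f (alpha_path (alpha_ j) (X_ j) w).1)).
  by apply: eq_cEx => w; rewrite big_mkord.
rewrite (independent_cEx_prod (f := fun=> fun p => f p.1) mZ copies.2)//; last exact: iota_uniq.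
have E j : cEx P (fun w => f (alpha_path (alpha_ j) (X_ j) w).1) = cEx P0 (fun w => f (alpha w)).
  exact: (law_cEx (mZ j) mZ0 (copies.1 j) (M := 1) mg (fun p => f1 p.1)).
under eq_bigr do rewrite E.
by rewrite prodr_const_nat subn0.
Qed.

(** Truncated like [rate], because of the copies of [alpha]. *)
Definition vlim01 (a : R) : R := if 0 < a < 1 then vlim lambda a else 0.

Lemma measurable_vlim01 : measurable_fun [set: R] vlim01.
Proof.
apply: measurable_fun_ifT => //; last exact: measurable_vlim.
by apply: measurable_and; exact: measurable_fun_ltr.
Qed.

Lemma vlim01_ge0 a : 0 <= vlim01 a.
Proof. by rewrite /vlim01; case: ifP => // a01; exact: vlim_ge0. Qed.

(** Given the copies of [alpha], this is the limiting variance at time [1] of the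
normalized sum of [N] copies. *)
Definition random_variance N (w : T) : R := sqrtV N ^+ 2 * \sum_(j < N) vlim01 (alpha_ j w).

Lemma measurable_random_variance N : measurable_fun [set: T] (random_variance N).
Proof.
apply: measurable_funM => //; apply: measurable_sum => j.
by apply: (measurableT_comp measurable_vlim01).
Qed.

Lemma random_variance_ge0 N w : 0 <= random_variance N w.
Proof. by rewrite mulr_ge0 ?sqr_ge0// sumr_ge0// => j _; exact: vlim01_ge0. Qed.

(** For fixed copies the limit is Gaussian given their values of [alpha], with a
variance that the law of large numbers makes deterministic in the end. *)
Lemma iterated_limit_horizon_first :
  iterated_fdd_lim (fun N n => scaled n N) (scale_process limit_sigma B).
Proof.
pose S N : {RV P >-> R} := mfun_Sub (mem_set (measurable_random_variance N)).
have S0 N w : 0 <= S N w by exact: random_variance_ge0.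
pose Z N := mixture_process B (S N).
have charZ N m (t c : 'I_m -> R) : (forall i, 0 <= t i) ->
    charf (Z N) t c = mixchar lambda alpha t c (sqrtV N) ^+ N.
  move=> t0; rewrite charf_mixture//.
  pose f a : C := (expR (- (sqrtV N ^+ 2 * (minform t c * vlim01 a) / 2)))%:C.
  have mf : cmf f.
    apply: cmf_real; apply: (measurableT_comp (@measurable_expR R)); apply: measurable_funN.
    apply: measurable_funM => //; apply: measurable_funM => //; apply: measurable_funM => //.
    exact: measurable_vlim01.
  have f1 a : normc (f a) <= 1.
    rewrite normc_real ger0_norm ?expR_ge0// expR_le1 oppr_le0 divr_ge0//.
    by rewrite mulr_ge0 ?sqr_ge0// mulr_ge0 ?vlim01_ge0// minform_ge0.
  transitivity (cEx P (fun w => \prod_(j < N) f (alpha_ j w))).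
    apply: eq_cEx => w; rewrite -rmorph_prod -expR_sum; congr ((expR _)%:C).
    rewrite sumrN -mulr_suml -mulr_sumr -mulr_sumr /S/= /random_variance; ring.
  rewrite copies_cEx_prod//; congr (_ ^+ _); apply: eq_cEx => w.
  by rewrite cexp_real /f /vlim01 al01.
have cin N m (t c : 'I_m -> R) : (forall i, 0 <= t i) ->
    normc (charf (scaled n N) t c - charf (Z N) t c) @[n --> \oo] --> 0.
  move=> t0; rewrite charZ//; under eq_fun do rewrite charf_scaled//.
  exact: (phi_stepw_power_cvg lambda0 al01 _ t0 N (sqrtV_ge0 N)).
exists Z; split.
  move=> N _; apply: fdd_cvg_charf; first exact: cin.
  by move=> t t0; eexists => n s; exact: scaled_bound.
apply: fdd_cvg_charf.
- move=> m t c t0; rewrite charf_limit//; under eq_fun do rewrite charZ//.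
  exact: (mixchar_power_cvg lambda0 al01 inv2 _ t0).
- move=> t t0; eexists => N s; rewrite charf1E.
  apply: (Re_bound_limit (cin N 1%N (fun=> t) (fun=> s) (fun=> t0))) => n.
  by rewrite -charf1E; exact: scaled_bound.
Qed.

Lemma limit_sigma_sqr : ((limit_sigma ^+ 2)%:E =
  lambda%:E * 'E_P0[fun w => ((1 + alpha w) * (1 - alpha w) ^- 2)%R])%E.
Proof.
rewrite sqr_sqrtr//.
have ie : itg P0 (fun w => (1 + alpha w) * (1 - alpha w)^-1 ^+ 2).
  have := itgZ lambda^-1 (itg_vlim lambda0 al01 inv2); congr (itg _ _).
  by apply/funext => w; rewrite /vlim mulKf// gt_eqF.
have -> : ('E_P0[fun w => ((1 + alpha w) * (1 - alpha w) ^- 2)%R] =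
    (Ex P0 (fun w => (1 + alpha w) * (1 - alpha w)^-1 ^+ 2)%R)%:E)%E.
  rewrite unlock -Ex_fin//; apply: eq_integral => w _.
  by rewrite exprVn.
by rewrite -EFinM; congr (_%:E); rewrite -ExZ.
Qed.

End aggregated_limits.

Theorem theorem4p11 (R : realType)
  (* the randomized INAR(1) process *)
  (d0 : measure_display) (T0 : measurableType d0) (P0 : probability T0 R)
  (lambda : R) (alpha : {RV P0 >-> R})
  (xi : nat -> nat -> {RV P0 >-> nat}) (eps : nat -> {RV P0 >-> nat})
  (X : nat -> {RV P0 >-> nat})
  (* the mixing density *)
  (psi : R -> R) (psi1 beta : R)
  (* the independent copies and their conditional means *)
  (d : measure_display) (T : measurableType d) (P : probability T R)
  (alpha_ : nat -> {RV P >-> R}) (X_ : nat -> nat -> {RV P >-> nat})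
  (m_ : nat -> nat -> {RV P >-> R})
  (B : process R) :
  0 < lambda ->
  randomized_INAR1 lambda alpha xi eps X ->
  has_density01 P0 alpha (fun x => psi x * (1 - x) `^ beta) ->
  psi x @[x --> 1^'-] --> psi1 ->
  0 < psi1 ->
  1 < beta ->
  independent_copies alpha X alpha_ X_ ->
  (forall j k, cond_exp P (alpha_ j) (fun w => (X_ j k w)%:R) (m_ j k)) ->
  standard_wiener B ->
  exists sigma : R,
    [/\ 0 <= sigma,
        ((sigma ^+ 2)%:E
         = lambda%:E * 'E_P0[fun w => ((1 + alpha w) * (1 - alpha w) ^- 2)%R])%E,
        iterated_fdd_lim
          (fun n N => scale_process (Num.sqrt (n * N)%N%:R)^-1
                        (aggregated X_ m_ N n))
          (scale_process sigma B) &
        iterated_fdd_lim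
          (fun N n => scale_process (Num.sqrt (n * N)%N%:R)^-1
                        (aggregated X_ m_ N n))
          (scale_process sigma B)].
Proof.
move=> lambda0 HX density psi_limit psi1_gt0 beta1 copies condm wB.
have inv2 := itg_inv1B_square (inar_alpha HX) density psi_limit psi1_gt0 beta1.
exists (limit_sigma lambda alpha); split.
- exact: sqrtr_ge0.
- exact: (limit_sigma_sqr lambda0 HX inv2).
- exact: (iterated_limit_copies_first lambda0 HX copies condm inv2 wB).
- exact: (iterated_limit_horizon_first lambda0 HX copies condm inv2 wB).
Qed.
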